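(* Let $N\ge 1$ and $T>0$. Assume that: (a) $u_0\in W^{1,\infty}(\mathbb{R}^N)$, $-1\le u_0\le 1$, and there exists $R_0>0$ such that $u_0(x)=-1$ for $|x|\ge R_0$; (b) $c_0\in C([0,T);L^1(\mathbb{R}^N))$ and $D_xc_0\in L^\infty([0,T);L^1(\mathbb{R}^N))$, with constants $M_0,L_0$ such that $|c_0(\cdot,t)|_{L^1(\mathbb{R}^N)}\le M_0$ and $|D_xc_0(\cdot,t)|_{L^1(\mathbb{R}^N)}\le L_0$ for (almost) every $t\in[0,T)$; (c) $c_1\in C(\mathbb{R}^N\times[0,T))$ and there exist constants $M_1,L_1$ such that $|c_1(x,t)|\le M_1$ and $|c_1(x,t)-c_1(y,t)|\le L_1|x-y|$ for all $x,y\in\mathbb{R}^N$, $t\in[0,T)$. Then there exists a weak solution $u$, on the time interval $[0,T)$, of the dislocation equation $$\frac{\partial u}{\partial t}=\bigl(c_0(\cdot,t)\star \mathbf 1_{\{u(\cdot,t)\ge 0\}}(x)+c_1(x,t)\bigr)|Du|\ \text{ in }\mathbb{R}^N\times(0,T),\qquad u(\cdot,0)=u_0\ \text{ in }\mathbb{R}^N .$$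
   Context: Notation: $c_0,c_1$ are real-valued; $\mathbf 1_A$ is the indicator function of $A$; $\star$ is convolution in space only: $(c_0(\cdot,t)\star f)(x)=\int_{\mathbb{R}^N}c_0(x-y,t)f(y)\,dy$. $Du$ is the gradient in $x$. **$L^1$-viscosity solutions.** Let $\bar c:\mathbb{R}^N\times(0,T)\to\mathbb{R}$ be defined for almost every $t$, continuous in $x$, measurable in $t$, with $|\bar c(x,t)|\le M$ and $|\bar c(x,t)-\bar c(y,t)|\le L|x-y|$ for all $x,y$ and a.e. $t$. An upper-semicontinuous (resp. lower-semicontinuous) function $v$ on $\mathbb{R}^N\times[0,T)$ is an $L^1$-viscosity subsolution (resp. supersolution) of $$v_t=\bar c(x,t)|Dv|\ \text{in }\mathbb{R}^N\times(0,T),\quad v(\cdot,0)=u_0,$$ if $v(\cdot,0)\le u_0$ (resp. $\ge u_0$) and if for every $(x_0,t_0)\in\mathbb{R}^N\times(0,T)$, $b\in L^1(0,T)$, $\varphi\in C^\infty(\mathbb{R}^N\times(0,T))$ and continuous $G:\mathbb{R}^N\times(0,T)\times\mathbb{R}^N\to\mathbb{R}$ such that (i) $(x,t)\mapsto v(x,t)-\int_0^t b(s)\,ds-\varphi(x,t)$ has a local maximum (resp. minimum) at $(x_0,t_0)$ over $\mathbb{R}^N\times(0,T)$, and (ii) for almost every $t$ in some neighborhood of $t_0$ and every $(x,p)$ in some neighborhood of $(x_0,p_0)$, $p_0=D\varphi(x_0,t_0)$, one has $\bar c(x,t)|p|-b(t)\le G(x,t,p)$ (resp. $\ge G(x,t,p)$),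 one has $\frac{\partial\varphi}{\partial t}(x_0,t_0)\le G(x_0,t_0,p_0)$ (resp. $\ge$). A locally bounded function is an $L^1$-viscosity solution if its upper-semicontinuous envelope is an $L^1$-viscosity subsolution and its lower-semicontinuous envelope is an $L^1$-viscosity supersolution. **Weak solutions.** A function $u\in W^{1,\infty}(\mathbb{R}^N\times[0,T))$ is a weak solution of the dislocation equation on $[0,T)$ if there is a measurable map $\chi:\mathbb{R}^N\times(0,T)\to[0,1]$ such that $u$ is an $L^1$-viscosity solution of $$\frac{\partial u}{\partial t}=\bar c(x,t)|Du|\ \text{in }\mathbb{R}^N\times(0,T),\quad u(\cdot,0)=u_0\ \text{in }\mathbb{R}^N,\qquad \bar c(x,t)=c_0(\cdot,t)\star\chi(\cdot,t)(x)+c_1(x,t),$$ and $\mathbf 1_{\{u(\cdot,t)>0\}}(x)\le\chi(x,t)\le\mathbf 1_{\{u(\cdot,t)\ge0\}}(x)$ for almost all $(x,t)\in\mathbb{R}^N\times(0,T)$. *)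

(* Defs.v *)
From HB Require Import structures.
From mathcomp Require Import all_boot all_order all_algebra.
From mathcomp Require Import all_classical all_reals all_analysis.

Set Implicit Arguments.
Unset Strict Implicit.
Unset Printing Implicit Defensive.

Import Order.TTheory GRing.Theory Num.Theory.
Import numFieldNormedType.Exports.

Local Open Scope classical_set_scope.
Local Open Scope ring_scope.

(* Lebesgue measure on R^n: the row vectors ['rV[R]_n] carry the product
   sigma-algebra (generated by the coordinates, as the library does for tuples),
   which is the Borel one, and the n-fold product of [lebesgue_measure]. *)
Definition rV_display : measure_display. Proof. exact: default_measure_display. Qed.

Section measurable_rV.
Context {R : realType} (n : nat).

Let coord (i : 'I_n) (x : 'rV[R]_n) : measurableTypeR R := x 0 i.

Let rV_set0 : g_sigma_preimage coord set0.
Proof. exact: sigma_algebra0. Qed.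

Let rV_setC A : g_sigma_preimage coord A -> g_sigma_preimage coord (~` A).
Proof. exact: sigma_algebraC. Qed.

Let rV_bigcup (F : _^nat) : (forall i, g_sigma_preimage coord (F i)) ->
  g_sigma_preimage coord (\bigcup_i (F i)).
Proof. exact: sigma_algebra_bigcup. Qed.

HB.instance Definition _ := @isMeasurable.Build rV_display
  'rV[R]_n (g_sigma_preimage coord) rV_set0 rV_setC rV_bigcup.

Lemma measurable_coord (i : 'I_n) :
  measurable_fun [set: 'rV[R]_n] (fun x : 'rV[R]_n => x 0 i).
Proof.
move=> _ Y mY; rewrite setTI; apply: sub_sigma_algebra => /=.
rewrite -bigcup_seq/=; exists i => /=; first by rewrite mem_index_enum.
by exists Y => //; rewrite setTI.
Qed.

Lemma measurable_fun_rV d (T : measurableType d) (f : T -> 'rV[R]_n) :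
  (forall i, measurable_fun [set: T] (fun t => f t 0 i)) ->
  measurable_fun [set: T] f.
Proof.
move=> mf; apply: (@measurability _ _ _ _ _ _
    (\big[setU/set0]_(i < n) preimage_set_system setT (coord i) measurable)) => //.
move=> _ [A + <-]; rewrite -bigcup_seq /= => -[i _ [B mB <-]].
by have := mf i measurableT B mB; rewrite !setTI.
Qed.

End measurable_rV.

Section lebesgue_rV.
Context {R : realType}.

Definition cons_rV n (p : R * 'rV[R]_n) : 'rV[R]_n.+1 :=
  row_mx (p.1)%:M p.2 : 'rV[R]_(1 + n).

Definition uncons_rV n (x : 'rV[R]_n.+1) : R * 'rV[R]_n :=
  (x 0 ord0, \row_i x 0 (lift ord0 i)).

Lemma cons_rVK n : cancel (@cons_rV n) (@uncons_rV n).
Proof.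
move=> [a v]; congr pair => /=.
  transitivity ((a%:M : 'M[R]_1) 0 0); last by rewrite mxE eqxx mulr1n.
  by rewrite -(row_mxEl (a%:M : 'M[R]_1) v 0 0); congr (_ 0 _); exact: val_inj.
by apply/rowP => i; rewrite mxE -[RHS](row_mxEr (a%:M : 'M[R]_1)) -rshift1.
Qed.

Lemma measurable_cons_rV n :
  measurable_fun [set: measurableTypeR R * 'rV[R]_n] (@cons_rV n).
Proof.
apply: measurable_fun_rV => i; rewrite /cons_rV.
have [j ->|->] := unliftP ord0 i.
  rewrite (_ : (fun _ => _) = (fun x : 'rV[R]_n => x 0 j) \o snd).
    exact: measurableT_comp (measurable_coord j) measurable_snd.
  by apply/funext => p; rewrite -[RHS](row_mxEr (p.1%:M : 'M[R]_1)) -rshift1.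
rewrite (_ : (fun _ => _) = fst); first exact: measurable_fst.
by apply/funext => -[a v] /=; have [] := cons_rVK (a, v).
Qed.

Lemma measurable_uncons_rV n :
  measurable_fun [set: 'rV[R]_n.+1]
    (@uncons_rV n : _ -> measurableTypeR R * 'rV[R]_n).
Proof.
apply/measurable_fun_pairP; split => /=; first exact: measurable_coord.
apply: measurable_fun_rV => i /=.
by under eq_fun do rewrite mxE; exact: measurable_coord.
Qed.

Section step.
Variables (n : nat) (mu : {sigma_finite_measure set 'rV[R]_n -> \bar R}).

Definition lebesgue_cons : set 'rV[R]_n.+1 -> \bar R :=
  pushforward (lebesgue_measure \x mu)%E (@cons_rV n).

HB.instance Definition _ := Measure.copy lebesgue_cons
  (measure_function_pushforward__canonical__measure_function_Measure
    (lebesgue_measure \x mu)%E (@measurable_cons_rV n)).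

Let sigma_finite_lebesgue_cons : sigma_finite [set: 'rV[R]_n.+1] lebesgue_cons.
Proof.
have [F FT Ffin] : sigma_finite setT (lebesgue_measure \x mu)%E.
  have /sigma_finiteP[F [FT ndF Ffin]] := sigma_finiteT (@lebesgue_measure R).
  have /sigma_finiteP[G [GT ndG Gfin]] := sigma_finiteT mu.
  exists (fun k => F k `*` G k).
    rewrite -setXTT FT GT; apply/seteqP; split=> [[x y] /=|].
      move=> [[i _ Fix] [j _ Gjy]]; exists (maxn i j) => //; split.
        by move: x Fix; exact/subsetPset/ndF/leq_maxl.
      by move: y Gjy; exact/subsetPset/ndG/leq_maxr.
    by move=> [x y] [k _ [/= Fkx Gky]]; split; exists k.
  move=> k; have [mF Fk] := Ffin k; have [mG Gk] := Gfin k.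
  split; first exact: measurableX.
  by rewrite product_measure1E// lte_mul_pinfty// ge0_fin_numE.
exists (fun k => @uncons_rV n @^-1` F k).
  by rewrite -preimage_bigcup -FT preimage_setT.
move=> k; have [mF Fk] := Ffin k; split.
  by have := measurable_uncons_rV measurableT mF; rewrite setTI.
rewrite /lebesgue_cons /pushforward -comp_preimage.
by rewrite (_ : _ \o _ = id)//; apply/funext => p; exact: cons_rVK.
Qed.

HB.instance Definition _ := Measure_isSigmaFinite.Build _ _ _ lebesgue_cons
  sigma_finite_lebesgue_cons.

End step.

Fixpoint lebesgue_rV n : {sigma_finite_measure set 'rV[R]_n -> \bar R} :=
  match n with
  | 0 => @dirac _ 'rV[R]_0 0 R
  | n'.+1 => lebesgue_cons (lebesgue_rV n')
  end.

End lebesgue_rV.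

Section function_spaces.
Context {R : realType}.

Definition enorm n (p : 'rV[R]_n) : R := Num.sqrt (\sum_(i < n) p 0 i ^+ 2).

Fixpoint iter_derive (V : normedModType R) (vs : seq V) (f : V -> R) : V -> R :=
  if vs is v :: vs' then fun x => 'D_v (iter_derive vs' f) x else f.

(* C^infinity on the open set [A] (in finite dimension): iterated directional
   derivatives of all orders exist and are continuous. *)
Definition smooth_on (V : normedModType R) (A : set V) (f : V -> R) :=
  forall vs x, A x -> {for x, continuous (iter_derive vs f)} /\
    forall v, derivable (iter_derive vs f) x v.

Definition test_function (V : normedModType R) (A : set V) (phi : V -> R) :=
  let supp := closure [set x | phi x != 0] in
  [/\ smooth_on setT phi, compact supp & supp `<=` A].

Definition ess_bounded d (X : measurableType d) (mu : {measure set X -> \bar R})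
    (A : set X) (f : X -> R) :=
  measurable_fun A f /\ exists M : R, \forall x \ae mu, A x -> `|f x| <= M.

(* Space-time points are pairs [(x, t)]. *)
Definition open_cylinder N (T : R) : set ('rV[R]_N * R) := setT `*` `]0, T[.
Definition cylinder N (T : R) : set ('rV[R]_N * R) := setT `*` `[0, T[.

Arguments open_cylinder N T : clear implicits.
Arguments cylinder N T : clear implicits.

(* [measurableTypeR R] is [R] with the convertible Borel sigma-algebra on which
   [lebesgue_measure] is declared. *)
Definition lebesgue_space_time N :
    {measure set ('rV[R]_N * measurableTypeR R) -> \bar R} :=
  (lebesgue_rV N \x lebesgue_measure)%E.

Definition dx {N} (i : 'I_N) : 'rV[R]_N * R := (delta_mx 0 i, 0).
Definition dt {N} : 'rV[R]_N * R := (0, 1).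

Definition space_gradient N (phi : 'rV[R]_N * R -> R) (z : 'rV[R]_N * R) :
  'rV[R]_N := \row_i 'D_(dx i) phi z.

Definition weak_gradient N (f : 'rV[R]_N -> R) (g : 'rV[R]_N -> 'rV[R]_N) :=
  forall phi, test_function setT phi -> forall i : 'I_N,
    \int[lebesgue_rV N]_x (f x * 'D_(delta_mx 0 i) phi x) =
    - \int[lebesgue_rV N]_x (g x 0 i * phi x).

Definition weak_space_time_gradient N (T : R) (u : 'rV[R]_N * R -> R)
    (g : 'rV[R]_N * R -> 'rV[R]_N) (h : 'rV[R]_N * R -> R) :=
  forall phi, test_function (open_cylinder N T) phi ->
    (forall i : 'I_N,
       \int[lebesgue_space_time N]_(z in open_cylinder N T)
         (u z * 'D_(dx i) phi z) =
       - \int[lebesgue_space_time N]_(z in open_cylinder N T)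
         (g z 0 i * phi z)) /\
    \int[lebesgue_space_time N]_(z in open_cylinder N T)
      (u z * 'D_dt phi z) =
    - \int[lebesgue_space_time N]_(z in open_cylinder N T) (h z * phi z).

(* Elements of W^{1,infty} are identified with their continuous
   representatives, which have pointwise values. *)
Definition W1infty N (f : 'rV[R]_N -> R) :=
  [/\ continuous f, ess_bounded (lebesgue_rV N) setT f &
    exists2 g, weak_gradient f g &
      forall i, ess_bounded (lebesgue_rV N) setT (fun x => g x 0 i)].

Definition W1infty_cylinder N (T : R) (u : 'rV[R]_N * R -> R) :=
  [/\ {within cylinder N T, continuous u},
      ess_bounded (lebesgue_space_time N) (open_cylinder N T) u &
    exists g h, [/\ weak_space_time_gradient T u g h,
      forall i, ess_bounded (lebesgue_space_time N) (open_cylinder N T)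
        (fun z => g z 0 i) &
      ess_bounded (lebesgue_space_time N) (open_cylinder N T) h]].

(* c in C([0,T); L^1(R^N)) *)
Definition continuous_L1 N (T : R) (c : R -> 'rV[R]_N -> R) :=
  forall t, t \in `[0, T[ ->
    (lebesgue_rV N).-integrable setT (EFin \o c t) /\
    \int[lebesgue_rV N]_x `|c s x - c t x| @[s --> within `[0, T[ (nbhs t)] --> 0.

(* [g] represents an element of L^infty([0,T); L^1(R^N; R^N)) of norm at most
   [L]; strong measurability in [t] amounts to joint measurability. *)
Definition Linfty_L1_bound N (T : R) (g : 'rV[R]_N * R -> 'rV[R]_N) (L : R) :=
  measurable_fun (cylinder N T) g /\
  \forall t \ae @lebesgue_measure R, t \in `[0, T[ ->
    (\int[lebesgue_rV N]_x (enorm (g (x, t)))%:E <= L%:E)%E.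

End function_spaces.
Arguments open_cylinder {R} N T _.
Arguments cylinder {R} N T _.

Section viscosity.
Context {R : realType} {N : nat}.
Implicit Types (T : R) (cbar : 'rV[R]_N -> R -> R)
  (v u : 'rV[R]_N * R -> R).

Definition upper_semicontinuous_on (D : set ('rV[R]_N * R)) v :=
  forall z a, D z -> v z < a -> \forall y \near within D (nbhs z), v y < a.

Definition lower_semicontinuous_on (D : set ('rV[R]_N * R)) v :=
  forall z a, D z -> a < v z -> \forall y \near within D (nbhs z), a < v y.

Definition locally_bounded_on (D : set ('rV[R]_N * R)) v :=
  forall z, D z -> exists M, \forall y \near within D (nbhs z), `|v y| <= M.

(* Semicontinuous envelopes relative to [D]; the filter is not punctured, so the
   value at the point is taken into account. *)
Definition usc_envelope (D : set ('rV[R]_N * R)) v (z : 'rV[R]_N * R) : R :=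
  fine (limf_esup (EFin \o v) (within D (nbhs z))).

Definition lsc_envelope (D : set ('rV[R]_N * R)) v (z : 'rV[R]_N * R) : R :=
  fine (limf_einf (EFin \o v) (within D (nbhs z))).

Definition admissible_velocity T cbar :=
  (forall x, measurable_fun `]0, T[ (cbar x)) /\
  exists M L : R, \forall t \ae @lebesgue_measure R, t \in `]0, T[ ->
    forall x y, `|cbar x t| <= M /\
      `|cbar x t - cbar y t| <= L * enorm (x - y).

Definition L1_subsolution T cbar (u0 : 'rV[R]_N -> R) v :=
  [/\ upper_semicontinuous_on (cylinder N T) v,
      forall x, v (x, 0) <= u0 x &
    forall (x0 : 'rV[R]_N) (t0 : R) (b : R -> R) (phi : 'rV[R]_N * R -> R)
        (G : 'rV[R]_N * R * 'rV[R]_N -> R),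
      let p0 := space_gradient phi (x0, t0) in
      t0 \in `]0, T[ ->
      lebesgue_measure.-integrable `]0, T[ (EFin \o b) ->
      smooth_on (open_cylinder N T) phi ->
      {in open_cylinder N T `*` setT, continuous G} ->
      let psi z := v z - \int[lebesgue_measure]_(s in `]0, z.2[) b s - phi z in
      (\forall z \near within (open_cylinder N T) (nbhs (x0, t0)),
         psi z <= psi (x0, t0)) ->
      (exists A B, [/\ nbhs t0 A, nbhs (x0, p0) B &
         \forall t \ae @lebesgue_measure R, A t -> forall x p, B (x, p) ->
           cbar x t * enorm p - b t <= G (x, t, p)]) ->
      'D_dt phi (x0, t0) <= G (x0, t0, p0)].

Definition L1_supersolution T cbar (u0 : 'rV[R]_N -> R) v :=
  [/\ lower_semicontinuous_on (cylinder N T) v,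
      forall x, u0 x <= v (x, 0) &
    forall (x0 : 'rV[R]_N) (t0 : R) (b : R -> R) (phi : 'rV[R]_N * R -> R)
        (G : 'rV[R]_N * R * 'rV[R]_N -> R),
      let p0 := space_gradient phi (x0, t0) in
      t0 \in `]0, T[ ->
      lebesgue_measure.-integrable `]0, T[ (EFin \o b) ->
      smooth_on (open_cylinder N T) phi ->
      {in open_cylinder N T `*` setT, continuous G} ->
      let psi z := v z - \int[lebesgue_measure]_(s in `]0, z.2[) b s - phi z in
      (\forall z \near within (open_cylinder N T) (nbhs (x0, t0)),
         psi (x0, t0) <= psi z) ->
      (exists A B, [/\ nbhs t0 A, nbhs (x0, p0) B &
         \forall t \ae @lebesgue_measure R, A t -> forall x p, B (x, p) ->
           G (x, t, p) <= cbar x t * enorm p - b t]) ->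
      G (x0, t0, p0) <= 'D_dt phi (x0, t0)].

Definition L1_viscosity_solution T cbar (u0 : 'rV[R]_N -> R) u :=
  [/\ admissible_velocity T cbar,
      locally_bounded_on (cylinder N T) u,
      L1_subsolution T cbar u0 (usc_envelope (cylinder N T) u) &
      L1_supersolution T cbar u0 (lsc_envelope (cylinder N T) u)].

Definition convolution (f g : 'rV[R]_N -> R) (x : 'rV[R]_N) : R :=
  \int[lebesgue_rV N]_y (f (x - y) * g y).

Definition dislocation_weak_solution T (c0 : R -> 'rV[R]_N -> R)
    (c1 : 'rV[R]_N * R -> R) (u0 : 'rV[R]_N -> R) u :=
  W1infty_cylinder T u /\
  exists chi : 'rV[R]_N * R -> R,
    [/\ measurable_fun (open_cylinder N T) chi,
        forall z, open_cylinder N T z -> 0 <= chi z <= 1,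
        L1_viscosity_solution T
          (fun x t => convolution (c0 t) (fun y => chi (y, t)) x + c1 (x, t))
          u0 u &
        \forall z \ae lebesgue_space_time N, open_cylinder N T z ->
          \1_[set z' | 0 < u z'] z <= chi z <= \1_[set z' | 0 <= u z'] z].

End viscosity.

(* Main.v *)
Require Import Defs.
From HB Require Import structures.
From mathcomp Require Import all_boot all_order all_algebra.
From mathcomp Require Import all_classical all_reals all_analysis.
From mathcomp Require Import measurable_realfun lra ring.
From mathcomp Require finmap.

(** Existence is obtained by constructing approximate fronts explicitly and passing to the limit,
    rather than by a fixed point theorem for the set-valued map that sends [chi] to the phases of the
    corresponding solution.

    The approximation. Time is cut into steps of length [h]. During a step the velocity is frozen: it
    is computed from the superlevel set of the front at the beginning of the step, and the front then
    moves by the Hopf-Lax formula, that is, [u] is replaced by its supremum (or infimum, where the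
    velocity is negative) over balls of radius [h |c|] ([front_step], [scheme]). The assumptions on
    [c0] and [c1] enter through uniform bounds on the velocity and on its Lipschitz constant in space
    ([velocity_estimates]): the gradient bound in [L^1] makes translations of [c0] Lipschitz in [L^1]
    ([L1_shift_le]), and the convolution with a function between 0 and 1 inherits this. Consequently
    the approximate fronts are Lipschitz in space, and in time along the grid, uniformly in [h], and
    equal to [-1] off a fixed cube ([scheme_lip], [scheme_time], [scheme_far]).

    The limit. Along an ultrafilter all bounded quantities converge, so the fronts have a limit [u],
    uniformly in space-time ([front_unif]). The indicators of the superlevel sets only have a weak-star
    limit [chi], whose existence follows from Radon-Nikodym ([weak_star_limit]). Uniform convergence of
    the fronts forces [chi = 1] almost everywhere where [u > 0] and [chi = 0] where [u < 0]
    ([front_chi]); the set where [u = 0] may have positive measure, and this is why the solution is weak.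

    The equation. Weak-star convergence of the indicators does not give pointwise convergence of the
    velocities in time, but their integrals over ]0, t[ converge, uniformly in [t], to those of the
    velocity associated with [chi] ([integral_velocity_unif]). Viscosity solutions in the [L^1] sense
    are stable under exactly this kind of convergence: test functions carry a term that is the
    primitive of an integrable function of time, and the difference of the velocities, multiplied by
    the norm of the gradient of the test function, can be absorbed in it ([scheme_stability]).
    Supersolutions follow by symmetry ([front_step_opp]).

    Finally the Lipschitz bounds on [u] provide bounded weak derivatives, as weak-star limits of
    difference quotients ([bounded_weak_derivative]). *)
Set Implicit Arguments.
Unset Strict Implicit.
Unset Printing Implicit Defensive.

Import Order.TTheory GRing.Theory Num.Theory.
Import numFieldNormedType.Exports.
Local Open Scope classical_set_scope.
Local Open Scope ring_scope.


(** * Borel structure and Euclidean norm on row vectors *)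

Section countable_base.
Context d (T : measurableType d) (X : topologicalType).
Variables (I : countType) (B : I -> set X) (f : T -> X).
Hypothesis mB : forall i, measurable (f @^-1` B i).
Hypothesis baseB : forall (O : set X) x, open O -> O x ->
  exists2 i, B i x & B i `<=` O.

(** The map [f] lets the measurable structure and the topology live on two types; below it is the
    identity between convertible carriers. *)
Lemma open_preimage_measurable (O : set X) : open O -> measurable (f @^-1` O).
Proof.
move=> oO; pose P i := B i `<=` O.
rewrite (_ : f @^-1` O =
    \bigcup_(i : I) (if `[< P i >] then f @^-1` B i else set0)).
  apply: countable_bigcupT_measurable => // i; by case: ifP.
apply/seteqP; split => x /=.
  by move=> /(baseB oO)[i Bi BO]; exists i => //; rewrite asboolT.
by move=> [i _]; case: asboolP => // + Bi; apply.
Qed.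

Lemma measurable_fun_continuous_comp (R : realType) (g : X -> R) :
  continuous g -> measurable_fun setT (g \o f).
Proof.
move=> cg; apply: (measurability _ (RGenOInfty.measurableE R)) => //.
move=> _ [_ [a ->] <-]; rewrite setTI comp_preimage.
apply: open_preimage_measurable; apply: open_comp; last exact: rray_open.
by move=> x _; exact: cg.
Qed.
End countable_base.

Section rV_borel.
Context {R : realType}.
Implicit Types n : nat.

Lemma rV_ball n (x y : 'rV[R]_n) e : 0 < e ->
  (forall i, `|x 0 i - y 0 i| < e) <-> ball x e y.
Proof.
move=> e0; split => [h|[_ h] i]; last exact: h.
by split => // i j; rewrite ord1; exact: h.
Qed.

Lemma rV_norm_le n (x : 'rV[R]_n) e : 0 <= e ->
  (forall i, `|x 0 i| <= e) <-> `|x| <= e.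
Proof.
move=> e0; rewrite [in X in _ <-> X]/Num.norm /= mx_normrE; split => [h|h i].
  by apply: bigmax_le => // -[i j] _ /=; rewrite ord1.
by apply: le_trans h; rewrite (le_bigmax _ (fun ij => `|x ij.1 ij.2|) (0, i)).
Qed.

Lemma rV_coord_le n (x : 'rV[R]_n) i : `|x 0 i| <= `|x|.
Proof. by have /rV_norm_le := lexx `|x|; apply; exact: normr_ge0. Qed.

(** With rational centres and radii [1 / (k + 1)], these boxes form a countable base. *)
Definition rat_box n (p : 'rV[rat]_n * nat) : set 'rV[R]_n :=
  [set y | forall i, `|ratr (p.1 0 i) - y 0 i| < p.2.+1%:R^-1].

Lemma measurable_rat_box n p : measurable (@rat_box n p).
Proof.
rewrite (_ : rat_box p = \bigcap_(i : 'I_n)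
    [set y : 'rV[R]_n | y 0 i \in `](ratr (p.1 0 i) - p.2.+1%:R^-1),
                                   (ratr (p.1 0 i) + p.2.+1%:R^-1)[%R]).
  apply: fin_bigcap_measurable => [|i _]; first exact: finite_finset.
  rewrite -[X in measurable X]setTI.
  exact: (measurable_coord i measurableT (measurable_itv _)).
apply/seteqP; split => y /= h i; last first.
  by have := h i I; rewrite /= in_itv/= ltr_distlC.
by move=> _; rewrite /= in_itv/= -ltr_distlC.
Qed.

Lemma rat_box_sub n (x : 'rV[R]_n) e : 0 < e ->
  exists2 p, rat_box p x & rat_box p `<=` ball x e.
Proof.
move=> e0.
have [k ke] : exists k : nat, k.+1%:R^-1 < e / 2.
  exists (Num.truncn (e / 2)^-1); rewrite invf_plt ?posrE ?divr_gt0//.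
  exact: truncnS_gt.
have /choice[q qP] : forall i : 'I_n, exists q : rat,
    `|ratr q - x 0 i| < k.+1%:R^-1.
  move=> i; have [|q] := @rat_in_itvoo R (x 0 i - k.+1%:R^-1) (x 0 i + k.+1%:R^-1).
    by rewrite ltrBlDr -addrA ltrDl addr_gt0// invr_gt0.
  by rewrite in_itv/= => h; exists q; rewrite distrC ltr_distlC.
exists (\row_i q i, k) => [i|y yq]; first by rewrite /= mxE.
apply/rV_ball => // i; have := yq i; rewrite /= mxE => h.
rewrite [ltRHS](splitr e) (le_lt_trans (ler_distD (ratr (q i)) _ _))//.
by rewrite ltrD// distrC ?(lt_trans (qP i))// (lt_trans _ ke)// distrC.
Qed.

Lemma rV_continuous_measurable n (g : 'rV[R]_n -> R) :
  continuous g -> measurable_fun setT g.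
Proof.
move=> cg; apply: (@measurable_fun_continuous_comp _ _ _ _ (@rat_box n) id) => //.
  exact: measurable_rat_box.
move=> O x oO Ox; have /nbhs_ballP[e /= e0 eO] : nbhs x O by exact: open_nbhs_nbhs.
by have [p px pe] := rat_box_sub x e0; exists p => // y /pe/eO.
Qed.

Lemma rVR_continuous_measurable n (g : 'rV[R]_n * R -> R) :
  continuous g ->
  measurable_fun [set: 'rV[R]_n * measurableTypeR R] g.
Proof.
(* the time axis is seen as the row vectors of length one, to reuse the rational boxes *)
move=> cg; pose B (p : ('rV[rat]_n * nat) * ('rV[rat]_1 * nat)) :
  set ('rV[R]_n * R) := rat_box p.1 `*` ((fun t => \row__ t) @^-1` rat_box p.2).
apply: (@measurable_fun_continuous_comp _ ('rV[R]_n * measurableTypeR R)%type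
  _ _ B id) => //.
  move=> p; apply: measurableX; first exact: measurable_rat_box.
  rewrite (_ : _ @^-1` _ = [set t | `|ratr (p.2.1 0 0) - t| < p.2.2.+1%:R^-1]).
    rewrite (_ : [set _ | _] = [set` `](ratr (p.2.1 0 0) - p.2.2.+1%:R^-1),
                                   (ratr (p.2.1 0 0) + p.2.2.+1%:R^-1)[%R]).
      exact: measurable_itv.
    by apply/seteqP; split => t; rewrite /= in_itv/= ltr_distlC.
  apply/seteqP; split => t /= h; first by have := h 0; rewrite mxE.
  by move=> i; rewrite mxE ord1.
move=> O [x t] oO Oxt.
have /nbhs_ballP[e /= e0 eO] : nbhs (x, t) O by exact: open_nbhs_nbhs.
have [p px pe] := rat_box_sub x e0.
have [q qt qe] := rat_box_sub (\row_(_ < 1) t) e0.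
exists (p, q) => // -[y s] [/= /pe ye /qe se]; apply: eO; split => //=.
have /rV_ball := se; move=> /(_ e0)/(_ 0); rewrite !mxE.
by rewrite /ball/=.
Qed.

End rV_borel.

Section enorm.
Context {R : realType} {n : nat}.
Implicit Types x y p : 'rV[R]_n.

Definition dotp x y : R := \sum_(i < n) x 0 i * y 0 i.

Lemma enorm_ge0 x : 0 <= enorm x. Proof. exact: sqrtr_ge0. Qed.

Lemma sqr_enorm x : enorm x ^+ 2 = dotp x x.
Proof. by rewrite sqr_sqrtr ?sumr_ge0// => i _; rewrite sqr_ge0. Qed.

Lemma enorm0 : enorm (0 : 'rV[R]_n) = 0.
Proof. by rewrite /enorm big1 ?sqrtr0// => i _; rewrite mxE expr0n. Qed.

Lemma enormZ a x : enorm (a *: x) = `|a| * enorm x.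
Proof.
rewrite /enorm -sqrtr_sqr -sqrtrM ?sqr_ge0// mulr_sumr; congr Num.sqrt.
by apply: eq_bigr => i _; rewrite mxE exprMn.
Qed.

Lemma enormN x : enorm (- x) = enorm x.
Proof. by rewrite -scaleN1r enormZ normrN1 mul1r. Qed.

Lemma dotpDl x y z : dotp (x + y) z = dotp x z + dotp y z.
Proof. by rewrite -big_split/=; apply: eq_bigr => i _; rewrite mxE mulrDl. Qed.

Lemma dotpC x y : dotp x y = dotp y x.
Proof. by apply: eq_bigr => i _; rewrite mulrC. Qed.

Lemma dotpZl a x y : dotp (a *: x) y = a * dotp x y.
Proof. by rewrite mulr_sumr; apply: eq_bigr => i _; rewrite mxE mulrA. Qed.

Lemma enorm_eq0 x i : enorm x = 0 -> x 0 i = 0.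
Proof.
move=> x0; have : dotp x x = 0 by rewrite -sqr_enorm x0 expr0n.
move=> /psumr_eq0P h; have /eqP : x 0 i * x 0 i = 0.
  by apply: h => // j _; rewrite -expr2 sqr_ge0.
by rewrite mulf_eq0 orbb => /eqP.
Qed.

(** Cauchy-Schwarz: expand the square of [enorm y *: x - enorm x *: y]. *)
Lemma dotp_le x y : dotp x y <= enorm x * enorm y.
Proof.
have [x0|x0] := eqVneq (enorm x) 0.
  by rewrite x0 mul0r /dotp big1// => i _; rewrite enorm_eq0 ?mul0r.
have [y0|y0] := eqVneq (enorm y) 0.
  by rewrite y0 mulr0 /dotp big1// => i _; rewrite (enorm_eq0 _ y0) ?mulr0.
have {}x0 : 0 < enorm x by rewrite lt_neqAle eq_sym x0 enorm_ge0.
have {}y0 : 0 < enorm y by rewrite lt_neqAle eq_sym y0 enorm_ge0.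
pose z := enorm y *: x - enorm x *: y.
have : 0 <= dotp z z by rewrite -sqr_enorm sqr_ge0.
rewrite /z dotpDl !(dotpC _ (_ - _)) !dotpDl -!scaleNr !dotpZl.
rewrite !(dotpC _ (_ *: _)) !dotpZl -!sqr_enorm (dotpC y x).
move: x0 y0; set a := enorm x; set b := enorm y; set c := dotp x y => a0 b0.
move=> h; have {h} : 0 <= 2 * (a * b) * (a * b - c) by lra.
by rewrite pmulr_rge0 ?subr_ge0// !mulr_gt0.
Qed.

Lemma enormD x y : enorm (x + y) <= enorm x + enorm y.
Proof.
rewrite -ler_sqr ?nnegrE ?addr_ge0 ?enorm_ge0// sqr_enorm dotpDl.
rewrite !(dotpC _ (_ + _)) !dotpDl (dotpC y x) sqrrD -!sqr_enorm.
by have := dotp_le x y; lra.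
Qed.

Lemma enorm_dist z x y : enorm (x - y) <= enorm (x - z) + enorm (z - y).
Proof. by rewrite (le_trans _ (enormD _ _))// addrA subrK. Qed.

Lemma enormB x y : enorm (x - y) = enorm (y - x).
Proof. by rewrite -enormN opprB. Qed.

Lemma norm_le_enorm x : `|x| <= enorm x.
Proof.
apply/rV_norm_le; rewrite ?enorm_ge0// => i.
rewrite -ler_sqr ?nnegrE ?enorm_ge0// sqr_enorm /dotp (bigD1 i)//=.
by rewrite real_normK ?num_real// expr2 lerDl sumr_ge0// => j _; rewrite -expr2 sqr_ge0.
Qed.

Lemma coord_le_enorm x i : `|x 0 i| <= enorm x.
Proof. exact: le_trans (rV_coord_le x i) (norm_le_enorm x). Qed.

Lemma enorm_le_sum x : enorm x <= \sum_(i < n) `|x 0 i|.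
Proof.
rewrite -ler_sqr ?nnegrE ?enorm_ge0 ?sumr_ge0// sqr_enorm expr2 mulr_suml.
apply: ler_sum => i _; rewrite (le_trans (ler_norm _))// normrM ler_wpM2l//.
by rewrite (bigD1 i)//= lerDl sumr_ge0.
Qed.

Lemma enorm_le_norm x : enorm x <= n%:R * `|x|.
Proof.
rewrite (le_trans (enorm_le_sum x))// mulr_natl -[n in _ *+ n]card_ord -sumr_const.
by apply: ler_sum => i _; exact: rV_coord_le.
Qed.

End enorm.


(** * Invariance of Lebesgue measure *)

Section preserving.
Context {R : realType}.

Definition preserves d (T : measurableType d) (mu : set T -> \bar R) (f : T -> T) :=
  measurable_fun setT f /\ forall A, measurable A -> mu (f @^-1` A) = mu A.

Lemma preserves_comp d (T : measurableType d) (mu : set T -> \bar R) f g :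
  preserves mu f -> preserves mu g -> preserves mu (f \o g).
Proof.
move=> [mf pf] [mg pg]; split; first exact: measurableT_comp.
move=> A mA; rewrite comp_preimage pg ?pf//.
by have := mf measurableT A mA; rewrite setTI.
Qed.

Section integral.
Context d (T : measurableType d) (mu : {measure set T -> \bar R}) (f : T -> T).
Hypothesis pf : preserves mu f.

Lemma integral_preserves_ge0 (F : T -> \bar R) : measurable_fun setT F ->
  (forall x, 0 <= F x)%E -> (\int[mu]_x F (f x) = \int[mu]_x F x)%E.
Proof.
move=> mF F0; have [mf muf] := pf.
have := @ge0_integral_pushforward _ _ _ _ R _ mf mu setT F measurableT.
rewrite preimage_setT => <- //.
pose m := measure_function_pushforward__canonical__measure_function_Measure mu mf.
rewrite -[in LHS]/(integral m _ _).
by apply: eq_measure_integral => A mA _; rewrite -muf.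
Qed.

Lemma integral_preserves (F : T -> \bar R) : measurable_fun setT F ->
  (\int[mu]_x F (f x) = \int[mu]_x F x)%E.
Proof.
move=> mF; rewrite integralE [RHS]integralE.
congr (_ - _)%E.
  rewrite (_ : (fun x => F (f x))^\+%E = F^\+%E \o f).
    by apply: (@integral_preserves_ge0 (F^\+)%E) => //; exact: measurable_funepos.
  by apply/funext => x; rewrite /= !funeposE.
rewrite (_ : (fun x => F (f x))^\-%E = F^\-%E \o f).
  by apply: (@integral_preserves_ge0 (F^\-)%E) => //; exact: measurable_funeneg.
by apply/funext => x; rewrite /= !funenegE.
Qed.

Lemma integrable_preserves (F : T -> \bar R) : mu.-integrable setT F ->
  mu.-integrable setT (F \o f).
Proof.
move=> /integrableP[mF iF]; apply/integrableP; split.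
  by apply: measurableT_comp => //; case: pf.
by have := @integral_preserves_ge0 (fun x => `|F x|)%E; rewrite /= => -> //;
  exact: measurableT_comp.
Qed.

Lemma Rintegral_preserves (F : T -> R) : measurable_fun setT F ->
  \int[mu]_x F (f x) = \int[mu]_x F x.
Proof.
move=> mF; congr fine; apply: (integral_preserves (F := EFin \o F)).
exact/measurable_EFinP.
Qed.
End integral.

Lemma preserves_prod d1 d2 (T1 : measurableType d1) (T2 : measurableType d2)
    (m1 : {sigma_finite_measure set T1 -> \bar R})
    (m2 : {sigma_finite_measure set T2 -> \bar R}) f g :
  preserves m1 f -> preserves m2 g ->
  preserves (m1 \x m2)%E (fun z => (f z.1, g z.2)).
Proof.
move=> [mf pf] [mg pg].
have mfg : measurable_fun setT (fun z : T1 * T2 => (f z.1, g z.2)).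
  apply/measurable_fun_pairP; split => /=.
    exact: measurableT_comp mf measurable_fst.
  exact: measurableT_comp mg measurable_snd.
split => // A mA; apply/esym.
pose m := measure_function_pushforward__canonical__measure_function_Measure
  (m1 \x m2)%E mfg.
suff h : forall B C, measurable B -> measurable C -> m (B `*` C) = (m1 B * m2 C)%E.
  exact: product_measure_unique h A mA.
move=> B C mB mC /=; rewrite /pushforward.
rewrite (_ : _ @^-1` _ = (f @^-1` B) `*` (g @^-1` C))//.
rewrite product_measure1E.
- by congr (_ * _)%E; [exact: pf|exact: pg].
- by rewrite -[X in measurable X]setTI; exact: mf.
- by rewrite -[X in measurable X]setTI; exact: mg.
Qed.

Lemma lebesgue_shift (a : R) :
  preserves (@lebesgue_measure R) (fun x : measurableTypeR R => x + a : measurableTypeR R).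
Proof.
have ms : measurable_fun setT (fun x : measurableTypeR R => x + a : measurableTypeR R).
  exact: (measurable_funD (@measurable_id _ _ _) (@measurable_cst _ _ _ _ _ a)).
split => // A mA; apply/esym.
pose m : {measure set (measurableTypeR R) -> \bar R} :=
  measure_function_pushforward__canonical__measure_function_Measure
  (@lebesgue_measure R) ms.
suff h : forall X, ocitv X -> lebesgue_measure X = m X.
  exact: (lebesgue_measure_unique h mA).
move=> _ [[x y] _ <-] /=; rewrite /m/= /pushforward.
rewrite (_ : _ @^-1` _ = `](x - a), (y - a)]%classic); last first.
  by apply/seteqP; split => z; rewrite /= !in_itv/= ltrBlDr lerBrDr.
rewrite !lebesgue_measure_itv/= !lte_fin ltrD2r.
by case: ifP => // _; rewrite -!EFinB; congr EFin; ring.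
Qed.

Lemma lebesgue_opp :
  preserves (@lebesgue_measure R) (-%R : measurableTypeR R -> measurableTypeR R).
Proof.
split; last by move=> A mA; exact: lebesgue_measureN.
exact: oppr_measurable.
Qed.

Lemma cons_rV0 n (p : R * 'rV[R]_n) : cons_rV p 0 ord0 = p.1.
Proof. exact: (congr1 fst (cons_rVK p)). Qed.

Lemma cons_rVS n (p : R * 'rV[R]_n) i : cons_rV p 0 (lift ord0 i) = p.2 0 i.
Proof. by rewrite -[in RHS](cons_rVK p) /uncons_rV /= mxE. Qed.

Lemma preserves_cons n (f : R -> R) (g : 'rV[R]_n -> 'rV[R]_n)
    (h : 'rV[R]_n.+1 -> 'rV[R]_n.+1) :
  preserves (@lebesgue_measure R) (f : measurableTypeR R -> measurableTypeR R) ->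
  preserves (@lebesgue_rV R n) g ->
  (forall p, h (cons_rV p) = cons_rV (f p.1, g p.2)) -> measurable_fun setT h ->
  preserves (@lebesgue_rV R n.+1) h.
Proof.
move=> pf pg hE mh; split => // A mA.
have [_ pfg] := preserves_prod pf pg.
rewrite /= /lebesgue_cons /pushforward -[RHS]pfg; last first.
  by rewrite -[X in measurable X]setTI; exact: measurable_cons_rV.
by congr (_ _); apply/seteqP; split => z /=; rewrite hE.
Qed.

(** The measure on row vectors is built by adding coordinates one at a time, so that invariance
    under coordinatewise maps follows by induction from the uniqueness of product measures. *)
Lemma preserves_rV n (f : 'I_n -> R -> R) :
  (forall i, preserves (@lebesgue_measure R)
    (f i : measurableTypeR R -> measurableTypeR R)) ->
  preserves (@lebesgue_rV R n) (fun x => \row_i f i (x 0 i)).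
Proof.
elim: n f => [|n ih] f pf.
  split; first by apply: measurable_fun_rV; case.
  move=> A mA /=; congr dirac; apply/seteqP.
  by split => x /=; rewrite [x]thinmx0 (_ : \row_i _ = 0)// [LHS]thinmx0.
apply: (preserves_cons (f := f ord0) (g := fun x => \row_i f (lift ord0 i) (x 0 i))) => //.
- by have := ih (fun i => f (lift ord0 i)) (fun i => pf _).
- move=> p; apply/rowP => i; rewrite mxE.
  have [j ->|->] := unliftP ord0 i; last by rewrite !cons_rV0.
  by rewrite !cons_rVS mxE.
apply: measurable_fun_rV => i.
rewrite (_ : (fun _ => _) = f i \o (fun x : 'rV[R]_n.+1 => x 0 i)); last first.
  by apply/funext => x /=; rewrite mxE.
by apply: measurableT_comp (measurable_coord i); case: (pf i).
Qed.

End preserving.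

Section shifts.
Context {R : realType}.

Lemma rV_shift n (a : 'rV[R]_n) : preserves (lebesgue_rV n) (fun x => x + a).
Proof.
have := @preserves_rV R n (fun i t => t + a 0 i) (fun i => lebesgue_shift _).
by congr preserves; apply/funext => x; apply/rowP => i; rewrite !mxE.
Qed.

Lemma rV_opp n : preserves (@lebesgue_rV R n) -%R.
Proof.
have := @preserves_rV R n (fun i t => - t) (fun i => lebesgue_opp).
by congr preserves; apply/funext => x; apply/rowP => i; rewrite !mxE.
Qed.

Lemma rV_reflect n (a : 'rV[R]_n) : preserves (lebesgue_rV n) (fun x => a - x).
Proof.
have := preserves_comp (rV_shift a) (@rV_opp n).
by congr preserves; apply/funext => x /=; rewrite addrC.
Qed.

Lemma space_time_shift n (a : 'rV[R]_n * R) :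
  preserves (lebesgue_space_time n : set ('rV[R]_n * measurableTypeR R) -> \bar R)
    (fun z => z + a).
Proof. exact: preserves_prod (rV_shift a.1) (lebesgue_shift a.2). Qed.

Definition cube n (r : R) : set 'rV[R]_n := [set x | forall i, `|x 0 i| <= r].

Lemma measurable_cube n r : measurable (@cube n r).
Proof.
rewrite (_ : cube r = \bigcap_(i : 'I_n) [set x : 'rV[R]_n | x 0 i \in `[(- r), r]%R]).
  apply: fin_bigcap_measurable => [|i _]; first exact: finite_finset.
  rewrite -[X in measurable X]setTI.
  exact: (measurable_coord i measurableT (measurable_itv _)).
apply/seteqP; split => x /= h i; last first.
  by have := h i I; rewrite /= in_itv/= -ler_norml.
by move=> _; rewrite /= in_itv/= -ler_norml.
Qed.

Lemma lebesgue_cube n r : (lebesgue_rV n (@cube n r) < +oo)%E.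
Proof.
elim: n => [|n ih]; first by rewrite /= ltry.
rewrite /= /lebesgue_cons /pushforward.
rewrite (_ : _ @^-1` _ = `[(- r), r]%classic `*` @cube n r).
  rewrite product_measure1E//; last exact: measurable_cube.
  have h : (lebesgue_measure (`[(- r)%R, r%R]%classic : set (measurableTypeR R)) < +oo)%E.
    by rewrite lebesgue_measure_itv/= -EFinB; case: ifP => // _; exact: ltry.
  by apply: lte_mul_pinfty => //; rewrite ge0_fin_numE.
apply/seteqP; split => -[a v] /=.
  move=> h; split; first by rewrite in_itv/= -ler_norml; have := h ord0; rewrite cons_rV0.
  by move=> i; have := h (lift ord0 i); rewrite cons_rVS.
rewrite in_itv/= -ler_norml => -[ar vr] i.
by have [j ->|->] := unliftP ord0 i; rewrite ?cons_rV0// cons_rVS; exact: vr.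
Qed.

End shifts.


(** * Smooth bump functions *)

Section Ck.
Context {R : realType} {V : normedModType R}.
Implicit Types (f g : V -> R) (k : nat).

(** Recursion on the order is what makes products tractable: differentiating a product once leaves
    products of functions that are one order less regular. *)
Fixpoint Ck k f : Prop := continuous f /\
  if k is k'.+1 then forall v, (forall x, derivable f x v) /\ Ck k' ('D_v f)
  else True.

Definition smooth f := forall k, Ck k f.

Lemma CkW k f : Ck k.+1 f -> Ck k f.
Proof.
elim: k f => [|k ih] f [cf h]; split => // v.
by have [df Df] := h v; split => //; exact: ih.
Qed.

Lemma smooth_continuous f : smooth f -> continuous f.
Proof. by move=> /(_ 0%N)[]. Qed.

Lemma smooth_derivable f x v : smooth f -> derivable f x v.
Proof. by move=> /(_ 1%N)[_ /(_ v)[]]. Qed.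

Lemma smooth_derive f v : smooth f -> smooth ('D_v f).
Proof. by move=> sf k; have [_ /(_ v)[]] := sf k.+1. Qed.

Lemma smooth_iter f vs : smooth f -> smooth (iter_derive vs f).
Proof. by elim: vs => //= v vs ih sf; apply: smooth_derive; exact: ih. Qed.

Lemma smoothP f : smooth f <-> smooth_on setT f.
Proof.
split=> [sf vs x _|sf k].
  split=> [|v]; first exact: (smooth_continuous (smooth_iter vs sf)).
  by apply: smooth_derivable; exact: smooth_iter.
suff : forall vs, Ck k (iter_derive vs f) by move=> /(_ [::]).
elim: k => [|k ih] vs; split=> //; try by move=> x; exact: (sf vs x I).1.
move=> v; split; first by move=> x; exact: (sf vs x I).2.
exact: (ih (v :: vs)).
Qed.

Lemma Ck_add k f g : Ck k f -> Ck k g -> Ck k (f \+ g).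
Proof.
elim: k f g => [|k ih] f g [cf hf] [cg hg].
  by split=> // x; apply: continuousD; [exact: cf|exact: cg].
split=> [x|v]; first by apply: continuousD; [exact: cf|exact: cg].
have [df Df] := hf v; have [dg Dg] := hg v.
split=> [x|]; first exact: derivableD.
rewrite (_ : 'D_v _ = 'D_v f \+ 'D_v g); first exact: ih.
by apply/funext => x; rewrite deriveD.
Qed.

Lemma Ck_mul k f g : Ck k f -> Ck k g -> Ck k (f \* g).
Proof.
elim: k f g => [|k ih] f g.
  by move=> [cf _] [cg _]; split=> // x; apply: continuousM; [exact: cf|exact: cg].
move=> Cf Cg; have [cf hf] := Cf; have [cg hg] := Cg.
split=> [x|v]; first by apply: continuousM; [exact: cf|exact: cg].
have [df Df] := hf v; have [dg Dg] := hg v.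
split=> [x|]; first exact: derivableM.
rewrite (_ : 'D_v _ = (f \* 'D_v g) \+ (g \* 'D_v f)).
  by apply: Ck_add; apply: ih => //; exact: CkW.
by apply/funext => x; rewrite deriveM.
Qed.

Lemma Ck_cst k (c : R) : Ck k (fun _ : V => c).
Proof.
elim: k c => [|k ih] c; first by split => // x; exact: cst_continuous.
split=> [x|v]; first exact: cst_continuous.
split=> [x|]; first exact: derivable_cst.
rewrite (_ : 'D_v _ = cst 0); first exact: ih.
by apply/funext => x; rewrite derive_cst.
Qed.

Lemma smooth_mul f g : smooth f -> smooth g -> smooth (fun x => f x * g x).
Proof. by move=> sf sg k; exact: Ck_mul. Qed.

Lemma smooth_compl f : smooth f -> smooth (fun x => 1 - f x).
Proof.
move=> sf k; rewrite (_ : (fun _ => _) = (cst 1) \+ ((cst (-1)) \* f)).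
  by apply: Ck_add; [exact: Ck_cst|apply: Ck_mul => //; exact: Ck_cst].
by apply/funext => x /=; rewrite mulN1r.
Qed.

Lemma smooth_prod (I : Type) (r : seq I) (F : I -> V -> R) :
  (forall i, smooth (F i)) -> smooth (fun x => \prod_(i <- r) F i x).
Proof.
move=> sF; elim: r => [|i r ih].
  rewrite (_ : (fun _ => _) = cst 1); first by move=> k; exact: Ck_cst.
  by apply/funext => x; rewrite big_nil.
rewrite (_ : (fun _ => _) = fun x => F i x * \prod_(j <- r) F j x).
  exact: smooth_mul.
by apply/funext => x; rewrite big_cons.
Qed.
End Ck.

Section flat_exp.
Context {R : realType}.

(** The functions [P(1/s) exp(-1/s)] on the half-line. Taking all polynomials [P] at once gives
    a family that is stable under differentiation, hence made of smooth functions. *)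
Definition flat (p : {poly R}) (s : R) : R :=
  if 0 < s then p.[s^-1] * expR (- s^-1) else 0.

(** With [y = 1/s], the monomial [y ^+ i] is beaten by [exp y >= y ^+ (i + 2) / (i + 2)!]; the
    decay in [s ^+ 2] then gives the derivative at 0. *)
Lemma flat_bound p : exists2 C : R, 0 <= C & forall s, `|flat p s| <= C * s ^+ 2.
Proof.
exists (\sum_(i < size p) `|p`_i| * (i.+2)`!%:R).
  by apply: sumr_ge0 => i _; rewrite mulr_ge0.
move=> s; rewrite /flat; case: ifPn => [s0|_]; last first.
  by rewrite normr0 mulr_ge0 ?sqr_ge0// sumr_ge0// => i _; rewrite mulr_ge0.
set y := s^-1; have y0 : 0 < y by rewrite invr_gt0.
rewrite -[s]invrK -/y exprVn ler_pdivlMr ?exprn_gt0// normrM.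
rewrite (gtr0_norm (expR_gt0 _)) expRN -mulrA (mulrC _ (y ^+ 2)).
rewrite horner_coef (le_trans (ler_wpM2r _ (ler_norm_sum _ _ _)))//.
  by rewrite mulr_ge0 ?invr_ge0 ?expR_ge0// exprn_ge0// ltW.
rewrite mulr_suml; apply: ler_sum => i _.
rewrite normrM -mulrA ler_wpM2l// normrX (gtr0_norm y0) mulrA.
rewrite ler_pdivrMr ?expR_gt0// -exprD addn2 mulrC -ler_pdivrMr ?ltr0n ?fact_gt0//.
by rewrite (le_trans _ (expR_ge1Dxn i.+1 (ltW y0)))// lerDr.
Qed.

Lemma is_derive_flat p (s : R) :
  is_derive s 1 (flat p) (flat ('X^2 * (p - p^`())) s).
Proof.
have [s0|s0|->] := ltrgtP s 0.
- rewrite /flat (ltNge 0 s) (ltW s0)/=.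
  apply: (near_eq_is_derive (f := cst 0)).
  near=> t; rewrite ltNge ltW//; near: t; exact: lt_nbhsl.
- rewrite {2}/flat s0.
  apply: (@near_eq_is_derive R R R (fun t => p.[t^-1] * expR (- t^-1))).
    near=> t; rewrite /flat ifT//; near: t; exact: lt_nbhsr.
  have sn0 : s != 0 by rewrite gt_eqF.
  have dV : is_derive s 1 (fun t : R => t^-1) (- s ^- 2).
    by apply: is_derive_eq; first exact: (is_deriveV (f := id)); rewrite [_ *: _]mulr1.
  have dp := @is_derive1_comp R (horner p) _ s _ _ (is_derive_poly p s^-1) dV.
  have de := @is_derive1_comp R (expR \o -%R) _ s _ _
    (@is_derive1_comp R expR -%R s^-1 _ _ (is_derive_expR _) (is_deriveNid _ _)) dV.
  apply: (is_derive_eq (is_deriveM dp de)).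
  rewrite /= hornerM hornerXn hornerD hornerN /GRing.scale/= exprVn.
  by ring.
- have [C C0 hC] := flat_bound p.
  have -> : flat ('X^2 * (p - p^`())) 0 = 0 by rewrite /flat ltxx.
  have h0 : (fun h => h^-1 *: ((flat p \o shift 0) (h *: 1) - flat p 0)) @ 0^' --> (0 : R).
    have C1 : 0 < C + 1 by rewrite (lt_le_trans ltr01)// lerDr.
    apply/cvgrPdist_le => e e0; have eC : 0 < e / (C + 1) by rewrite divr_gt0.
    near=> h.
    rewrite sub0r normrN /= addr0 {2}/flat ltxx subr0 scaler1.
    rewrite normrZ normfV ler_pdivrMl ?normr_gt0//; last by near: h; exact: nbhs_dnbhs_neq.
    rewrite (le_trans (hC _))// -real_normK ?num_real// expr2 mulrCA ler_wpM2l//.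
    have he : `|h| <= e / (C + 1).
      by near: h; exact: dnbhs0_le.
    rewrite (le_trans (ler_wpM2l C0 he))// mulrA ler_pdivrMr// mulrC.
    by rewrite ler_wpM2l ?lerDl// ltW.
  by apply: DeriveDef; [apply/cvg_ex; exists 0|exact: cvg_lim].
Unshelve. all: by end_near.
Qed.
End flat_exp.

Section bumps.
Context {R : realType} {n : nat}.
Local Notation V := 'rV[R]_n.

Lemma coordP_is_derive (p : {poly R}) (a b : R) i (x v : V) :
  is_derive x v (fun y => flat p (a * (y 0 i) + b))
    (a * v 0 i * flat ('X^2 * (p - p^`())) (a * x 0 i + b)).
Proof.
pose g (h : R) := a * (h * v 0 i + x 0 i) + b.
have dg : is_derive (0 : R) 1 g (a * v 0 i).
  rewrite (_ : g = ((a * v 0 i) \*: id) + cst (a * x 0 i + b)); last first.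
    by apply/funext => h; rewrite -[RHS]/(a * v 0 i * h + (a * x 0 i + b)) /g; ring.
  by apply: is_derive_eq; rewrite addr0 [LHS]mulr1.
have := @is_derive1_comp R (flat p) g 0 _ _ (is_derive_flat p _) dg.
move=> [d0 d1].
have E : (fun h => h^-1 *: (((fun y : V => flat p (a * (y 0 i) + b)) \o shift x) (h *: v)
             - flat p (a * x 0 i + b))) =
         (fun h => h^-1 *: (((flat p \o g) \o shift 0) (h *: 1) - (flat p \o g) 0)).
  apply/funext => h; rewrite /= /g !mxE mul0r add0r.
  by rewrite addr0 [h *: 1]mulr1.
have g0 : g 0 = a * x 0 i + b by rewrite /g mul0r add0r.
apply: DeriveDef; first by rewrite /derivable E.
by rewrite /derive E -[LHS]/('D_1 (flat p \o g) 0) d1 g0 mulrC.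
Qed.

Lemma smooth_flat_coord (a b : R) i :
  smooth (fun x : V => flat 1 (a * x 0 i + b)).
Proof.
suff h k p c : Ck k (fun x : V => c * flat p (a * x 0 i + b)).
  move=> k; have := h k 1 1; congr Ck; apply/funext => x; exact: mul1r.
have lin : continuous (fun x : V => a * x 0 i + b).
  move=> x; have cx : (fun y : V => y 0 i) @ x --> x 0 i.
    exact: (@coord_continuous R 1 n 0 i x).
  exact: (cvgD (cvgM (cvg_cst a) cx) (cvg_cst b)).
have cont q d : continuous (fun x : V => d * flat q (a * x 0 i + b)).
  move=> x; have cf : continuous (fun x : V => flat q (a * x 0 i + b)).
    move=> {}x; apply: (continuous_comp (lin x)).
    apply/differentiable_continuous/derivable1_diffP.
    by have [] := is_derive_flat q (a * x 0 i + b).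
  exact: (cvgM (cvg_cst d) (cf x)).
elim: k p c => [|k ih] p c; split => // v; split => [x|].
  by have [] := is_deriveZ c (coordP_is_derive p a b i x v).
rewrite (_ : 'D_v _ = fun x : V => (c * (a * v 0 i)) *
    flat ('X^2 * (p - p^`())) (a * x 0 i + b)); first exact: ih.
apply/funext => x; have [_ E] := is_deriveZ c (coordP_is_derive p a b i x v).
by rewrite -mulrA -[RHS]E.
Qed.

Lemma flat1_itv (s : R) : 0 <= flat 1 s <= 1.
Proof.
rewrite /flat hornerC mul1r; case: ifPn => [s0|]; last by rewrite lexx ler01.
by rewrite expR_ge0 /= -expR0 ler_expR oppr_le0 invr_ge0 ltW.
Qed.

Lemma flat1_gt0 (s : R) : 0 < s -> 0 < flat 1 s.
Proof. by move=> s0; rewrite /flat s0 hornerC mul1r expR_gt0. Qed.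

Lemma flat1_cvg1 (f : nat -> R) : f @ \oo --> +oo -> flat 1 (f k) @[k --> \oo] --> (1 : R).
Proof.
move=> foo; apply/cvgrPdist_le => e e0.
near=> k.
have fk : e^-1 + 1 <= f k by near: k; exact: (cvgryPge _).1.
have f0 : 0 < f k by rewrite (lt_le_trans _ fk)// addr_gt0// invr_gt0.
have := flat1_itv (f k); rewrite /flat f0 hornerC mul1r => /andP[_ h].
rewrite ger0_norm ?subr_ge0// lerBlDr.
have := expR_ge1Dx (- (f k)^-1); have : (f k)^-1 <= e; last by lra.
by rewrite invf_ple ?posrE// (le_trans _ fk)// lerDl.
Unshelve. all: by end_near.
Qed.

(** A bump supported in the cube of radius [b / a] around [y]: large [a] concentrates it at [y],
    large [b] brings it close to 1. *)
Definition tent (y : V) (a b : R) (x : V) : R :=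
  \prod_(i < n) (flat 1 (b + a * (x 0 i - y 0 i)) * flat 1 (b - a * (x 0 i - y 0 i))).

Lemma smooth_tent y a b : smooth (tent y a b).
Proof.
apply: smooth_prod => i; apply: smooth_mul.
  have := smooth_flat_coord a (b - a * y 0 i) i; congr smooth.
  by apply/funext => x; congr flat; ring.
have := smooth_flat_coord (- a) (b + a * y 0 i) i; congr smooth.
by apply/funext => x; congr flat; ring.
Qed.

Lemma tent_itv y a b x : 0 <= tent y a b x <= 1.
Proof.
apply/andP; split; first apply: prodr_ge0 => i _; last apply: prodr_ile1 => i _.
  by apply: mulr_ge0; exact: (andP (flat1_itv _)).1.
have /andP[? ?] := flat1_itv (b + a * (x 0 i - y 0 i)).
have /andP[? ?] := flat1_itv (b - a * (x 0 i - y 0 i)).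
by rewrite mulr_ge0//= mulr_ile1.
Qed.

Lemma tent_supp y a b x : tent y a b x != 0 -> forall i, `|a * (x 0 i - y 0 i)| < b.
Proof.
move=> /prodf_neq0 h i; have := h i isT; rewrite mulf_eq0 negb_or => /andP[].
rewrite /flat; case: ifPn => [h1|]; last by rewrite eqxx.
by case: ifPn => [h2 _ _|]; [rewrite ltr_norml; apply/andP; split; lra|rewrite eqxx].
Qed.

Lemma closed_cube r : closed (@cube R n r).
Proof.
have [r0|r0] := ltP r 0; last first.
  rewrite (_ : cube r = [set x : V | `|x| <= r]).
    apply: (@preimage_closed _ _ (fun x : V => `|x|) [set t | t <= r]).
      by move=> x _; exact: norm_continuous.
    exact: closed_le.
  by apply/seteqP; split => x /rV_norm_le; exact.
case: n => [|m].
  rewrite (_ : cube r = setT); first exact: closedT.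
  by apply/seteqP; split => // x _ [].
rewrite (_ : cube r = set0); first exact: closed0.
by apply/seteqP; split => // x /(_ ord0); rewrite leNgt (lt_le_trans r0).
Qed.

Lemma compact_cube r : compact (@cube R n r).
Proof.
apply: bounded_closed_compact; last exact: closed_cube.
exists `|r|; split; rewrite ?num_real// => M rM x xr.
apply/rV_norm_le; first by rewrite (le_trans _ (ltW rM)).
by move=> i; rewrite (le_trans (xr i))// (le_trans (ler_norm _)) ?ltW.
Qed.

Lemma smooth_test (phi : V -> R) r : smooth phi ->
  (forall x, phi x != 0 -> cube r x) -> test_function setT phi.
Proof.
move=> sphi h; split => //; first exact/smoothP.
apply: (@subclosed_compact _ _ (@cube R n r)).
- exact: closed_closure.
- exact: compact_cube.
- by rewrite (closure_id (cube r)).1; [exact: closure_subset|exact: closed_cube].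
Qed.
End bumps.


(** * Directional mean value theorem and Taylor bound *)

Section line.
Context {R : realType} {V : normedModType R}.
Implicit Types (f : V -> R) (x v : V) (s t : R).

Lemma is_derive_line f x v s t : derivable f (x + (t * s) *: v) v ->
  is_derive t 1 (fun r => f (x + (r * s) *: v)) (s * 'D_v f (x + (t * s) *: v)).
Proof.
move=> df; pose g r := f (x + r *: v).
have dg : is_derive (t * s) 1 g ('D_v f (x + (t * s) *: v)).
  have E : (fun h => h^-1 *: ((g \o shift (t * s)) (h *: 1) - g (t * s))) =
    (fun h => h^-1 *: ((f \o shift (x + (t * s) *: v)) (h *: v) - f (x + (t * s) *: v))).
    by apply/funext => h; rewrite /g /= [h *: 1]mulr1 scalerDl addrCA.
  by apply: DeriveDef; rewrite /derivable /derive E.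
have dl : is_derive t 1 (fun r : R => r * s) s.
  rewrite (_ : (fun r => _) = s \*: id); last by apply/funext => r; rewrite mulrC.
  by apply: is_derive_eq; rewrite [LHS]mulr1.
by rewrite mulrC; exact: (@is_derive1_comp R g (fun r => r * s)).
Qed.

Lemma line_MVT f x v s :
  (forall t, 0 <= t <= 1 -> derivable f (x + (t * s) *: v) v) ->
  exists2 t, 0 <= t <= 1 & f (x + s *: v) - f x = s * 'D_v f (x + (t * s) *: v).
Proof.
move=> df; have [||c] := @MVT_segment R (fun r => f (x + (r * s) *: v))
    (fun t => s * 'D_v f (x + (t * s) *: v)) 0 1 ler01.
- move=> t; rewrite in_itv/= => /andP[t0 t1]; apply: is_derive_line.
  by apply: df; rewrite !ltW.
- apply: derivable_within_continuous => t; rewrite in_itv/= => t01.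
  by have [] := is_derive_line (df t t01).
rewrite in_itv/= => c01; rewrite mul1r mul0r scale0r addr0 subr0 mulr1 => E.
by exists c.
Qed.

End line.

Section vanishing.
Context {R : realType} {V : normedModType R}.
Variables (K : set V) (cK : compact K).

Lemma vanish_bounded (f : V -> R) : continuous f ->
  (forall x, ~ K x -> f x = 0) -> exists2 B, 0 <= B & forall x, `|f x| <= B.
Proof.
move=> cf f0; have /compact_bounded[M [_ hM]] : compact (f @` K).
  by apply: continuous_compact => //; apply: continuous_subspaceT.
exists (`|M| + 1) => [|x]; first by rewrite addr_ge0.
have [Kx|/f0 ->] := pselect (K x); last by rewrite normr0 addr_ge0.
by apply: hM; [rewrite (le_lt_trans (ler_norm _))// ltrDl|exists x].
Qed.

Lemma vanish_derive (f : V -> R) v : (forall x, ~ K x -> f x = 0) ->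
  forall x, ~ K x -> 'D_v f x = 0.
Proof.
move=> f0 x nK; have : \forall y \near x, f y = 0.
  have oK : open (~` K).
    by rewrite openC; apply: compact_closed => //; exact: norm_hausdorff.
  by near=> y; apply: f0; near: y; exact: open_nbhs_nbhs.
move=> h; rewrite (@near_eq_derive _ _ _ f (cst 0))// derive_cst//.
Unshelve. all: by end_near.
Qed.

(** Two applications of the mean value theorem; the second derivative along [v] is bounded
    because it is continuous and vanishes off a compact set. *)
Lemma taylor_bound (phi : V -> R) v : smooth phi ->
  (forall x, ~ K x -> phi x = 0) ->
  exists2 B, 0 <= B & forall x s,
    `|phi (x + s *: v) - phi x - s * 'D_v phi x| <= s ^+ 2 * B.
Proof.
move=> sphi phi0; have s1 := smooth_derive v sphi; have s2 := smooth_derive v s1.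
have [|B B0 hB] := @vanish_bounded ('D_v ('D_v phi)) (smooth_continuous s2).
  exact/vanish_derive/vanish_derive.
exists B => // x s.
have [t /andP[t0 t1] ->] : exists2 t, 0 <= t <= 1 &
    phi (x + s *: v) - phi x = s * 'D_v phi (x + (t * s) *: v).
  by apply: line_MVT => t _; exact: smooth_derivable.
have [r _ E] : exists2 r, 0 <= r <= 1 &
    'D_v phi (x + (t * s) *: v) - 'D_v phi x
    = t * s * 'D_v ('D_v phi) (x + (r * (t * s)) *: v).
  by apply: (@line_MVT _ _ ('D_v phi) x v (t * s)) => r _; exact: smooth_derivable.
rewrite -mulrBr E (_ : s * _ = s ^+ 2 * (t * 'D_v ('D_v phi) (x + (r * (t * s)) *: v))); last by ring.
rewrite normrM (ger0_norm (sqr_ge0 _)) ler_wpM2l ?sqr_ge0// normrM ger0_norm//.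
by rewrite (le_trans _ (hB (x + (r * (t * s)) *: v)))// ler_piMl.
Qed.
End vanishing.


(** * Ultralimits and weak-star compactness *)

Section ultralimit.
Context {R : realType} {U : set_system nat} {UU : UltraFilter U}.

Lemma ultra_fmap (T : Type) (a : nat -> T) : UltraFilter (a @ U).
Proof.
split; first exact: fmap_proper_filter.
move=> G GG UG; apply/seteqP; split=> // A GA.
have [//|nA] := in_ultra_setVsetC (a @^-1` A) UU.
have GnA : G (~` A) by apply: UG.
by have [x []] := filter_ex (filterI GA GnA).
Qed.

(** Compactness of segments without extraction of subsequences: one ultrafilter gives limits at
    all points of space-time simultaneously. *)
Lemma ultra_bounded_cvg (a : nat -> R) (C : R) :
  (forall n, `|a n| <= C) -> cvg (a @ U).
Proof.
move=> aC; have := @segment_compact R (- C) C; rewrite compact_ultra /= => h.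
have [|l [_ al]] := h _ (ultra_fmap a); last by apply/cvg_ex; exists l.
by apply: (@filterE _ U) => n; rewrite /= in_itv/= -ler_norml.
Qed.

Lemma ultra_ge0 (a : nat -> R) : cvg (a @ U) -> (forall n, 0 <= a n) ->
  0 <= lim (a @ U).
Proof. by move=> ca a0; apply: limr_ge => //; exact: filterE. Qed.

End ultralimit.

Section Rint.
Context {R : realType} d (T : measurableType d) (mu : {measure set T -> \bar R}).
Implicit Types (f g h : T -> R) (D : set T).

Lemma integrable_le D g h : measurable D -> mu.-integrable D (EFin \o g) ->
  measurable_fun D h -> (forall x, D x -> `|h x| <= g x) ->
  mu.-integrable D (EFin \o h).
Proof.
move=> mD ig mh hg; apply: (le_integrable mD _ _ ig); first exact/measurable_EFinP.
by move=> x Dx; rewrite /= lee_fin (le_trans (hg x Dx)) ?ler_norm.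
Qed.

Lemma integrable_abs D g : measurable D -> mu.-integrable D (EFin \o g) ->
  mu.-integrable D (EFin \o (fun x => `|g x|)).
Proof.
move=> mD ig; apply: (le_integrable mD _ _ ig).
  apply/measurable_EFinP; apply: measurableT_comp => //.
  by apply/measurable_EFinP; exact: measurable_int ig.
by move=> x Dx; rewrite /= normr_id.
Qed.

Lemma integrable_measurable D g : mu.-integrable D (EFin \o g) -> measurable_fun D g.
Proof. by move=> ig; apply/measurable_EFinP; exact: measurable_int ig. Qed.

Lemma integrable_add D f g : measurable D -> mu.-integrable D (EFin \o f) ->
  mu.-integrable D (EFin \o g) -> mu.-integrable D (EFin \o (fun x => f x + g x)).
Proof.
move=> mD intf intg; rewrite (_ : _ \o _ = (EFin \o f) \+ (EFin \o g))%E; last exact/funext.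
exact: integrableD.
Qed.

Lemma integrable_scale D c f : measurable D -> mu.-integrable D (EFin \o f) ->
  mu.-integrable D (EFin \o (fun x => c * f x)).
Proof.
move=> mD intf; rewrite (_ : _ \o _ = fun x => (c%:E * (EFin \o f) x)%E); last exact/funext.
exact: integrableZl.
Qed.

Lemma integrable_sub D f g : measurable D -> mu.-integrable D (EFin \o f) ->
  mu.-integrable D (EFin \o g) -> mu.-integrable D (EFin \o (fun x => f x - g x)).
Proof.
move=> mD intf intg; rewrite (_ : _ \o _ = (EFin \o f) \- (EFin \o g))%E; last exact/funext.
exact: integrableB.
Qed.

Lemma integrable_mul_le1 D f g : measurable D -> mu.-integrable D (EFin \o g) ->
  measurable_fun D f -> (forall x, D x -> `|f x| <= 1) ->
  mu.-integrable D (EFin \o (fun x => f x * g x)).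
Proof.
move=> mD ig mf f1; apply: (integrable_le mD (integrable_abs mD ig)).
  by apply: measurable_funM => //; exact: integrable_measurable ig.
by move=> x Dx; rewrite normrM ler_piMl// f1.
Qed.

Lemma Rintegral_abs_le D g h : measurable D -> mu.-integrable D (EFin \o g) ->
  measurable_fun D h -> (forall x, D x -> `|h x| <= g x) ->
  `|\int[mu]_(x in D) h x| <= \int[mu]_(x in D) g x.
Proof.
move=> mD ig mh hg; have ih := integrable_le mD ig mh hg.
rewrite (le_trans (le_normr_Rintegral mD ih))//.
by apply: le_Rintegral => //; exact: integrable_abs.
Qed.

Lemma integrable_indic D : measurable D -> (mu D < +oo)%E ->
  mu.-integrable setT (EFin \o (\1_D : T -> R)).
Proof.
move=> mD Dfin; apply/integrableP; split.
  by apply/measurable_EFinP; exact: measurable_indic.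
rewrite (eq_integral (fun x => (\1_D x)%:E)).
  by rewrite integral_indic// setIT.
by move=> x _; rewrite /= ger0_norm// indicE.
Qed.

Lemma Rintegral_indic D : measurable D -> \int[mu]_x \1_D x = fine (mu D).
Proof. by move=> mD; rewrite /Rintegral integral_indic// setIT. Qed.

Lemma Rintegral_setIind D f : measurable D ->
  \int[mu]_(x in D) f x = \int[mu]_x (\1_D x * f x).
Proof.
move=> mD; rewrite Rintegral_mkcond; apply: eq_Rintegral => x _.
by rewrite patchE indicE; case: ifP; rewrite ?mul1r ?mul0r.
Qed.
End Rint.

Section weak_star.
Import HBSimple.
Context {R : realType} d (T : measurableType d).
Variables (mu : {sigma_finite_measure set T -> \bar R}).
Variables (U : set_system nat) (UU : UltraFilter U).
Variables (Om : set T) (mOm : measurable Om) (Omfin : (mu Om < +oo)%E).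
Variables (f : nat -> T -> R) (mf : forall n, measurable_fun setT (f n)).
Hypothesis f01 : forall n x, 0 <= f n x <= \1_Om x.

Let f_le1 n x : `|f n x| <= \1_Om x.
Proof. by have /andP[f0 f1] := f01 n x; rewrite ger0_norm. Qed.

Let iOm A : measurable A -> mu.-integrable A (EFin \o (\1_Om : T -> R)).
Proof. by move=> mA; apply: integrableS (integrable_indic mOm Omfin). Qed.

Let intf A n : measurable A -> mu.-integrable A (EFin \o f n).
Proof.
move=> mA; apply: (integrable_le mA (iOm mA)) => //.
exact: measurable_funTS.
Qed.

Let m : {finite_measure set T -> \bar R} := mfrestr mOm Omfin.

Let mE A : (m A = mu (A `&` Om))%E. Proof. by []. Qed.

Let I A n := \int[mu]_(x in A) f n x.

Let I_bound A n : measurable A -> 0 <= I A n <= fine (m A).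
Proof.
move=> mA; rewrite Rintegral_ge0 => [|x _]; last by case/andP: (f01 n x).
have -> : fine (m A) = \int[mu]_(x in A) \1_Om x.
  by rewrite /Rintegral integral_indic// setIC.
apply: le_Rintegral => //; [exact: intf|exact: iOm|].
by move=> x _; case/andP: (f01 n x).
Qed.

(** The measure whose density is the weak-star limit. *)
Definition limit_measure A := (lim (I A @ U))%:E.

Let I_cvg A : measurable A -> cvg (I A @ U).
Proof.
move=> mA; apply: (@ultra_bounded_cvg _ _ _ _ (fine (m A))) => n.
by have /andP[I0 I1] := I_bound n mA; rewrite ger0_norm.
Qed.

Let I_setU A B n : measurable A -> measurable B -> [disjoint A & B] ->
  I (A `|` B) n = I A n + I B n.
Proof.
move=> mA mB AB; apply: Rintegral_setU => //; apply: intf; exact: measurableU.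
Qed.

Let limit_measure0 : limit_measure set0 = 0%E.
Proof.
rewrite /limit_measure (_ : I set0 = cst 0); first by rewrite lim_cst.
by apply/funext => n; rewrite /I Rintegral_set0.
Qed.

Let limit_measure_ge0 A : (0 <= limit_measure A)%E.
Proof.
rewrite lee_fin; have [cI|nI] := pselect (cvg (I A @ U)).
  by apply: ultra_ge0 => // n; apply: Rintegral_ge0 => x _; case/andP: (f01 n x).
by rewrite dvgP.
Qed.

Let limit_measure_le A : measurable A -> (limit_measure A <= m A)%E.
Proof.
move=> mA; rewrite -[leRHS]fineK ?fin_num_measure// lee_fin.
apply: limr_le; first exact: I_cvg.
by apply: filterE => n; case/andP: (I_bound n mA).
Qed.

Let limit_measure_setU A B : measurable A -> measurable B -> [disjoint A & B] ->
  limit_measure (A `|` B) = (limit_measure A + limit_measure B)%E.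
Proof.
move=> mA mB AB; rewrite /limit_measure (_ : I (A `|` B) = I A \+ I B).
  by rewrite limD//; exact: I_cvg.
by apply/funext => n; exact: I_setU.
Qed.

(** Limits of integrals are only finitely additive in general. Here they are dominated by the
    finite measure [m], whose tails tend to 0, and this gives countable additivity. *)
Let limit_measure_sigma : semi_sigma_additive limit_measure.
Proof.
move=> F mF tF mUF; have mC n : measurable (\big[setU/set0]_(i < n) F i).
  exact: bigsetU_measurable.
have dC n : [disjoint (\big[setU/set0]_(i < n) F i) & F n].
  apply/disj_set2P; rewrite -subset0 -bigcup_mkord => x [[i /= ilt Fi] Fn].
  have E : i = n by apply: (tF i n) => //; exists x.
  by rewrite E ltnn in ilt.
have sumE n : (\sum_(0 <= i < n) limit_measure (F i) = limit_measure (\big[setU/set0]_(i < n) F i))%E.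
  elim: n => [|n ih]; first by rewrite big_geq// big_ord0 limit_measure0.
  by rewrite big_nat_recr//= ih big_ord_recr/= (limit_measure_setU (mC n) (mF n) (dC n)).
under eq_fun do rewrite sumE.
pose C n := \big[setU/set0]_(i < n) F i; pose B := \bigcup_n F n.
have CB n : C n `<=` B by rewrite /C -bigcup_mkord => x [i _ Fx]; exists i.
have mD n : measurable (B `\` C n) by exact: (measurableD mUF (mC n)).
have BE n : B = C n `|` (B `\` C n) by rewrite setDUK.
have dD n : [disjoint C n & B `\` C n] by apply/disj_set2P; rewrite -subset0 => x [? []].
have mcvg : (m \o C) n @[n --> \oo] --> m B.
  have BC : B = \bigcup_n C n.
    apply/seteqP; split=> [x [n _ Fx]|x [n _ /CB//]].
    by exists n.+1 => //; rewrite /C big_ord_recr; right.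
  rewrite BC; have := @nondecreasing_cvg_mu _ _ _ m C mC; apply.
    by rewrite -BC.
  by apply/nondecreasing_seqP => n; apply/subsetPset; rewrite /C big_ord_recr; exact: subsetUl.
have fmcvg : fine (m (C n)) @[n --> \oo] --> fine (m B).
  by apply: fine_cvg; rewrite fineK ?fin_num_measure.
apply: cvg_EFin; first by apply: nearW => n.
apply/cvgrPdist_le => e e0; near=> n.
have w := limit_measure_setU (mC n) (mD n) (dD n); rewrite -BE -/B in w.
have mw : m B = (m (C n) + m (B `\` C n))%E.
  by rewrite {1}(BE n) measureU; [|exact: mC|exact: mD|exact/disj_set2P].
rewrite /= -/(C n); move: w => [->].
have fC : m (C n) \is a fin_num by apply: fin_num_measure; exact: mC.
have fD : m (B `\` C n) \is a fin_num by apply: fin_num_measure; exact: mD.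
have {}mw : fine (m B) = fine (m (C n)) + fine (m (B `\` C n)).
  by rewrite mw fineD.
rewrite addrAC subrr add0r ger0_norm; last first.
  by have := limit_measure_ge0 (B `\` C n); rewrite lee_fin.
rewrite (@le_trans _ _ (fine (m (B `\` C n))))//.
  by have := limit_measure_le (mD n); rewrite -(fineK fD) lee_fin.
have -> : fine (m (B `\` C n)) = fine (m B) - fine (m (C n)) by rewrite mw addrAC subrr add0r.
rewrite (le_trans (ler_norm _))//; near: n.
by move/cvgrPdist_le : fmcvg; exact.
Unshelve. all: by end_near.
Qed.

HB.instance Definition _ := isMeasure.Build _ _ _ limit_measure limit_measure0 limit_measure_ge0 limit_measure_sigma.
Let limit_measure_fin : fin_num_fun limit_measure. Proof. by []. Qed.
HB.instance Definition _ := @Measure_isFinite.Build _ _ _ limit_measure limit_measure_fin.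

Let nu : {finite_measure set T -> \bar R} := limit_measure.

Let nu_dom : nu `<< mu.
Proof.
apply/null_content_dominatesP => A mA muA0; apply/eqP.
rewrite eq_le measure_ge0 andbT (le_trans (limit_measure_le mA))// -muA0.
rewrite mE; apply: le_measure; rewrite ?inE//; exact: measurableI.
Qed.

Let density : exists g : T -> R, [/\ measurable_fun setT g,
  forall x, 0 <= g x <= \1_Om x &
  forall A, measurable A -> (limit_measure A = \int[mu]_(x in A) (g x)%:E)%E].
Proof.
have [h [h0 hfin ih hE]] := radon_nikodym_sigma_finite nu_dom.
pose g x := fine (h x).
have gE x : (g x)%:E = h x by rewrite fineK.
have mg : measurable_fun setT g.
  by apply/measurable_EFinP; rewrite (_ : EFin \o g = h);
    [exact: measurable_int ih|exact/funext].
have m1 : measurable_fun setT (\1_Om : T -> R) by exact: measurable_indic.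
(* the Radon-Nikodym density is below the indicator of [Om] almost everywhere only *)
pose g' x := Num.min (g x) (\1_Om x).
have mg' : measurable_fun setT g' by exact: measurable_minr.
exists g'; split => // [x|A mA].
  by rewrite ge_min lexx orbT andbT le_min fine_ge0//= indicE.
pose B := [set x | \1_Om x < g x].
have mB : measurable B by rewrite -[B]setTI; exact: measurable_fun_ltr.
have mAB : measurable (A `&` B) by exact: measurableI.
have mADB : measurable (A `\` B) by exact: measurableD.
have dAB : [disjoint A `&` B & A `\` B].
  by apply/disj_set2P; rewrite -subset0 => x [[_ ?] [_ /(_ _)]].
have AE : A = (A `&` B) `|` (A `\` B) by rewrite setUIDK.
have g'0 x : (0 <= (g' x)%:E)%E by rewrite lee_fin le_min fine_ge0//= indicE.
have mEg' D : measurable_fun D (EFin \o g').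
  by apply/measurable_EFinP; exact: measurable_funTS.
rewrite AE limit_measure_setU// ge0_integral_setU//; congr (_ + _)%E; last first.
  rewrite [LHS]hE//; apply: eq_integral => x; rewrite inE => -[_ /negP nB].
  by rewrite /g' min_l ?gE// leNgt.
apply/eqP; rewrite eq_le; apply/andP; split.
  rewrite (le_trans (limit_measure_le mAB))// mE -[X in mu X]setIC.
  rewrite -(integral_indic mu mAB mOm); apply: ge0_le_integral => //.
  - by apply/measurable_EFinP; exact: measurable_funTS.
  - by move=> x [_ Bx]; rewrite lee_fin le_min lexx ltW.
rewrite [leRHS]hE//; apply: ge0_le_integral => //.
  by apply: measurable_funTS; exact: measurable_int ih.
by move=> x _; rewrite -gE lee_fin ge_min lexx.
Qed.

Section test.
Variables (g : T -> R) (mg : measurable_fun setT g).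
Hypothesis g01 : forall x, 0 <= g x <= \1_Om x.
Hypothesis gE : forall A, measurable A -> (limit_measure A = \int[mu]_(x in A) (g x)%:E)%E.

Let bounded_tests (s : T -> R) := [/\ measurable_fun setT s,
  exists C, forall x, `|s x| <= C &
  \int[mu]_x (f n x * s x) @[n --> U] --> \int[mu]_x (g x * s x)].

Let integrable_bnd (h s : T -> R) : measurable_fun setT h -> 
  (forall x, 0 <= h x <= \1_Om x) -> measurable_fun setT s ->
  (exists C, forall x, `|s x| <= C) ->
  mu.-integrable setT (EFin \o (fun x => h x * s x)).
Proof.
move=> mh h01 ms [C sC].
apply: (@integrable_le _ _ _ _ _ (fun x => C * \1_Om x)) => //.
- rewrite (_ : _ \o _ = fun x => (C%:E * (\1_Om x)%:E)%E); last exact/funext.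
  by apply: integrableZl => //; exact: iOm.
- exact: measurable_funM.
- move=> x _; have /andP[h0 h1] := h01 x.
  by rewrite normrM ger0_norm// mulrC ler_pM.
Qed.

Let bounded_tests_sum (I0 : Type) (r : seq I0) (F : I0 -> T -> R) :
  (forall i, bounded_tests (F i)) ->
  bounded_tests (fun x => \sum_(i <- r) F i x).
Proof.
move=> tF; elim: r => [|i r [ms [C sC] cs]].
  rewrite (_ : (fun _ => _) = cst 0); last by apply/funext => x; rewrite big_nil.
  split; [exact: measurable_cst|by exists 0 => x; rewrite normr0|].
  under eq_fun do under eq_Rintegral do rewrite mulr0.
  under eq_Rintegral do rewrite mulr0.
  exact: cvg_cst.
have [mi [Ci iC] ci] := tF i.
rewrite (_ : (fun _ => _) = F i \+ (fun x => \sum_(i <- r) F i x)); last first.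
  by apply/funext => x; rewrite big_cons.
split; first exact: measurable_funD.
  by exists (Ci + C) => x; rewrite (le_trans (ler_normD _ _))// lerD.
have E (h : T -> R) : measurable_fun setT h -> (forall x, 0 <= h x <= \1_Om x) ->
  \int[mu]_x (h x * (F i \+ (fun x => \sum_(i <- r) F i x)) x) =
  \int[mu]_x (h x * F i x) + \int[mu]_x (h x * \sum_(i <- r) F i x).
  move=> mh h01; rewrite -RintegralD//.
  - by apply: eq_Rintegral => x _; rewrite mulrDr.
  - by apply: integrable_bnd => //; exists Ci.
  - by apply: integrable_bnd => //; exists C.
under eq_fun do rewrite E//.
by rewrite E//; apply: cvgD.
Qed.

Let bounded_tests_indic A y : measurable A -> bounded_tests (fun x => y * \1_A x).
Proof.
move=> mA; have m1 : measurable_fun setT (\1_A : T -> R) by exact: measurable_indic.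
have A1 x : `|\1_A x| <= 1 :> R by rewrite indicE ger0_norm// lern1 leq_b1.
split; first exact: measurable_funM.
  by exists `|y| => x; rewrite normrM ler_piMr.
have E (h : T -> R) : measurable_fun setT h -> (forall x, 0 <= h x <= \1_Om x) ->
    \int[mu]_x (h x * (y * \1_A x)) = y * \int[mu]_(x in A) h x.
  move=> mh h01; rewrite (Rintegral_setIind _ _ mA) -(@RintegralZl _ _ _ mu setT)//.
    by apply: eq_Rintegral => x _; ring.
  rewrite (_ : (fun x => \1_A x * h x) = fun x => h x * \1_A x).
    by apply: integrable_bnd => //; exists 1.
  by apply/funext => x; rewrite mulrC.
under eq_fun do rewrite E//.
rewrite E//; apply: cvgMl_tmp.
have -> : \int[mu]_(x in A) g x = lim (I A @ U) by rewrite /Rintegral -gE.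
exact: I_cvg.
Qed.

Let bounded_tests_sfun (s : {sfun T >-> R}) : bounded_tests s.
Proof.
rewrite (_ : (s : T -> R) = fun x => \sum_(y <- finmap.enum_fset (fset_set (range s))) y * \1_(s @^-1` [set y]) x).
  by apply: bounded_tests_sum => y; exact: bounded_tests_indic.
by apply/funext => x; rewrite fimfunE fsbig_finite.
Qed.

Let integrable_prod (h s : T -> R) : measurable_fun setT h ->
  (forall x, 0 <= h x <= \1_Om x) -> mu.-integrable setT (EFin \o s) ->
  mu.-integrable setT (EFin \o (fun x => h x * s x)).
Proof.
move=> mh h01 ints; apply: integrable_mul_le1 => // x _.
by have /andP[h0 h1] := h01 x; rewrite ger0_norm// (le_trans h1).
Qed.

Let close (h s r : T -> R) : measurable_fun setT h ->
  (forall x, 0 <= h x <= \1_Om x) -> mu.-integrable setT (EFin \o s) ->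
  mu.-integrable setT (EFin \o r) ->
  `|\int[mu]_x (h x * s x) - \int[mu]_x (h x * r x)| <= \int[mu]_x `|s x - r x|.
Proof.
move=> mh h01 ints intr; rewrite -RintegralB//; [|exact: integrable_prod..].
have isr : mu.-integrable setT (EFin \o (fun x => s x - r x)).
  rewrite (_ : _ \o _ = (EFin \o s) \- (EFin \o r))%E; last exact/funext.
  exact: integrableB.
apply: Rintegral_abs_le => //; first exact: integrable_abs.
  apply: measurable_funB; apply: measurable_funM => //.
    exact: integrable_measurable ints.
  exact: integrable_measurable intr.
move=> x _; rewrite -mulrBr normrM ler_piMl//.
by have /andP[h0 h1] := h01 x; rewrite ger0_norm// (le_trans h1).
Qed.

(** Indicators of measurable sets are tested by definition of [limit_measure], simple functions by
    linearity, and integrable functions by density since all [f n] are bounded by 1. *)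
Lemma weak_star_test (phi : T -> R) : mu.-integrable setT (EFin \o phi) ->
  \int[mu]_x (f n x * phi x) @[n --> U] --> \int[mu]_x (g x * phi x).
Proof.
move=> iphi; have [s_ [is_ _ s_cvg]] := approximation_sfun_integrable measurableT iphi.
apply/cvgrPdist_le => e e0.
have [k hk] : exists k, \int[mu]_x `|phi x - s_ k x| <= e / 3.
  have e3 : 0 < e / 3 by rewrite divr_gt0.
  have /fine_cvgP[_ /cvgrPdist_le/(_ _ e3)[k _ /(_ k (leqnn k))]] := s_cvg.
  by rewrite sub0r normrN => h; exists k; rewrite (le_trans _ h)// ler_norm.
have [_ _ /cvgrPdist_le ck] := bounded_tests_sfun (s_ k).
have e3 : 0 < e / 3 by rewrite divr_gt0.
near=> n.
have ckn : `|\int[mu]_x (g x * s_ k x) - \int[mu]_x (f n x * s_ k x)| <= e / 3.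
  by near: n; exact: ck.
have h1 := close mg g01 iphi (is_ k).
have h2 := close (mf n) (f01 n) iphi (is_ k).
move: ckn h1 h2 hk.
set a := Rintegral _ _ _; set b := Rintegral _ _ _; set c := Rintegral _ _ _.
set a' := Rintegral _ _ _; set b' := Rintegral _ _ _.
rewrite !ler_norml => /andP[? ?] /andP[? ?] /andP[? ?] ?.
by apply/andP; split; lra.
Unshelve. all: by end_near.
Qed.
End test.

(** Weak-star compactness of the functions with values between 0 and the indicator of a set of
    finite measure. *)
Lemma weak_star_limit : exists g : T -> R, [/\ measurable_fun setT g,
  forall x, 0 <= g x <= \1_Om x &
  forall phi, mu.-integrable setT (EFin \o phi) ->
    \int[mu]_x (f n x * phi x) @[n --> U] --> \int[mu]_x (g x * phi x)].
Proof.
have [g [mg g01 gE]] := density; exists g; split => // phi; exact: weak_star_test.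
Qed.

End weak_star.

(** Radon-Nikodym needs a sigma-finite reference measure; a product inherits this from its
    factors. *)
Lemma weak_star_limit_prod (R : realType) d1 d2 (T1 : measurableType d1) (T2 : measurableType d2)
  (m1 : {sigma_finite_measure set T1 -> \bar R}) (m2 : {sigma_finite_measure set T2 -> \bar R})
  (U : set_system nat) (UU : UltraFilter U) (Om : set (T1 * T2)) :
  measurable Om -> ((m1 \x m2) Om < +oo)%E ->
  forall f : nat -> T1 * T2 -> R, (forall n, measurable_fun setT (f n)) ->
  (forall n z, 0 <= f n z <= \1_Om z) ->
  exists g : T1 * T2 -> R, [/\ measurable_fun setT g,
  forall z, 0 <= g z <= \1_Om z &
  forall phi, (m1 \x m2)%E.-integrable setT (EFin \o phi) ->
    \int[(m1 \x m2)%E]_z (f n z * phi z) @[n --> U] --> \int[(m1 \x m2)%E]_z (g z * phi z)].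
Proof.
move=> mOm Omfin f mf f01.
have sf : sigma_finite setT (m1 \x m2)%E.
  have /sigma_finiteP[F [TF ndF Foo]] := sigma_finiteT m1.
  have /sigma_finiteP[G [TG ndG Goo]] := sigma_finiteT m2.
  exists (fun n => F n `*` G n).
    rewrite -setXTT TF TG; apply/seteqP; split => -[x y].
      move=> [/= [n _ Fnx] [k _ Gky]]; exists (maxn n k) => //; split.
        by move: x Fnx; exact/subsetPset/ndF/leq_maxl.
      by move: y Gky; exact/subsetPset/ndG/leq_maxr.
    by move=> [n _ []/= ? ?]; split; exists n.
  move=> k; have [? ?] := Foo k; have [? ?] := Goo k.
  split; first exact: measurableX.
  by rewrite product_measure1E// lte_mul_pinfty// ge0_fin_numE.
pose nu0 : {measure set (T1 * T2)%type -> \bar R} := (m1 \x m2)%E.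
pose nu : {sigma_finite_measure set (T1 * T2)%type -> \bar R} := HB.pack (nu0 : set _ -> \bar R) nu0
  (Measure_isSigmaFinite.Build _ _ _ nu0 sf).
exact: (@weak_star_limit R _ (T1 * T2)%type nu U UU Om mOm Omfin f mf f01).
Qed.


(** * Translation estimates from weak gradients *)

Section smooth_shift.
Context {R : realType} {V : normedModType R}.

Lemma derive_shift (f : V -> R) a v x :
  'D_v (fun y => f (y + a)) x = 'D_v f (x + a).
Proof.
rewrite /derive; set F := fun h => _; set G := fun h => _.
by rewrite (_ : F = G)//; apply/funext => h; rewrite /F /G /= addrA.
Qed.

Lemma derivable_shift (f : V -> R) a v x :
  derivable f (x + a) v -> derivable (fun y => f (y + a)) x v.
Proof.
rewrite /derivable; set F := fun h => _; set G := fun h => _.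
by rewrite (_ : F = G)//; apply/funext => h; rewrite /F /G /= addrA.
Qed.

Lemma continuous_translate (g : V -> R) a :
  continuous g -> continuous (fun x : V => g (x + a) : R).
Proof.
move=> cg x; apply: (@continuous_comp _ _ _ (fun x => x + a) g); last exact: cg.
by apply: cvgD; [exact: cvg_id|exact: cvg_cst].
Qed.

Lemma smooth_shift (f : V -> R) a : smooth f -> smooth (fun x => f (x + a)).
Proof.
move=> sf k; have cs g := @continuous_translate g a.
elim: k f sf => [|k ih] f sf; first by split => //; apply/cs/smooth_continuous.
split; first exact/cs/smooth_continuous.
move=> v; split => [x|]; first by apply: derivable_shift; exact: smooth_derivable.
rewrite (_ : 'D_v _ = fun x => 'D_v f (x + a)); last first.
  by apply/funext => x; exact: derive_shift.
by apply: (ih ('D_v f)); exact: smooth_derive.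
Qed.
End smooth_shift.

Section weak_translation.
Context {R : realType} {n : nat}.
Local Notation V := 'rV[R]_n.
Local Notation mu := (@lebesgue_rV R n).
Variables (f : V -> R) (g : V -> V).
Hypothesis f_loc : forall r, mu.-integrable (cube r) (EFin \o f).
Hypothesis mf : measurable_fun setT f.

Lemma integrable_mul_supp (h : V -> R) r C : measurable_fun setT h ->
  (forall x, `|h x| <= C) -> (forall x, ~ cube r x -> h x = 0) ->
  mu.-integrable setT (EFin \o (fun x => f x * h x)).
Proof.
move=> mh hC h0.
have C0 : 0 <= C by rewrite (le_trans _ (hC 0)).
have ig : mu.-integrable setT (EFin \o (fun x => C * `|(f \_ (cube r)) x|)).
  rewrite (_ : _ \o _ = fun x => (C%:E * (`|(f \_ (cube r)) x|)%:E)%E); last exact/funext.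
  apply: integrableZl => //; apply: integrable_abs => //.
  rewrite -restrict_EFin; apply/(integrable_mkcond _ (measurable_cube _)).
  exact: f_loc.
apply: (integrable_le measurableT ig); first exact: measurable_funM.
move=> x _; rewrite normrM patchE; case: ifPn => [_|]; first by rewrite mulrC ler_wpM2r.
by rewrite notin_setE => /h0 ->; rewrite normr0 mulr0 mulr_ge0.
Qed.

Lemma Rintegral_mul_supp_le (h : V -> R) r C : measurable_fun setT h ->
  (forall x, `|h x| <= C) -> (forall x, ~ cube r x -> h x = 0) ->
  `|\int[mu]_x (f x * h x)| <= C * \int[mu]_(x in cube r) `|f x|.
Proof.
move=> mh hC h0; have C0 : 0 <= C by rewrite (le_trans _ (hC 0)).
have mc := @measurable_cube R n r.
rewrite (_ : \int[mu]_x _ = \int[mu]_(x in cube r) (f x * h x)); last first.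
  rewrite [RHS]Rintegral_mkcond; apply: eq_Rintegral => x _; rewrite patchE.
  by case: ifPn => //; rewrite notin_setE => /h0 ->; rewrite mulr0.
rewrite -RintegralZl//; last exact: integrable_abs.
apply: Rintegral_abs_le => //.
- rewrite (_ : _ \o _ = fun x => (C%:E * (`|f x|)%:E)%E); last exact/funext.
  by apply: integrableZl => //; exact: integrable_abs.
- by apply: measurable_funTS; exact: measurable_funM.
- by move=> x _; rewrite normrM mulrC ler_wpM2r.
Qed.

Variables (i : 'I_n) (phi : V -> R) (r G : R).
Hypothesis fg : weak_gradient f g.
Hypothesis sphi : smooth phi.
Hypothesis phi0 : forall x, ~ cube r x -> phi x = 0.
Let e : V := delta_mx 0 i.
Let shifted (s : R) x := phi (x + s *: e).
Hypothesis gG : forall s, `|\int[mu]_x (g x 0 i * shifted s x)| <= G.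

Let F (s : R) := \int[mu]_x (f x * shifted s x).

Let cube_shift (t S : R) x : `|t| <= S -> ~ cube (r + S) x -> ~ cube r (x + t *: e).
Proof.
move=> tS nx cx; apply: nx => j; have := cx j; rewrite !mxE => h.
have -> : x 0 j = (x 0 j + t * (true && (j == i))%:R) - t * (true && (j == i))%:R by ring.
rewrite (le_trans (ler_normB _ _))// lerD// normrM (le_trans _ tS)//.
by rewrite ler_piMr// normr_nat lern1 leq_b1.
Qed.

Let step_bound S : 0 <= S -> exists2 J, 0 <= J & forall s t, `|s| <= S -> `|s + t| <= S ->
  `|F (s + t) - F s| <= `|t| * G + t ^+ 2 * J.
Proof.
move=> S0; have [B B0 hB] := taylor_bound (@compact_cube R n r) e sphi phi0.
have sD := smooth_derive e sphi.
have [C C0 hC] := vanish_bounded (@compact_cube R n r) (smooth_continuous sphi) phi0.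
have D0 := vanish_derive (@compact_cube R n r) e phi0.
have [C' C'0 hC'] := vanish_bounded (@compact_cube R n r) (smooth_continuous sD) D0.
exists (B * \int[mu]_(x in cube (r + S)) `|f x|).
  by rewrite mulr_ge0// Rintegral_ge0.
move=> s t sS stS.
pose err x := shifted (s + t) x - shifted s x - t * 'D_e phi (x + s *: e).
have msh u : measurable_fun setT (shifted u).
  exact: (rV_continuous_measurable (smooth_continuous (smooth_shift _ sphi))).
have mD : measurable_fun setT (fun x : V => 'D_e phi (x + s *: e)).
  exact: (rV_continuous_measurable (smooth_continuous (smooth_shift _ sD))).
have merr : measurable_fun setT err.
  by apply: measurable_funB; [exact: measurable_funB|exact: measurable_funM].
have errB x : `|err x| <= t ^+ 2 * B.
  by rewrite /err /shifted scalerDl addrA; exact: hB.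
have err0 x : ~ cube (r + S) x -> err x = 0.
  move=> nx; rewrite /err /shifted !phi0 ?D0 ?mulr0 ?subr0//; exact: cube_shift nx.
have ish u : `|u| <= S -> mu.-integrable setT (EFin \o (fun x => f x * shifted u x)).
  move=> uS; apply: (integrable_mul_supp (r := r + S) (msh u) (fun x => hC _)).
  by move=> x nx; apply: phi0; exact: cube_shift nx.
have iD : mu.-integrable setT (EFin \o (fun x : V => f x * 'D_e phi (x + s *: e))).
  apply: (integrable_mul_supp (r := r + S) mD (fun x => hC' _)).
  by move=> x nx; apply: D0; exact: cube_shift nx.
have ierr := integrable_mul_supp merr errB err0.
have FE : F (s + t) - F s = t * \int[mu]_x (f x * 'D_e phi (x + s *: e)) + \int[mu]_x (f x * err x).
  rewrite /F -RintegralB//; [|exact: ish|exact: ish].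
  rewrite -RintegralZl// -RintegralD//; last first.
    rewrite (_ : _ \o _ = fun x => (t%:E * (f x * 'D_e phi (x + s *: e))%:E)%E); last exact/funext.
    exact: integrableZl.
  by apply: eq_Rintegral => x _; rewrite /err; ring.
have wg : \int[mu]_x (f x * 'D_e phi (x + s *: e)) = - \int[mu]_x (g x 0 i * shifted s x).
  have tphi : test_function setT (shifted s).
    apply: (@smooth_test _ _ _ (r + S)); first exact: smooth_shift.
    by move=> x; apply: contra_neqP => nx; apply: phi0; exact: cube_shift nx.
  rewrite -(fg tphi i); apply: eq_Rintegral => x _.
  by rewrite [in RHS]derive_shift.
rewrite FE wg (le_trans (ler_normD _ _))// lerD//.
  by rewrite normrM normrN ler_wpM2l.
by rewrite mulrA; exact: Rintegral_mul_supp_le.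
Qed.

(** Let [F s] be the integral of [f] against [phi] shifted by [s]. The weak gradient moves the
    derivative of [F] onto [g], so that [F] changes by at most [|t| G + O(t ^+ 2)] over a step [t].
    Cutting [s] into [m] steps, the quadratic errors add up to [O(1 / m)]. *)
Lemma weak_translation s :
  `|\int[mu]_x (f x * phi (x + s *: e)) - \int[mu]_x (f x * phi x)| <= `|s| * G.
Proof.
have [J J0 hJ] := step_bound (normr_ge0 s).
have F0 : \int[mu]_x (f x * phi x) = F 0.
  by apply: eq_Rintegral => x _; rewrite /shifted scale0r addr0.
rewrite F0 -/(F s).
have tele m : (m > 0)%N -> `|F s - F 0| <= `|s| * G + s ^+ 2 * J / m%:R.
  move=> m0; have m0' : 0 < m%:R :> R by rewrite ltr0n.
  have h k : (k <= m)%N -> `|F (k%:R * (s / m%:R)) - F 0| <=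
      k%:R * (`|s| / m%:R * G + (s / m%:R) ^+ 2 * J).
    elim: k => [|k ih] km; first by rewrite !mul0r subrr normr0.
    rewrite (le_trans (ler_distD (F (k%:R * (s / m%:R))) _ _))//.
    rewrite -[in leRHS]addn1 natrD mulrDl [leRHS]addrC lerD ?ih 1?ltnW//.
    have bnd q : (q <= m)%N -> `|q%:R * (s / m%:R)| <= `|s|.
      move=> qm; rewrite !normrM !normfV !normr_nat mulrCA ler_piMr//.
      by rewrite ler_pdivrMr// mul1r ler_nat.
    rewrite -addn1 natrD mulrDl !mul1r.
    have nsm : `|s / m%:R| = `|s| / m%:R by rewrite normrM normfV normr_nat.
    rewrite -nsm; apply: hJ; first exact: (bnd k (ltnW km)).
    by have := bnd k.+1 km; rewrite -addn1 natrD mulrDl mul1r.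
  have := h m (leqnn m); rewrite mulrCA divff ?gt_eqF// mulr1 => /le_trans; apply.
  rewrite mulrDr le_eqVlt; apply/orP; left; apply/eqP.
  by field; rewrite gt_eqF.
apply/ler_addgt0Pr => eps eps0.
pose m := (Num.truncn (s ^+ 2 * J / eps)).+1.
rewrite (le_trans (tele m isT))// lerD2l ler_pdivrMr ?ltr0n// -ler_pdivrMl// mulrC.
by rewrite ltW// truncnS_gt.
Qed.

End weak_translation.

Section approximation.
Context {R : realType} {n : nat}.
Local Notation V := 'rV[R]_n.
Local Notation mu := (@lebesgue_rV R n).
Variables (w : V -> R) (iw : mu.-integrable setT (EFin \o w)).
Hypothesis w0 : forall x, 0 <= w x.

Let appr (h : V -> R) := forall eps, 0 < eps -> exists phi : V -> R,
  [/\ smooth phi, forall x, 0 <= phi x <= 1 &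
      \int[mu]_x (w x * `|h x - phi x|) <= eps].

Let iwh (h : V -> R) : measurable_fun setT h -> (forall x, `|h x| <= 1) ->
  mu.-integrable setT (EFin \o (fun x => w x * h x)).
Proof.
move=> mh h1; rewrite (_ : (fun x => _) = fun x => h x * w x).
  exact: integrable_mul_le1.
by apply/funext => x; rewrite mulrC.
Qed.

Let itv_abs (a b : R) : 0 <= a <= 1 -> 0 <= b <= 1 -> `| `|a - b| | <= 1.
Proof. by move=> /andP[? ?] /andP[? ?]; rewrite normr_id ler_norml; apply/andP; split; lra. Qed.

Let iwd (h k : V -> R) : measurable_fun setT h -> (forall x, 0 <= h x <= 1) ->
  measurable_fun setT k -> (forall x, 0 <= k x <= 1) ->
  mu.-integrable setT (EFin \o (fun x => w x * `|h x - k x|)).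
Proof.
move=> mh h1 mk k1; apply: iwh; last by move=> x; exact: itv_abs.
by apply: measurableT_comp => //; exact: measurable_funB.
Qed.

Let smooth_measurable (phi : V -> R) : smooth phi -> measurable_fun setT phi.
Proof. by move=> s; exact: (rV_continuous_measurable (smooth_continuous s)). Qed.

Let appr_smooth phi : smooth phi -> (forall x, 0 <= phi x <= 1) -> appr phi.
Proof.
move=> sphi phi01 e e0; exists phi; split => //.
under eq_Rintegral do rewrite subrr normr0 mulr0.
by rewrite Rintegral_cst// mul0r ltW.
Qed.

Let appr_lim (h_ : nat -> V -> R) (h : V -> R) :
  (forall k, measurable_fun setT (h_ k)) -> (forall k x, 0 <= h_ k x <= 1) ->
  (forall x, h_ ^~ x @ \oo --> h x) -> (forall k, appr (h_ k)) -> appr h.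
Proof.
move=> mh h01 hh ah e e0.
have mh' : measurable_fun setT h by apply: (measurable_fun_cvg mh) => x _; exact: hh.
have h01' x : 0 <= h x <= 1.
  apply/andP; split.
    by apply: (cvgr_to_ge (hh x)); apply: nearW => k; case/andP: (h01 k x).
  by apply: (cvgr_to_le (hh x)); apply: nearW => k; case/andP: (h01 k x).
have c0 : (\int[mu]_x (w x * `|h x - h_ k x|)%R%:E)%E @[k --> \oo] --> (\int[mu]_x (0%R : R)%:E)%E.
  apply: (@dominated_cvg _ _ _ mu setT measurableT _ _ (EFin \o w)) => //.
  - by move=> k; exact: measurable_int (iwd mh' h01' (mh k) (h01 k)).
  - move=> x _; apply: cvg_EFin; first exact: nearW.
    rewrite -[X in _ --> X](mulr0 (w x)); apply: cvgMl_tmp.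
    rewrite -(normr0 R) -(subrr (h x)); apply: cvg_norm.
    by apply: cvgB; [exact: cvg_cst|exact: hh].
  - move=> k x _; rewrite /= lee_fin normrM (ger0_norm (w0 x)) ler_piMr//.
    exact: itv_abs.
have e2 : 0 < e / 2 by rewrite divr_gt0.
move: c0; rewrite integral0 => /fine_cvgP[_ /cvgrPdist_le/(_ _ e2)[k _ /(_ k (leqnn k))]].
rewrite sub0r normrN => hk; have [phi [sphi phi01 hphi]] := ah k _ e2.
exists phi; split => //; have mphi := smooth_measurable sphi.
rewrite (@le_trans _ _ (\int[mu]_x (w x * `|h x - h_ k x| + w x * `|h_ k x - phi x|)))//.
  apply: le_Rintegral => //; first exact: iwd.
    by apply: integrable_add => //; exact: iwd.
  by move=> x _; rewrite -mulrDr ler_wpM2l// ler_distD.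
rewrite RintegralD//; [|exact: iwd|exact: iwd].
by rewrite [leRHS]splitr lerD// (le_trans _ hk)// ler_norm.
Qed.

Let apprset : set (set V) := [set A | measurable A /\ appr (\1_A)].

Let m1 (A : set V) : measurable A -> measurable_fun setT (\1_A : V -> R).
Proof. by move=> mA; exact: measurable_indic. Qed.

Let ind01 (A : set V) x : 0 <= (\1_A x : R) <= 1.
Proof. by rewrite indicE ler0n lern1 leq_b1. Qed.

Let apprset0 : apprset set0.
Proof.
split => // e e0; exists (fun _ => 0); split => [k|x|]; first exact: Ck_cst.
  by rewrite lexx ler01.
under eq_Rintegral do rewrite indic0 subrr normr0 mulr0.
by rewrite Rintegral_cst// mul0r ltW.
Qed.

Let apprsetC A : apprset A -> apprset (~` A).
Proof.
move=> [mA aA]; split; first exact: measurableC.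
move=> e e0; have [phi [sphi phi01 hphi]] := aA e e0.
exists (fun x => 1 - phi x); split; first exact: smooth_compl.
  by move=> x; have /andP[? ?] := phi01 x; apply/andP; split; lra.
rewrite (le_trans _ hphi)// le_eqVlt; apply/orP; left; apply/eqP.
apply: eq_Rintegral => x _; congr (_ * _); rewrite -normrN; congr `|_|.
by rewrite !indicE in_setC; case: (x \in A) => /=; ring.
Qed.

Let apprsetU A B : apprset A -> apprset B -> apprset (A `|` B).
Proof.
move=> [mA aA] [mB aB]; split; first exact: measurableU.
move=> e e0; have e2 : 0 < e / 2 by rewrite divr_gt0.
have [phi [sphi phi01 hphi]] := aA _ e2; have [psi [spsi psi01 hpsi]] := aB _ e2.
have mphi := smooth_measurable sphi; have mpsi := smooth_measurable spsi.
pose h x := 1 - (1 - phi x) * (1 - psi x).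
have sh : smooth h by apply: smooth_compl; apply: smooth_mul; exact: smooth_compl.
have h01 x : 0 <= h x <= 1.
  rewrite /h; have /andP[? ?] := phi01 x; have /andP[? ?] := psi01 x.
  by apply/andP; split; nra.
exists h; split => //.
have idA := iwd (m1 mA) (ind01 A) mphi phi01.
have idB := iwd (m1 mB) (ind01 B) mpsi psi01.
rewrite (@le_trans _ _ (\int[mu]_x (w x * `|\1_A x - phi x| + w x * `|\1_B x - psi x|)))//.
  apply: le_Rintegral => //.
  - apply: iwd => //; [by apply: m1; exact: measurableU|exact: smooth_measurable].
  - exact: integrable_add.
  - move=> x _; rewrite -mulrDr ler_wpM2l//.
    have -> : \1_(A `|` B) x = 1 - (1 - \1_A x) * (1 - \1_B x) :> R.
      rewrite !indicE in_setU; case: (x \in A); case: (x \in B) => /=; ring.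
    have /andP[? ?] := phi01 x; have /andP[? ?] := psi01 x.
    have /andP[? ?] := ind01 A x; have /andP[? ?] := ind01 B x.
    rewrite /h (_ : _ - _ = (\1_A x - phi x) * (1 - \1_B x) +
      (1 - phi x) * (\1_B x - psi x)); last by ring.
    rewrite (le_trans (ler_normD _ _))// !normrM lerD//.
      by rewrite ler_piMr// ger0_norm; lra.
    by rewrite ler_piMl// ger0_norm; lra.
rewrite RintegralD//.
by rewrite [leRHS]splitr lerD.
Qed.

Let apprset_bigcup (F : nat -> set V) : (forall k, apprset (F k)) ->
  apprset (\bigcup_k (F k)).
Proof.
move=> aF; have aU k : apprset (\big[setU/set0]_(i < k) F i).
  by elim: k => [|k ih]; rewrite ?big_ord0// big_ord_recr; exact: apprsetU.
split; first by apply: bigcup_measurable => k _; case: (aF k).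
apply: (appr_lim (h_ := fun k => \1_(\big[setU/set0]_(i < k) F i))).
- by move=> k; apply: m1; case: (aU k).
- by move=> k x; exact: ind01.
- move=> x; have [[k _ Fkx]|nx] := pselect ((\bigcup_k F k) x).
    rewrite (_ : \1__ x = 1); last by rewrite indicE mem_set//; exists k.
    apply: (@cvg_near_cst _ _ (1 : R)); near=> m.
    rewrite indicE mem_set// -bigcup_mkord; exists k => //=.
    by near: m; exact: nbhs_infty_gt.
  rewrite (_ : \1__ x = 0); last by rewrite indicE memNset.
  apply: (@cvg_near_cst _ _ (0 : R)); near=> m.
  rewrite indicE memNset// -bigcup_mkord => -[i _ Fx]; apply: nx; by exists i.
- by move=> k; case: (aU k).
Unshelve. all: by end_near.
Qed.

Let appr_halfspace (i : 'I_n) (a : R) : apprset [set x | a < x 0 i].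
Proof.
have mA : measurable [set x : V | a < x 0 i].
  rewrite -[X in measurable X]setTI.
  rewrite (_ : setT `&` _ = setT `&` (fun x : V => x 0 i) @^-1` `]a, +oo[).
    exact: (measurable_coord i measurableT (measurable_itv _)).
  by rewrite !setTI; apply/seteqP; split => x /=; rewrite in_itv/= andbT.
pose h (k : nat) (x : V) := flat 1 (k%:R * x 0 i + (- (k%:R * a))).
have sh k : smooth (h k) by exact: smooth_flat_coord.
split => //; apply: (appr_lim (h_ := h)).
- by move=> k; exact: smooth_measurable.
- by move=> k x; exact: flat1_itv.
- move=> x; have hE k : h k x = flat 1 (k%:R * (x 0 i - a)) by congr flat; ring.
  under eq_fun do rewrite hE.
  rewrite indicE; have [ax|ax] := ltP a (x 0 i).
    rewrite mem_set//; apply: flat1_cvg1.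
    apply/cvgryPge => A; near=> k; rewrite -ler_pdivrMr ?subr_gt0//.
    by near: k; exact: nbhs_infty_ger.
  rewrite memNset /=; last by rewrite ltNge ax.
  apply: (@cvg_near_cst _ _ (0 : R)); near=> k.
  by rewrite /flat ltNge mulr_ge0_le0// subr_le0.
- by move=> k; apply: appr_smooth => // x; exact: flat1_itv.
Unshelve. all: by end_near.
Qed.

(** The sets whose indicator is approximable in this weighted sense form a sigma-algebra:
    [1 - phi] serves for the complement, [1 - (1 - phi) (1 - psi)] for a union, and dominated
    convergence gives countable unions. Half-spaces belong to it, as their indicators are the
    limits of [flat 1 (k (x_i - a))], and they generate all measurable sets. *)
Lemma indic_approx (A : set V) : measurable A -> forall eps, 0 < eps ->
  exists phi : V -> R, [/\ smooth phi, forall x, 0 <= phi x <= 1 &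
      \int[mu]_x (w x * `|\1_A x - phi x|) <= eps].
Proof.
move=> mA; suff : apprset A by case.
suff sub : g_sigma_preimage (fun i (x : V) => x 0 i : measurableTypeR R) `<=` apprset.
  exact: sub mA.
apply: smallest_sub; first split.
- exact: apprset0.
- by move=> B aB; rewrite setTD; exact: apprsetC.
- exact: apprset_bigcup.
move=> B; rewrite -bigcup_seq/= => -[i _ [Y mY <-]]; rewrite setTI.
pose S : set (set R) := [set Y | apprset ((fun x : V => x 0 i) @^-1` Y)].
suff : S Y by [].
move: mY; rewrite RGenOInfty.measurableE; apply: smallest_sub; first split.
- exact: apprset0.
- by move=> Z aZ; rewrite setTD; exact: apprsetC.
- by move=> Z aZ; rewrite /S/= preimage_bigcup; exact: apprset_bigcup.
move=> _ [a ->]; rewrite /S /= (_ : _ @^-1` _ = [set x : V | a < x 0 i]).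
  exact: appr_halfspace.
by apply/seteqP; split => x /=; rewrite in_itv/= andbT.
Qed.

End approximation.


Lemma tent_cvg1 {R : realType} {n : nat} (x : 'rV[R]_n) :
  tent 0 1 k%:R x @[k --> \oo] --> (1 : R).
Proof.
have coo (c : R) : (k%:R + c : R) @[k --> \oo] --> +oo.
  apply/cvgryPge => A; near=> k; rewrite -lerBlDr; near: k; exact: nbhs_infty_ger.
rewrite /tent; elim: (index_enum _) => [|i r ih].
  by under eq_fun do rewrite big_nil; exact: cvg_cst.
under eq_fun do rewrite big_cons.
have coo' (c : R) : (k%:R - c : R) @[k --> \oo] --> +oo by exact: coo.
have := cvgM (cvgM (flat1_cvg1 (coo (1 * (x 0 i - (0 : 'rV_n) 0 i))))
  (flat1_cvg1 (coo' (1 * (x 0 i - (0 : 'rV_n) 0 i))))) ih.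
rewrite !mulr1 => h; exact: (h _ _).
Unshelve. all: by end_near.
Qed.

Section L1_duality.
Context {R : realType} {n : nat}.
Local Notation V := 'rV[R]_n.
Local Notation mu := (@lebesgue_rV R n).
Variables (w : V -> R) (iw : mu.-integrable setT (EFin \o w)) (C : R).
Hypothesis wC : forall phi r, smooth phi -> (forall x, 0 <= phi x <= 1) ->
  (forall x, ~ cube r x -> phi x = 0) -> `|\int[mu]_x (w x * phi x)| <= C.

Let mw : measurable_fun setT w. Proof. exact: integrable_measurable iw. Qed.

Let iwh (h : V -> R) : measurable_fun setT h -> (forall x, 0 <= h x <= 1) ->
  mu.-integrable setT (EFin \o (fun x => w x * h x)).
Proof.
move=> mh h1; rewrite (_ : (fun x => _) = fun x => h x * w x); last first.
  by apply/funext => x; rewrite mulrC.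
by apply: integrable_mul_le1 => // x _; have /andP[? ?] := h1 x; rewrite ger0_norm.
Qed.

Let smooth_bound (phi : V -> R) : smooth phi -> (forall x, 0 <= phi x <= 1) ->
  `|\int[mu]_x (w x * phi x)| <= C.
Proof.
move=> sphi phi01; pose h (k : nat) x := phi x * tent 0 1 k%:R x.
have mphi := rV_continuous_measurable (smooth_continuous sphi).
have sh k : smooth (h k) by apply: smooth_mul => //; exact: smooth_tent.
have h01 k x : 0 <= h k x <= 1.
  have /andP[? ?] := phi01 x; have /andP[? ?] := @tent_itv R n 0 1 k%:R x.
  by rewrite /h mulr_ge0//= mulr_ile1.
have bnd k : `|\int[mu]_x (w x * h k x)| <= C.
  apply: (wC (r := k%:R)) => // x nx; apply: contra_not_eq nx.
  rewrite mulf_eq0 negb_or => /andP[_ /tent_supp tx] i.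
  by have := tx i; rewrite mxE subr0 mul1r => /ltW.
have c : (\int[mu]_x (w x * h k x)%R%:E)%E @[k --> \oo] --> (\int[mu]_x (w x * phi x)%R%:E)%E.
  apply: (@dominated_cvg _ _ _ mu setT measurableT _ _ (EFin \o (fun x => `|w x|))) => //.
  - move=> k; apply: measurable_int (iwh _ (h01 k)).
    exact: rV_continuous_measurable (smooth_continuous (sh k)).
  - move=> x _; apply: cvg_EFin; first exact: nearW.
    apply: cvgMl_tmp; rewrite -[X in _ --> X]mulr1; apply: cvgMl_tmp.
    exact: tent_cvg1.
  - exact: integrable_abs.
  - move=> k x _; rewrite /= lee_fin normrM ler_piMr//.
    by have /andP[? ?] := h01 k x; rewrite ger0_norm.
have ip := iwh mphi phi01.
have E : (\int[mu]_x (w x * phi x)%R%:E)%E = (\int[mu]_x (w x * phi x))%:E.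
  by rewrite fineK//; exact: integrable_fin_num ip.
rewrite E in c; apply: (cvgr_to_le (cvg_norm (fine_cvg c))).
exact: nearW.
Qed.

Let set_bound (A : set V) : measurable A -> `|\int[mu]_x (w x * \1_A x)| <= C.
Proof.
move=> mA; apply/ler_addgt0Pr => e e0.
have [phi [sphi phi01 hphi]] := indic_approx (integrable_abs measurableT iw)
  (fun x => normr_ge0 (w x)) mA e0.
have mphi := rV_continuous_measurable (smooth_continuous sphi).
have m1 : measurable_fun setT (\1_A : V -> R) by exact: measurable_indic.
have i01 x : 0 <= (\1_A x : R) <= 1 by rewrite indicE ler0n lern1 leq_b1.
rewrite (_ : \int[mu]_x _ = \int[mu]_x (w x * phi x) +
    (\int[mu]_x (w x * \1_A x) - \int[mu]_x (w x * phi x))); last by ring.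
rewrite (le_trans (ler_normD _ _))// lerD ?smooth_bound// (le_trans _ hphi)//.
rewrite -RintegralB//; [|exact: iwh|exact: iwh].
apply: Rintegral_abs_le => //.
- apply: (@integrable_le _ _ _ _ _ (fun x => `|w x|)) => //.
  + exact: integrable_abs.
  + by apply: measurable_funM; apply: measurableT_comp => //; exact: measurable_funB.
  + move=> x _; rewrite normrM !normr_id ler_piMr// ler_norml.
    have /andP[? ?] := phi01 x; have /andP[? ?] := i01 x.
    by apply/andP; split; lra.
- by apply: measurable_funB; exact: measurable_funM.
- by move=> x _; rewrite -mulrBr normrM.
Qed.

(** The bound passes from compactly supported tests to all smooth ones by cutting off, then to
    indicators by [indic_approx]. The sets where [w >= 0] and [w < 0] give the factor 2. *)
Lemma L1_norm_le : \int[mu]_x `|w x| <= 2 * C.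
Proof.
pose A := [set x | 0 <= w x].
have mA : measurable A.
  rewrite (_ : A = setT `&` w @^-1` `[0, +oo[); first exact: mw.
  by rewrite setTI; apply/seteqP; split => x; rewrite /A /= in_itv/= andbT.
have i01 (B : set V) x : 0 <= (\1_B x : R) <= 1 by rewrite indicE ler0n lern1 leq_b1.
have m1 (B : set V) : measurable B -> measurable_fun setT (\1_B : V -> R).
  by move=> mB; exact: measurable_indic.
have mAC := measurableC mA.
rewrite (_ : \int[mu]_x _ = \int[mu]_x (w x * \1_A x) - \int[mu]_x (w x * \1_(~` A) x)).
  rewrite (le_trans (ler_norm _))// (le_trans (ler_normB _ _))//.
  by rewrite mulr_natl mulr2n lerD// set_bound.
rewrite -RintegralB//; [|by apply: iwh => //; exact: m1..].
apply: eq_Rintegral => x _; rewrite !indicE in_setC.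
have [wx|wx] := leP 0 (w x).
  have -> : x \in A by rewrite inE.
  by rewrite /= mulr1 mulr0 subr0 ger0_norm.
have -> : (x \in A) = false by apply/negbTE; rewrite notin_setE /A/= leNgt wx.
by rewrite /= mulr1 mulr0 sub0r ltr0_norm.
Qed.
End L1_duality.

Section L1_translation.
Context {R : realType} {n : nat}.
Local Notation V := 'rV[R]_n.
Local Notation mu := (@lebesgue_rV R n).
Variables (f : V -> R) (g : V -> V) (L : R).
Hypothesis intf : mu.-integrable setT (EFin \o f).
Hypothesis fg : weak_gradient f g.
Hypothesis mg : forall i, measurable_fun setT (fun x => g x 0 i).
Hypothesis gL : (\int[mu]_x (enorm (g x))%:E <= L%:E)%E.

Let mf : measurable_fun setT f. Proof. exact: integrable_measurable intf. Qed.

Let menorm : measurable_fun setT (fun x => enorm (g x)).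
Proof.
apply: (measurableT_comp (continuous_measurable_fun (@sqrt_continuous R))).
by apply: measurable_sum => i; exact: measurable_funX.
Qed.

Let ienorm : mu.-integrable setT (EFin \o (fun x => enorm (g x))).
Proof.
apply/integrableP; split; first by apply/measurable_EFinP; exact: menorm.
rewrite (eq_integral (fun x => (enorm (g x))%:E)).
  by rewrite (le_lt_trans gL) ?ltry.
by move=> x _; rewrite /= ger0_norm// enorm_ge0.
Qed.

Let gL' : \int[mu]_x enorm (g x) <= L.
Proof.
rewrite -lee_fin fineK//; apply: integrable_fin_num => //; exact: ienorm.
Qed.

Definition L1_shift (a : V) := \int[mu]_x `|f (x + a) - f x|.

Lemma integrable_shift a : mu.-integrable setT (EFin \o (fun x => f (x + a))).
Proof. exact: (integrable_preserves (rV_shift a) intf). Qed.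

Lemma integrable_shiftB a b :
  mu.-integrable setT (EFin \o (fun x => f (x + a) - f (x + b))).
Proof. by apply: integrable_sub => //; exact: integrable_shift. Qed.

Lemma L1_shiftD a b : L1_shift (a + b) <= L1_shift a + L1_shift b.
Proof.
rewrite /L1_shift -(Rintegral_preserves (rV_shift b) (F := fun x => `|f (x + a) - f x|)); last first.
  apply: measurableT_comp => //; apply: measurable_funB => //.
  exact: integrable_measurable (integrable_shift a).
have i0 : mu.-integrable setT (EFin \o (fun x => `|f (x + b) - f x|)).
  apply: integrable_abs => //.
  by apply: integrable_sub => //; exact: integrable_shift.
have i1 : mu.-integrable setT (EFin \o (fun x => `|f (x + b + a) - f (x + b)|)).
  apply: integrable_abs => //; rewrite (_ : (fun x => _) = fun x => f (x + (b + a)) - f (x + b)).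
    exact: integrable_shiftB.
  by apply/funext => x; rewrite addrA.
rewrite -RintegralD//; apply: le_Rintegral => //.
- by apply: integrable_abs => //; apply: integrable_sub => //; exact: integrable_shift.
- exact: integrable_add.
- move=> x _; rewrite (_ : x + (a + b) = x + b + a); last by rewrite addrAC addrA.
  exact: ler_distD.
Qed.

Lemma L1_shift_dir i s : L1_shift (s *: delta_mx 0 i) <= 2 * (`|s| * L).
Proof.
apply: L1_norm_le; first by apply: integrable_sub => //; exact: integrable_shift.
move=> phi r sphi phi01 phi0; set a := s *: _.
have mphi := rV_continuous_measurable (smooth_continuous sphi).
have mphis b : measurable_fun setT (fun x : V => phi (x + b)).
  exact: rV_continuous_measurable (smooth_continuous (smooth_shift b sphi)).
have iprod (h k : V -> R) : mu.-integrable setT (EFin \o h) -> measurable_fun setT k ->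
    (forall x, 0 <= k x <= 1) -> mu.-integrable setT (EFin \o (fun x => h x * k x)).
  move=> ih mk k01; rewrite (_ : (fun x => _) = fun x => k x * h x); last first.
    by apply/funext => x; rewrite mulrC.
  by apply: integrable_mul_le1 => // x _; have /andP[? ?] := k01 x; rewrite ger0_norm.
have -> : \int[mu]_x ((f (x + a) - f x) * phi x) =
    \int[mu]_x (f x * phi (x + (- s) *: delta_mx 0 i)) - \int[mu]_x (f x * phi x).
  rewrite -(Rintegral_preserves (rV_shift a)
     (F := fun x => f x * phi (x + (- s) *: delta_mx 0 i))); last first.
    by apply: measurable_funM.
  rewrite -RintegralB//.
  - by apply: eq_Rintegral => x _; rewrite scaleNr -/a addrK mulrBl.
  - rewrite (_ : (fun x => _) = fun x => f (x + a) * phi x); last first.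
      by apply/funext => x; rewrite scaleNr -/a addrK.
    by apply: iprod => //; exact: integrable_shift.
  - exact: iprod.
have floc k : mu.-integrable (cube k) (EFin \o f).
  by apply: integrableS intf => //; exact: measurable_cube.
rewrite -(normrN s); apply: (@weak_translation R n f g floc mf i phi r L fg sphi phi0).
move=> t; rewrite (le_trans _ gL')//; apply: Rintegral_abs_le => //.
  by apply: measurable_funM.
move=> x _; rewrite normrM (le_trans _ (coord_le_enorm _ i))// ler_piMr//.
by have /andP[? ?] := phi01 (x + t *: delta_mx 0 i); rewrite ger0_norm.
Qed.

(** Duality reduces a shift along a coordinate to [weak_translation], and a general shift is a
    composition of [n] of these. Only the linear dependence on [a] matters later, not the constant. *)
Lemma L1_shift_le a : L1_shift a <= 2 * n%:R * L * enorm a.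
Proof.
have L0 : 0 <= L by rewrite (le_trans _ gL')// Rintegral_ge0// => x _; exact: enorm_ge0.
have sh0 : L1_shift 0 = 0.
  rewrite /L1_shift; under eq_Rintegral do rewrite addr0 subrr normr0.
  by rewrite Rintegral_cst// mul0r.
have h (r : seq 'I_n) : L1_shift (\sum_(i <- r) a 0 i *: delta_mx 0 i) <=
    \sum_(i <- r) 2 * (`|a 0 i| * L).
  elim: r => [|i r ih]; first by rewrite !big_nil sh0.
  by rewrite !big_cons (le_trans (L1_shiftD _ _))// lerD// L1_shift_dir.
rewrite {1}(row_sum_delta a) (le_trans (h _))//.
apply: (@le_trans _ _ (\sum_(i < n) 2 * (enorm a * L))).
  by apply: ler_sum => i _; rewrite ler_wpM2l// ler_wpM2r// coord_le_enorm.
by rewrite sumr_const card_ord -[X in X <= _]mulr_natl le_eqVlt; apply/orP; left; apply/eqP; ring.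
Qed.

End L1_translation.

Section W1infty_lipschitz.
Context {R : realType} {n : nat}.
Local Notation V := 'rV[R]_n.
Local Notation mu := (@lebesgue_rV R n).

Lemma lebesgue_cube_gt0 (r : R) : 0 < r -> (0 < mu (cube r))%E.
Proof.
move=> r0; elim: n => [|m ih]; first by rewrite /= diracE mem_set; [rewrite lte_fin|case].
rewrite /= /lebesgue_cons /pushforward.
rewrite (_ : _ @^-1` _ = `[(- r), r]%classic `*` @cube R m r).
  rewrite product_measure1E//; last exact: measurable_cube.
  have h : (0 < lebesgue_measure (`[(- r)%R, r%R]%classic : set (measurableTypeR R)))%E.
    rewrite lebesgue_measure_itv/= lte_fin ifT; last by lra.
    by rewrite -EFinB lte_fin; lra.
  exact: mule_gt0.
apply/seteqP; split => -[a v] /=.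
  move=> h; split; first by rewrite in_itv/= -ler_norml; have := h ord0; rewrite cons_rV0.
  by move=> i; have := h (lift ord0 i); rewrite cons_rVS.
rewrite in_itv/= -ler_norml => -[ar vr] i.
by have [j ->|->] := unliftP ord0 i; rewrite ?cons_rV0// cons_rVS; exact: vr.
Qed.

Lemma continuous_loc_integrable (h : V -> R) : continuous h ->
  forall r, mu.-integrable (cube r) (EFin \o h).
Proof.
move=> ch r; have /compact_bounded[M [_ hM]] : compact (h @` cube r).
  by apply: continuous_compact; [exact: continuous_subspaceT|exact: compact_cube].
apply: measurable_bounded_integrable.
- exact: measurable_cube.
- exact: lebesgue_cube.
- by apply: measurable_funTS; exact: rV_continuous_measurable.
- exists (`|M| + 1); split; first exact: num_real.
  move=> A MA x /= xr; rewrite (le_trans (hM (`|M| + 1) _ _ _))//.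
  + by rewrite (le_lt_trans (ler_norm _))// ltrDl.
  + exact: ltW.
Qed.

Lemma tent_translate (y : V) (a b : R) x : tent y a b x = tent 0 a b (x - y).
Proof. by apply: eq_bigr => i _; rewrite !mxE subr0. Qed.

Lemma tent0_supp (a b : R) x : 0 < a -> ~ @cube R n (b / a) x -> tent 0 a b x = 0.
Proof.
move=> a0 nx; apply: contra_not_eq nx => /tent_supp h i.
have := h i; rewrite mxE subr0 normrM gtr0_norm// => h1.
by rewrite ler_pdivlMr// mulrC ltW.
Qed.

Lemma integrable_tent (y : V) (a : R) : 0 < a -> mu.-integrable setT (EFin \o (tent y a 1)).
Proof.
move=> a0; rewrite (_ : tent y a 1 = fun x => tent 0 a 1 (x + - y)); last first.
  by apply/funext => x; exact: tent_translate.
apply: (integrable_preserves (rV_shift (- y)) (F := EFin \o (tent 0 a 1))).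
apply: (@integrable_le _ _ _ _ _ (\1_(@cube R n (1 / a)))) => //.
- by apply: integrable_indic; [exact: measurable_cube|exact: lebesgue_cube].
- exact: rV_continuous_measurable (smooth_continuous (smooth_tent _ _ _)).
- move=> x _; have [xc|xc] := pselect (@cube R n (1 / a) x).
    rewrite indicE mem_set//.
    by have /andP[? ?] := tent_itv 0 a 1 x; rewrite ger0_norm.
  by rewrite tent0_supp ?normr0.
Qed.

Lemma tent_integral_gt0 (y : V) (a : R) : 0 < a -> 0 < \int[mu]_x tent y a 1 x.
Proof.
move=> a0; have mt : measurable_fun setT (@tent R n 0 a 1).
  exact: rV_continuous_measurable (smooth_continuous (smooth_tent _ _ _)).
have -> : \int[mu]_x tent y a 1 x = \int[mu]_x tent 0 a 1 x.
  rewrite -(Rintegral_preserves (rV_shift (- y)) mt).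
  by apply: eq_Rintegral => x _; exact: tent_translate.
pose c : R := flat 1 2^-1; have c0 : 0 < c by apply: flat1_gt0; lra.
have cE (s : R) : 2^-1 <= s -> c <= flat 1 s.
  move=> s2; have s0 : 0 < s by lra.
  rewrite /c /flat s0 ifT ?hornerC ?mul1r; last by lra.
  by rewrite ler_expR lerN2 lef_pV2 ?posrE//; lra.
have mc := @measurable_cube R n (2^-1 / a).
have fc := @lebesgue_cube R n (2^-1 / a).
pose C : R := \prod_(i < n) (c * c); have C0 : 0 < C by apply: prodr_gt0 => i _; exact: mulr_gt0.
apply: (@lt_le_trans _ _ (\int[mu]_x (C * \1_(@cube R n (2^-1 / a)) x))).
  rewrite RintegralZl//; last exact: integrable_indic.
  rewrite mulr_gt0// Rintegral_indic// fine_gt0// fc andbT.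
  by apply: lebesgue_cube_gt0; apply: divr_gt0 => //; lra.
apply: le_Rintegral => //.
- by apply: integrable_scale => //; exact: integrable_indic.
- exact: integrable_tent.
- move=> x _; rewrite indicE; have [xc'|xc'] := pselect (@cube R n (2^-1 / a) x); last first.
    by rewrite memNset// mulr0; case/andP: (tent_itv 0 a 1 x).
  rewrite mem_set// mulr1; apply: ler_prod => i _; rewrite (mulr_ge0 (ltW c0) (ltW c0))/=.
  have := xc' i; rewrite ler_pdivlMr// mxE subr0 => h.
  have {}h : `|a * x 0 i| <= 2^-1 by rewrite normrM gtr0_norm// mulrC.
  move: h; rewrite ler_norml => /andP[? ?].
  by apply: ler_pM; rewrite ?(ltW c0)//; apply: cE; lra.
Qed.

(** The bumps concentrate at [y] as [a] grows, so their averages see the value at [y] only. *)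
Lemma tent_average (h : V -> R) (y : V) (c : R) : continuous h ->
  (forall a, 0 < a -> \int[mu]_x (h x * tent y a 1 x) <= c * \int[mu]_x tent y a 1 x) ->
  h y <= c.
Proof.
move=> ch hc; rewrite leNgt; apply/negP => cy.
have d0 : 0 < (h y - c) / 2 by rewrite divr_gt0// subr_gt0.
have /nbhs_ballP[e /= e0 he] : \forall x \near y, `|h y - h x| < (h y - c) / 2.
  by have /cvgrPdist_lt := ch y; apply.
pose a := e^-1; have a0 : 0 < a by rewrite invr_gt0.
have := hc a a0; apply/negP; rewrite -ltNge.
have it := integrable_tent y a0.
have ta x : 0 <= tent y a 1 x <= 1 by exact: tent_itv.
apply: (@lt_le_trans _ _ ((c + (h y - c) / 2) * \int[mu]_x tent y a 1 x)).
  by rewrite ltr_pM2r ?tent_integral_gt0// ltrDl.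
have supp x : tent y a 1 x != 0 -> `|h y - h x| < (h y - c) / 2.
  move=> /tent_supp t0; apply: he; apply/rV_ball => // i.
  by have := t0 i; rewrite normrM gtr0_norm// -ltr_pdivlMl// /a invrK mulr1 distrC.
rewrite -RintegralZl//; apply: le_Rintegral => //.
- exact: integrable_scale.
- apply: (@integrable_le _ _ _ _ _ (fun x => (`|h y| + (h y - c) / 2) * tent y a 1 x)) => //.
  + exact: integrable_scale.
  + apply: measurable_funM; first exact: rV_continuous_measurable.
    exact: rV_continuous_measurable (smooth_continuous (smooth_tent _ _ _)).
  + move=> x _; have [t0|t0] := eqVneq (tent y a 1 x) 0; first by rewrite t0 !mulr0 normr0.
    have /andP[? ?] := ta x; rewrite normrM (ger0_norm (_ : 0 <= tent y a 1 x))// ler_wpM2r//.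
    have := supp x t0; rewrite distrC => h1.
    by rewrite -[h x](subrK (h y)) addrC (le_trans (ler_normD _ _))// lerD// ltW.
- move=> x _; have [t0|t0] := eqVneq (tent y a 1 x) 0; first by rewrite t0 !mulr0.
  have /andP[? ?] := ta x; rewrite ler_wpM2r//.
  by have := supp x t0; rewrite ltr_norml => /andP[? ?]; lra.
Qed.

(** Averaging the increments of [f] along a coordinate against bumps, [weak_translation] bounds
    them by the essential bound of the gradient; by continuity of [f] the bound is pointwise. *)
Lemma W1infty_lipschitz (f : V -> R) : W1infty f ->
  exists2 K, 0 <= K & forall x y, `|f x - f y| <= K * enorm (x - y).
Proof.
move=> [cf _ [g fg gb]].
have mf := rV_continuous_measurable cf.
have [M M0 gM] : exists2 M : R, 0 <= M & forall i, measurable_fun setT (fun x => g x 0 i) /\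
    \forall x \ae mu, `|g x 0 i| <= M.
  have /choice[M_ hM] : forall i, exists M : R, \forall x \ae mu, setT x -> `|g x 0 i| <= M.
    by move=> i; case: (gb i).
  exists (\sum_i `|M_ i|); first exact: sumr_ge0.
  move=> i; split; first by case: (gb i).
  apply: filterS (hM i) => x /(_ Logic.I)/le_trans; apply.
  by rewrite (bigD1 i)//= (le_trans (ler_norm _))// lerDl sumr_ge0.
have dir i s x : `|f (x + s *: delta_mx 0 i) - f x| <= M * `|s|.
  set a := s *: _.
  have gen s' (a' := s' *: delta_mx 0 i : V) (k : R) (y : V) : 0 < k ->
      `|\int[mu]_x ((f (x + a') - f x) * tent y k 1 x)| <= M * `|s'| * \int[mu]_x tent y k 1 x.
    move=> k0; have [mg gMi] := gM i.
    have st := smooth_tent y k 1.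
    pose r := 1 / k + `|y|.
    have t0 z : ~ cube r z -> tent y k 1 z = 0.
      move=> nz; rewrite tent_translate; apply: tent0_supp => // h; apply: nz => j.
      have := h j; rewrite !mxE => hj; rewrite -[z 0 j](subrK (y 0 j)).
      by rewrite (le_trans (ler_normD _ _))// lerD// rV_coord_le.
    have mts b : measurable_fun setT (fun z : V => tent y k 1 (z + b)).
      exact: rV_continuous_measurable (smooth_continuous (smooth_shift b st)).
    have mt : measurable_fun setT (tent y k 1).
      exact: rV_continuous_measurable (smooth_continuous st).
    have it := integrable_tent y k0.
    have gG t : `|\int[mu]_z (g z 0 i * tent y k 1 (z + t *: delta_mx 0 i))|
        <= M * \int[mu]_z tent y k 1 z.
      have mgt : measurable_fun setT (fun z : V => g z 0 i * tent y k 1 (z + t *: delta_mx 0 i)).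
        exact: measurable_funM.
      have its := integrable_scale M measurableT (integrable_preserves (rV_shift (t *: delta_mx 0 i)) it).
      have le : (\int[mu]_z `|g z 0 i * tent y k 1 (z + t *: delta_mx 0 i)|%:E <=
          \int[mu]_z (M * tent y k 1 (z + t *: delta_mx 0 i))%:E)%E.
        apply: ae_ge0_le_integral => //.
        - by apply/measurable_EFinP; exact: measurableT_comp.
        - by move=> z _; rewrite lee_fin mulr_ge0//; case/andP: (tent_itv y k 1 (z + t *: delta_mx 0 i)).
        - by apply/measurable_EFinP; exact: measurable_funM.
        - apply: filterS gMi => z gz _; rewrite lee_fin normrM.
          have /andP[? ?] := tent_itv y k 1 (z + t *: delta_mx 0 i).
          by rewrite (ger0_norm (_ : 0 <= tent y k 1 (z + t *: delta_mx 0 i)))// ler_wpM2r.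
      have igt : mu.-integrable setT (EFin \o (fun z : V => g z 0 i * tent y k 1 (z + t *: delta_mx 0 i))).
        apply/integrableP; split; first exact/measurable_EFinP.
        by apply: le_lt_trans le _; rewrite -ge0_fin_numE ?(integrable_fin_num _ its)//;
          apply: integral_ge0 => z _; rewrite lee_fin mulr_ge0//; case/andP: (tent_itv y k 1 (z + t *: delta_mx 0 i)).
      rewrite (le_trans (le_normr_Rintegral measurableT igt))//.
      rewrite -(Rintegral_preserves (rV_shift (t *: delta_mx 0 i)) mt) -RintegralZl//.
        by apply: fine_le => //; apply: integrable_fin_num => //; exact: integrable_abs.
      exact: (integrable_preserves (rV_shift (t *: delta_mx 0 i)) it).
    have := @weak_translation R n f g (continuous_loc_integrable cf) mf i (tent y k 1) r
      _ fg st t0 gG (- s').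
    rewrite normrN [`|s'| * _]mulrCA mulrA; congr (_ <= _); congr (`| _ |).
    have supp_int (h : V -> R) (b : V) : continuous h ->
        mu.-integrable setT (EFin \o (fun z => h z * tent y k 1 (z + b))).
      move=> ch; have mh := rV_continuous_measurable ch.
      apply: (@integrable_mul_supp _ _ h (continuous_loc_integrable ch) mh _ (r + `|b|) 1) => //.
        by move=> z; have /andP[? ?] := tent_itv y k 1 (z + b); rewrite ger0_norm.
      move=> z nz; apply: t0 => h1; apply: nz => j; have := h1 j; rewrite mxE => hj.
      by rewrite -[z 0 j](addrK (b 0 j)) (le_trans (ler_normB _ _))// lerD// rV_coord_le.
    have cfa : continuous (fun z : V => f (z + a')) by exact: continuous_translate.
    have E0 : \int[mu]_x (f x * tent y k 1 (x + - s' *: delta_mx 0 i)) =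
        \int[mu]_x (f (x + a') * tent y k 1 x).
      rewrite -(Rintegral_preserves (rV_shift a')
        (F := fun x : V => f x * tent y k 1 (x + - s' *: delta_mx 0 i))); last exact: measurable_funM.
      by apply: eq_Rintegral => z _; rewrite scaleNr addrK.
    have supp_int0 (h : V -> R) : continuous h ->
        mu.-integrable setT (EFin \o (fun z => h z * tent y k 1 z)).
      move=> ch; have := supp_int h 0 ch.
      suff -> : (fun z : V => h z * tent y k 1 (z + 0)) = fun z => h z * tent y k 1 z by [].
      by apply/funext => z; rewrite addr0.
    rewrite E0 -RintegralB; [|by []|exact: supp_int0|exact: supp_int0].
    by apply: eq_Rintegral => z _; rewrite mulrBl.
  have os s' z : f (z + s' *: delta_mx 0 i) - f z <= M * `|s'|.
    apply: (@tent_average (fun z => f (z + s' *: delta_mx 0 i) - f z)).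
      have cfs : continuous (fun z : V => f (z + s' *: delta_mx 0 i)) by exact: continuous_translate.
      move=> {}z; exact: (cvgB (cfs z) (cf z)).
    by move=> k k0; rewrite (le_trans (ler_norm _))// gen.
  rewrite ler_norml os andbT lerNl opprB.
  have := os (- s) (x + a); rewrite normrN scaleNr -/a addrK.
  by [].
exists (M * n%:R) => [|x y]; first by rewrite mulr_ge0.
set a := x - y.
have h (r : seq 'I_n) : `|f (y + \sum_(i <- r) a 0 i *: delta_mx 0 i) - f y| <=
    \sum_(i <- r) M * `|a 0 i|.
  elim: r => [|i r ih]; first by rewrite !big_nil addr0 subrr normr0.
  rewrite !big_cons (addrC (_ *: _)) addrA.
  by rewrite (le_trans (ler_distD (f (y + \sum_(j <- r) a 0 j *: delta_mx 0 j)) _ _))// lerD.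
have := h (index_enum _); rewrite -row_sum_delta (_ : y + a = x); last first.
  by rewrite /a addrC subrK.
move=> /le_trans; apply.
rewrite -mulrA mulr_natl -[n in _ *+ n]card_ord -sumr_const mulr_sumr.
by apply: ler_sum => i _; rewrite ler_wpM2l// coord_le_enorm.
Qed.
End W1infty_lipschitz.


(** * An explicit monotone scheme for the level-set equation *)

Section step.
Context {R : realType} {n : nat}.
Local Notation V := 'rV[R]_n.
Implicit Types (c u : V -> R) (x y : V).

(** The Hopf-Lax formula over a time [h] for [u_t = c |Du|], the velocity being frozen at its value
    [c x]: the front sweeps the ball of radius [h |c x|]. *)
Definition front_step (h : R) c u x : R :=
  if 0 <= c x then sup [set u y | y in [set y | enorm (y - x) <= h * c x]]
  else inf [set u y | y in [set y | enorm (y - x) <= h * - c x]].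

Variables (h : R) (h0 : 0 <= h).

Section bounded.
Variables (c u : V -> R) (B : R) (uB : forall x, `|u x| <= B).

Lemma front_step_le x a :
  (forall y, enorm (y - x) <= h * `|c x| -> u y <= a) -> front_step h c u x <= a.
Proof.
move=> ua; rewrite /front_step; case: ifPn => cx.
  apply: ge_sup; first by exists (u x), x => //=; rewrite subrr enorm0 mulr_ge0.
  by move=> _ [y hy <-]; apply: ua; rewrite ger0_norm.
have cx' : c x < 0 by rewrite ltNge.
apply: (@le_trans _ _ (u x)); last first.
  by apply: ua; rewrite subrr enorm0 mulr_ge0.
apply: ge_inf; first by exists (- B) => _ [y _ <-]; have := uB y; rewrite ler_norml => /andP[].
by exists x => //=; rewrite subrr enorm0 mulr_ge0// oppr_ge0 ltW.
Qed.

Lemma front_step_sup x y : 0 <= c x -> enorm (y - x) <= h * c x ->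
  u y <= front_step h c u x.
Proof.
move=> cx hy; rewrite /front_step cx; apply: ub_le_sup; last by exists y.
by exists B => _ [z _ <-]; rewrite (le_trans (ler_norm _)).
Qed.

Lemma front_step_inf x y : c x < 0 -> enorm (y - x) <= h * - c x ->
  front_step h c u x <= u y.
Proof.
move=> cx hy; rewrite /front_step; have /negbTE -> : ~~ (0 <= c x) by rewrite -ltNge.
apply: ge_inf; last by exists y.
by exists (- B) => _ [z _ <-]; have := uB z; rewrite ler_norml => /andP[].
Qed.
End bounded.

Lemma front_step_opp c u B x : (forall x, `|u x| <= B) ->
  front_step h (fun y => - c y) (fun y => - u y) x = - front_step h c u x.
Proof.
move=> uB; have [cx|cx|cx] := ltrgtP (c x) 0.
- rewrite /front_step oppr_ge0 ltW// leNgt cx/= /inf opprK; congr sup.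
  by rewrite -image_comp.
- rewrite /front_step oppr_ge0 leNgt cx/= (ltW cx) /inf opprK; congr (- sup _).
  apply/seteqP; split => [_ [_ [y hy <-] <-]|_ [y hy <-]].
    by exists y; rewrite ?opprK//= opprK in hy *.
  by exists (- u y); rewrite ?opprK//; exists y => //=; rewrite opprK.
- have sgl (v : V -> R) : sup [set v y | y in [set y | enorm (y - x) <= 0]] = v x.
    rewrite (_ : [set _ | _] = [set x]) ?image_set1 ?sup1//.
    apply/seteqP; split => y /=; last by move=> ->; rewrite subrr enorm0.
    move=> hy; have : enorm (y - x) = 0 by apply/eqP; rewrite eq_le hy enorm_ge0.
    move=> e0; apply/rowP => i; apply/eqP; rewrite -subr_eq0.
    by have := enorm_eq0 i e0; rewrite !mxE => ->.
  by rewrite /front_step cx oppr0 lexx mulr0 !sgl.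
Qed.

Lemma front_step_ge c u B x a : (forall x, `|u x| <= B) ->
  (forall y, enorm (y - x) <= h * `|c x| -> a <= u y) -> a <= front_step h c u x.
Proof.
move=> uB ua; rewrite -lerN2 -(front_step_opp c x uB).
apply: (front_step_le (B := B)) => [y|y]; first by rewrite normrN.
by rewrite normrN => /ua; rewrite lerN2.
Qed.

Section lipschitz.
Variables (L : R) (L0 : 0 <= L).

Let step_lip_pos c u B K x x' : (forall x, `|u x| <= B) -> 0 <= K ->
  (forall x y, `|u x - u y| <= K * enorm (x - y)) ->
  (forall x y, `|c x - c y| <= L * enorm (x - y)) ->
  0 <= c x -> 0 <= c x' ->
  front_step h c u x <= front_step h c u x' + K * ((1 + h * L) * enorm (x - x')).
Proof.
move=> uB K0 uK cL cx cx'; apply: (front_step_le uB) => y; rewrite ger0_norm// => hy.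
(* [y'] is the competitor [y] carried to the ball around [x'], and shrunk if that ball is smaller;
   the Lipschitz bound on [c] controls the shrinking *)
pose l := if c x <= c x' then 1 else c x' / c x.
have l0 : 0 <= l by rewrite /l; case: ifP => // _; rewrite divr_ge0.
have l1 : l <= 1.
  rewrite /l; case: ifPn => //; rewrite -ltNge => lt.
  by rewrite ler_pdivrMr ?mul1r ?ltW// (le_lt_trans cx').
pose y' := x' + l *: (y - x).
have hy' : enorm (y' - x') <= h * c x'.
  rewrite /y' addrC addKr enormZ ger0_norm// /l; case: ifPn => [le|].
    by rewrite mul1r (le_trans hy)// ler_wpM2l.
  rewrite -ltNge => lt; have cx0 : 0 < c x by rewrite (le_lt_trans cx').
  by rewrite -mulrA (mulrC h) ler_wpM2l// mulrC ler_pdivrMr.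
have key : (1 - l) * enorm (y - x) <= h * L * enorm (x - x').
  rewrite (le_trans (ler_wpM2l _ hy)) ?subr_ge0// /l; case: ifPn => [le|].
    by rewrite subrr mul0r !mulr_ge0// enorm_ge0.
  rewrite -ltNge => lt; have cx0 : 0 < c x by rewrite (le_lt_trans cx').
  rewrite mulrBl mul1r mulrCA divfK ?gt_eqF// -mulrBr -mulrA ler_wpM2l//.
  by rewrite (le_trans (ler_norm _)).
have d : enorm (y - y') <= (1 + h * L) * enorm (x - x').
  rewrite (_ : y - y' = (x - x') + (1 - l) *: (y - x)); last first.
    by rewrite /y' scalerBl scale1r; apply/rowP => i; rewrite !mxE; ring.
  rewrite (le_trans (enormD _ _))// enormZ ger0_norm ?subr_ge0//.
  by move: key; lra.
have := uK y y'; rewrite ler_norml => /andP[_ hu].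
have := front_step_sup uB cx' hy'; have := ler_wpM2l K0 d; lra.
Qed.

(** If the velocity is nonnegative at [x] and negative at [x'], then
    [c x - c x' <= L |x - x'|] forces both balls to be small, and the supremum and the infimum can
    be compared. Equal signs are treated by transport of competitors. *)
Lemma front_step_lip c u B K x x' : (forall x, `|u x| <= B) -> 0 <= K ->
  (forall x y, `|u x - u y| <= K * enorm (x - y)) ->
  (forall x y, `|c x - c y| <= L * enorm (x - y)) ->
  `|front_step h c u x - front_step h c u x'| <= K * ((1 + h * L) * enorm (x - x')).
Proof.
move=> uB K0 uK cL.
suff main z z' : front_step h c u z <= front_step h c u z' + K * ((1 + h * L) * enorm (z - z')).
  rewrite ler_norml; have := main x x'; have := main x' x; rewrite (enormB x' x) => ? ?.
  by apply/andP; split; lra.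
have [cz|cz] := leP 0 (c z); have [cz'|cz'] := leP 0 (c z').
- exact: (step_lip_pos uB).
- apply: (front_step_le uB) => y; rewrite ger0_norm// => hy.
  rewrite -lerBlDr; apply: (front_step_ge uB) => y'; rewrite ltr0_norm// => hy'.
  have := uK y y'; rewrite ler_norml => /andP[_ hu].
  have d1 := enorm_dist z y y'; have d2 := enorm_dist z' z y'.
  have e1 := enormB z' y'; have := cL z z'; rewrite ler_norml => /andP[_ h1].
  have h2 := ler_wpM2l h0 h1.
  have d : enorm (y - y') <= (1 + h * L) * enorm (z - z') by lra.
  by have := ler_wpM2l K0 d; lra.
- have hz : enorm (z - z) <= h * - c z.
    by rewrite subrr enorm0 mulr_ge0// oppr_ge0 ltW.
  have hz' : enorm (z' - z') <= h * c z' by rewrite subrr enorm0 mulr_ge0.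
  have h1 := front_step_inf uB cz hz; have h2 := front_step_sup uB cz' hz'.
  have := uK z z'; rewrite ler_norml => /andP[_ hu].
  have : K * enorm (z - z') <= K * ((1 + h * L) * enorm (z - z')).
    by rewrite ler_wpM2l// ler_peMl ?enorm_ge0// lerDl mulr_ge0.
  lra.
- have uB' y : `|- u y| <= B by rewrite normrN.
  have uK' a b : `|- u a - - u b| <= K * enorm (a - b) by rewrite -opprD normrN.
  have cL' a b : `|- c a - - c b| <= L * enorm (a - b) by rewrite -opprD normrN.
  have := @step_lip_pos (fun y => - c y) (fun y => - u y) B K z' z uB' K0 uK' cL'.
  rewrite !oppr_ge0 (ltW cz) (ltW cz') => /(_ isT isT).
  by rewrite !(front_step_opp _ _ uB) (enormB z' z); lra.
Qed.
End lipschitz.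

Lemma front_step_time c u B K M x : (forall x, `|u x| <= B) -> 0 <= K ->
  (forall x y, `|u x - u y| <= K * enorm (x - y)) -> `|c x| <= M ->
  `|front_step h c u x - u x| <= K * (h * M).
Proof.
move=> uB K0 uK cM.
have bnd y : enorm (y - x) <= h * `|c x| -> `|u y - u x| <= K * (h * M).
  move=> hy; rewrite (le_trans (uK _ _))// ler_wpM2l// (le_trans hy)//.
  by rewrite ler_wpM2l.
rewrite ler_norml; apply/andP; split.
  rewrite lerBrDr; apply: (front_step_ge uB) => y /bnd; rewrite ler_norml => /andP[]; lra.
rewrite lerBlDr; apply: (front_step_le uB) => y /bnd; rewrite ler_norml => /andP[]; lra.
Qed.

Lemma front_step_range c u x : (forall x, -1 <= u x <= 1) ->
  -1 <= front_step h c u x <= 1.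
Proof.
move=> u1; have uB y : `|u y| <= 1 by rewrite ler_norml.
apply/andP; split.
  by apply: (front_step_ge uB) => y _; case/andP: (u1 y).
by apply: (front_step_le uB) => y _; case/andP: (u1 y).
Qed.

Lemma front_step_far c u r M x : (forall x, -1 <= u x <= 1) ->
  (forall x, r <= enorm x -> u x = -1) -> `|c x| <= M -> r + h * M <= enorm x ->
  front_step h c u x = -1.
Proof.
move=> u1 ur cM rx; have uB y : `|u y| <= 1 by rewrite ler_norml.
apply/eqP; rewrite eq_le; apply/andP; split; last by case/andP: (front_step_range c x u1).
apply: (front_step_le uB) => y hy; rewrite ur//.
have := ler_wpM2l h0 cM; have := enormD y (x - y); rewrite addrC subrK (enormB x y); lra.
Qed.

End step.

Section iteration.
Context {R : realType} {n : nat}.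
Local Notation V := 'rV[R]_n.
Variables (h M L K0 R0 : R) (u0 : V -> R) (U c : nat -> V -> R).
Hypotheses (h0 : 0 <= h) (L0 : 0 <= L) (K00 : 0 <= K0).
Hypothesis UO : U 0%N = u0.
Hypothesis US : forall k, U k.+1 = front_step h (c k) (U k).
Hypothesis cM : forall k x, `|c k x| <= M.
Hypothesis cL : forall k x y, `|c k x - c k y| <= L * enorm (x - y).
Hypothesis u01 : forall x, -1 <= u0 x <= 1.
Hypothesis u0K : forall x y, `|u0 x - u0 y| <= K0 * enorm (x - y).
Hypothesis u0far : forall x, R0 <= enorm x -> u0 x = -1.

Lemma scheme_range k x : -1 <= U k x <= 1.
Proof. by elim: k x => [|k ih] x; rewrite ?UO ?US//; exact: front_step_range. Qed.

Lemma scheme_bound k x : `|U k x| <= 1.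
Proof. by rewrite ler_norml; exact: scheme_range. Qed.

(** The factors [1 + h L] of the successive steps accumulate to at most an exponential. *)
Lemma scheme_lip k x y : `|U k x - U k y| <= K0 * expR (L * (k%:R * h)) * enorm (x - y).
Proof.
have E k' : 0 <= K0 * expR (L * (k'%:R * h)) by rewrite mulr_ge0// expR_ge0.
elim: k x y => [|k ih] x y; first by rewrite UO mul0r mulr0 expR0 mulr1.
rewrite US (le_trans (front_step_lip h0 L0 x y (@scheme_bound k) (E k) ih (cL k)))//.
rewrite (_ : _ * ((1 + h * L) * enorm (x - y)) = (K0 * (expR (L * (k%:R * h)) * (1 + h * L))) * enorm (x - y)); last by ring.
rewrite ler_wpM2r ?enorm_ge0// ler_wpM2l//.
rewrite -[in leRHS]addn1 natrD mulrDl mul1r mulrDr expRD ler_wpM2l ?expR_ge0//.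
by rewrite (mulrC L) expR_ge1Dx.
Qed.

Lemma scheme_time_step k x : `|U k.+1 x - U k x| <= K0 * expR (L * (k%:R * h)) * (h * M).
Proof.
rewrite US; apply: (front_step_time h0 (@scheme_bound k)) => //.
  by rewrite mulr_ge0// expR_ge0.
exact: scheme_lip.
Qed.

Lemma scheme_far k x : R0 + k%:R * (h * M) <= enorm x -> U k x = -1.
Proof.
elim: k x => [|k ih] x; first by rewrite UO mul0r addr0; exact: u0far.
rewrite -addn1 natrD mulrDl mul1r addrA addn1 US => hx.
exact: (front_step_far h0 (@scheme_range k) ih (cM k x) hx).
Qed.

Lemma scheme_time j m x T : (j + m)%:R * h <= T -> 0 <= M ->
  `|U (j + m) x - U j x| <= K0 * expR (L * T) * M * (m%:R * h).
Proof.
move=> + M0; elim: m => [|m ih] kT.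
  by rewrite addn0 subrr normr0 mul0r mulr0.
rewrite addnS (le_trans (ler_distD (U (j + m)%N x) _ _))//.
have mT : (j + m)%:R * h <= T.
  by rewrite (le_trans _ kT)// ler_wpM2r// ler_nat leq_add2l.
rewrite -[in leRHS](addn1 m) natrD mulrDl mul1r mulrDr [leRHS]addrC lerD ?ih//.
rewrite (le_trans (scheme_time_step _ _))// -[leRHS]mulrA (mulrC M h).
by rewrite ler_wpM2r ?mulr_ge0// ler_wpM2l// ler_expR ler_wpM2l.
Qed.

End iteration.


(** * Stability of viscosity subsolutions along the scheme *)

Section interval_integrals.
Context {R : realType}.
Local Notation mu := (@lebesgue_measure R).

Lemma Rintegral_oo_split (f : R -> R) (t1 t2 T : R) :
  mu.-integrable `]0, T[ (EFin \o f) -> 0 < t1 -> t1 <= t2 -> t2 <= T ->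
  \int[mu]_(s in `]0, t2[) f s =
  \int[mu]_(s in `]0, t1[) f s + \int[mu]_(s in `[t1, t2[) f s.
Proof.
move=> intf t10 t12 t2T.
have E : `]0, t2[%classic = `]0, t1[ `|` `[t1, t2[ :> set R.
  apply/seteqP; split=> s; rewrite /= !in_itv/=.
    by move=> /andP[s0 st]; have [|] := ltP s t1 => h; [left|right]; rewrite ?s0 ?h.
  by move=> [/andP[s0 s1]|/andP[s0 s1]]; apply/andP; split => //; lra.
rewrite E Rintegral_setU//.
  rewrite -E; apply: (integrableS _ _ _ intf) => //.
  by move=> s; rewrite /= !in_itv/= => /andP[-> /=]; lra.
apply/disj_set2P; rewrite -subset0 => s []; rewrite /= !in_itv/=.
by move=> /andP[_ ?] /andP[? _]; lra.
Qed.

Lemma integrable_co (f : R -> R) (t1 t2 T : R) :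
  mu.-integrable `]0, T[ (EFin \o f) -> 0 < t1 -> t2 <= T ->
  mu.-integrable `[t1, t2[ (EFin \o f).
Proof.
move=> intf t10 t2T; apply: (integrableS _ _ _ intf) => // s; rewrite /= !in_itv/=.
by move=> /andP[? ?]; apply/andP; split; lra.
Qed.

Lemma Rintegral_co_cst (c t1 t2 : R) : t1 <= t2 ->
  \int[mu]_(s in `[t1, t2[) c = c * (t2 - t1).
Proof.
move=> t12; rewrite Rintegral_cst//= lebesgue_measure_itv/= lte_fin.
by case: ltP => //= h; rewrite (_ : t2 = t1) ?subrr//; apply/eqP; rewrite eq_le t12 h.
Qed.

Lemma lebesgue_co_fin (t1 t2 : R) :
  (lebesgue_measure (`[t1, t2[%classic : set (measurableTypeR R)) < +oo)%E.
Proof. by rewrite lebesgue_measure_itv/=; case: ifP => // _; rewrite -EFinB ltry. Qed.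

Lemma integrable_co_cst (c t1 t2 : R) : mu.-integrable `[t1, t2[ (EFin \o (fun _ => c)).
Proof.
apply: measurable_bounded_integrable => //.
- exact: lebesgue_co_fin.
- exists `|c|; split; first exact: num_real.
  by move=> M cM x _ /=; rewrite ltW.
Qed.

Lemma ae_Rintegral_le (f : R -> R) (c t1 t2 : R) : t1 <= t2 ->
  mu.-integrable `[t1, t2[ (EFin \o f) ->
  (\forall s \ae mu, s \in `[t1, t2[ -> f s <= c) ->
  \int[mu]_(s in `[t1, t2[) f s <= c * (t2 - t1).
Proof.
move=> t12 intf fc.
have ig : mu.-integrable `[t1, t2[ (EFin \o (fun s => c - f s)).
  by apply: integrable_sub => //; exact: integrable_co_cst.
rewrite -(Rintegral_co_cst c t12) -subr_ge0 -RintegralB//; last exact: integrable_co_cst.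
have mg : measurable_fun `[t1, t2[ (fun s => c - f s) by exact: integrable_measurable ig.
rewrite (_ : \int[mu]_(s in _) _ = \int[mu]_(s in `[t1, t2[) `|c - f s|).
  by apply: Rintegral_ge0.
congr fine; apply: ae_eq_integral => //.
- exact/measurable_EFinP.
- by apply/measurable_EFinP; exact: measurableT_comp.
- apply: (@filterS _ _ (ae_filter_ringOfSetsType (@lebesgue_measure R)) _ _ _ fc) => s h ts /=; rewrite ger0_norm// subr_ge0; exact: h.
Qed.

Lemma integral_oo_continuous (b : R -> R) (T t0 : R) :
  mu.-integrable `]0, T[ (EFin \o b) -> 0 < t0 < T ->
  forall e, 0 < e -> exists2 d, 0 < d & forall t, `|t - t0| <= d ->
    `|\int[mu]_(s in `]0, t[) b s - \int[mu]_(s in `]0, t0[) b s| <= e.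
Proof.
move=> ib /andP[t00 t0T] e e0.
pose f := b \_ `]0, T[.
have intf : mu.-integrable setT (EFin \o f).
  have /(_ ib) := (@integrable_mkcond _ _ R mu _ (EFin \o b) (measurable_itv `]0, T[)).1.
  by rewrite restrict_EFin.
have fE t : t <= T -> \int[mu]_(s in `]0, t[) b s = \int[mu]_(s in `[0, t]) f s.
  move=> tT; have ifI (i : interval R) : mu.-integrable [set` i] (EFin \o f).
    exact: integrableS intf.
  rewrite -Rintegral_itv_obnd_cbnd// -Rintegral_itv_bndo_bndc//.
  apply: eq_Rintegral => s; rewrite inE/= in_itv/= => /andP[s0 st].
  by rewrite /f patchE mem_set//= in_itv/= s0 (lt_le_trans st).
have T0 : 0 <= T by lra.
have := @parameterized_integral_continuous R 0 T f T0.
have i0T : mu.-integrable `[0, T] (EFin \o f) by exact: integrableS intf.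
have TT : 0 < T by lra.
move=> /(_ i0T)/(continuous_within_itvP _ TT)[/(_ t0)].
have t0in : t0 \in `]0, T[ by rewrite in_itv/= t00 t0T.
move=> /(_ t0in)/cvgrPdist_le/(_ _ e0)/nbhs_ballP[d /= d0 dP] _ _.
exists (Num.min (d / 2) (T - t0)) => [|t]; first by rewrite lt_min divr_gt0//= subr_gt0.
rewrite le_min => /andP[td tT]; rewrite distrC fE ?(ltW t0T)// fE; last first.
  by move: tT; rewrite ler_norml => /andP[]; lra.
apply: dP; rewrite /ball/= distrC (le_lt_trans td)//; lra.
Qed.

End interval_integrals.

Section linear_step.
Context {R : realType} {n : nat}.
Local Notation V := 'rV[R]_n.

(** For nonnegative [c] this is Cauchy-Schwarz. For negative [c], the infimum is tested at the
    point at distance [h |c x|] from [x] in the direction [- p]. *)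
Lemma front_step_linear (h : R) (c u : V -> R) (B A : R) (p x : V) : 0 <= h ->
  (forall x, `|u x| <= B) ->
  (forall y, enorm (y - x) <= h * `|c x| -> u y <= A + dotp p (y - x)) ->
  front_step h c u x <= A + h * c x * enorm p.
Proof.
move=> h0 uB uA; have [cx|cx] := leP 0 (c x).
  apply: (front_step_le h0 uB) => y hy; rewrite (le_trans (uA y hy))// lerD2l.
  rewrite (le_trans (dotp_le _ _))// mulrC ler_wpM2r ?enorm_ge0//.
  by rewrite (le_trans hy)// ger0_norm.
have [p0|p0] := eqVneq (enorm p) 0.
  rewrite p0 mulr0 addr0 (front_step_le h0 uB)// => y hy.
  rewrite (le_trans (uA y hy))// gerDl (le_trans (dotp_le _ _))//.
  by rewrite p0 mul0r.
have {}p0 : 0 < enorm p by rewrite lt_neqAle eq_sym p0 enorm_ge0.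
pose y := x + (h * c x / enorm p) *: p.
have yx : y - x = (h * c x / enorm p) *: p by rewrite /y addrC addKr.
have hy : enorm (y - x) = h * - c x.
  rewrite yx enormZ normrM normfV (gtr0_norm p0) divfK ?gt_eqF//.
  by rewrite normrM (ger0_norm h0) ltr0_norm.
rewrite (le_trans (front_step_inf uB cx (_ : enorm (y - x) <= _)))// ?hy//.
rewrite (le_trans (uA y _))//; first by rewrite hy ltr0_norm.
rewrite lerD2l yx dotpC dotpZl -sqr_enorm expr2 mulrA divfK ?gt_eqF//.
Qed.
End linear_step.

Section stability.
Context {R : realType} {n : nat}.
Local Notation V := 'rV[R]_n.
Local Notation mu := (@lebesgue_measure R).
Variables (T M L : R) (F : set_system nat) (FF : ProperFilter F).
Variables (h : nat -> R) (U c : nat -> nat -> V -> R).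
Hypotheses (h_gt0 : forall m, 0 < h m) (h_cvg : h @ F --> 0) (L0 : 0 <= L) (M0 : 0 <= M).
Hypothesis US : forall m k, U m k.+1 = front_step (h m) (c m k) (U m k).
Hypothesis U1 : forall m k x, `|U m k x| <= 1.
Hypothesis cM : forall m k x, `|c m k x| <= M.
Hypothesis cL : forall m k x y, `|c m k x - c m k y| <= L * enorm (x - y).

Definition time_index (m : nat) (t : R) := Num.truncn (t / h m).

Lemma time_index_step m k s : k%:R * h m <= s < k.+1%:R * h m -> time_index m s = k.
Proof.
move=> hs; apply: truncn_def; rewrite ler_pdivlMr// ltr_pdivrMr//.
Qed.

Variables (u : V * R -> R) (cbar : R -> R) (x0 : V) (t0 : R) (b : R -> R).
Variables (phi : V * R -> R) (p0 : V) (a Gam : R).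
Hypothesis t0T : 0 < t0 < T.
Hypothesis ib : mu.-integrable `]0, T[ (EFin \o b).
Hypothesis icbar : mu.-integrable `]0, T[ (EFin \o cbar).
Hypothesis ic : forall m, mu.-integrable `]0, T[ (EFin \o (fun s => c m (time_index m s) x0)).
Hypothesis u_cont : forall e, 0 < e -> exists2 d, 0 < d &
  forall t, `|t - t0| <= d -> `|u (x0, t) - u (x0, t0)| <= e.
Hypothesis U_cvg : exists2 r, 0 < r & forall e, 0 < e -> \forall m \near F,
  forall x k, enorm (x - x0) <= r -> `|k%:R * h m - t0| <= r ->
    `|U m k x - u (x, k%:R * h m)| <= e.
Hypothesis c_cvg : exists2 r, 0 < r & forall e, 0 < e -> \forall m \near F,
  forall t, `|t - t0| <= r ->
    `|\int[mu]_(s in `]0, t[) (c m (time_index m s) x0 - cbar s)| <= e.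
Hypothesis phi_diff : forall e, 0 < e -> exists2 r, 0 < r & forall x y t s,
  enorm (x - x0) <= r -> enorm (y - x0) <= r -> `|t - t0| <= r -> `|s - t0| <= r ->
  `|phi (y, s) - phi (x, t) - dotp p0 (y - x) - a * (s - t)| <=
    e * (enorm (y - x) + `|s - t|).
Hypothesis hGam : forall e, 0 < e -> exists2 r, 0 < r &
  \forall s \ae mu, `|s - t0| <= r -> cbar s * enorm p0 - b s <= Gam + e.
Let B t := \int[mu]_(s in `]0, t[) b s.
Hypothesis u_max : exists2 r, 0 < r & forall x t, enorm (x - x0) <= r -> `|t - t0| <= r ->
  u (x, t) - B t - phi (x, t) <= u (x0, t0) - B t0 - phi (x0, t0).

(* the penalisation makes the maximum strict, so that approximate maxima on the grid stay away
   from the boundary of the box *)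
Let phi' z := phi z + enorm (z.1 - x0) ^+ 2 + (z.2 - t0) ^+ 2.

Let phi'_diff e : 0 < e -> exists2 r, 0 < r & forall x y t s,
  enorm (x - x0) <= r -> enorm (y - x0) <= r -> `|t - t0| <= r -> `|s - t0| <= r ->
  `|phi' (y, s) - phi' (x, t) - dotp p0 (y - x) - a * (s - t)| <=
    e * (enorm (y - x) + `|s - t|).
Proof.
move=> e0; have e2 : 0 < e / 2 by rewrite divr_gt0.
have [r r0 hr] := phi_diff e2; exists (Num.min r (e / 4)).
  by rewrite lt_min r0 divr_gt0.
move=> x y t s; rewrite !le_min => /andP[xr xe] /andP[yr ye] /andP[tr te] /andP[sr se].
have := hr x y t s xr yr tr sr.
have q : `|enorm (y - x0) ^+ 2 - enorm (x - x0) ^+ 2| <= e / 2 * enorm (y - x).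
  rewrite subr_sqr normrM mulrC ler_pM//.
    by rewrite (ger0_norm (addr_ge0 (enorm_ge0 _) (enorm_ge0 _))); lra.
  have := enorm_dist x y x0; have := enorm_dist y x x0; rewrite (enormB x y) => ? ?.
  by rewrite ler_norml; apply/andP; split; lra.
have q' : `|(s - t0) ^+ 2 - (t - t0) ^+ 2| <= e / 2 * `|s - t|.
  rewrite subr_sqr normrM mulrC ler_pM//; first by rewrite (le_trans (ler_normD _ _))//; lra.
  by rewrite opprB addrA subrK.
move: q q'; rewrite /phi' /=.
set A := enorm (y - x0) ^+ 2; set A' := enorm (x - x0) ^+ 2.
set D := (s - t0) ^+ 2; set D' := (t - t0) ^+ 2.
rewrite !ler_norml => /andP[? ?] /andP[? ?] /andP[? ?].
by apply/andP; split; lra.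
Qed.

Ltac forget := repeat match goal with H : is_true _ |- _ =>
  tryif first [constr_eq H L0|constr_eq H M0|constr_eq H t0T] then fail else clear H end.
Ltac slra := forget; intros; lra.

(** The velocities [c m] converge to [cbar] after integration in time only. The remedy is to replace
    [b] by [bn = b + |p0| (c m - cbar)], the velocities being taken at [x0]: the primitive of [bn]
    converges uniformly to that of [b], so that the maximum of [u - B - phi] at [(x0, t0)] survives
    as an approximate maximum on the grid for the scheme corrected by the primitive of [bn].
    Comparing two consecutive times at this point, one step of the scheme acts on an affine
    function as in [front_step_linear]; the contribution of [c m] cancels with that of [bn] and
    only the time average of [cbar |p0| - b], at most [Gam] up to a small error, remains. *)
Theorem scheme_stability : a <= Gam.
Proof.
have /andP[t00 t0T'] := t0T.
pose K := 6 + 3 * M.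
suff main e : 0 < e -> a <= Gam + e * K.
  apply/ler_addgt0Pr => e e0; have K0 : 0 < K by rewrite /K ltr_pwDl// mulr_ge0.
  by have := main (e / K) (divr_gt0 e0 K0); rewrite divfK ?gt_eqF.
move=> e0.
have [r1 r10 h1] := phi'_diff e0.
have [r2 r20 h2] := hGam e0.
have [r3 r30 h3] := u_max.
have [r4 r40 h4] := U_cvg.
have [r5 r50 h5] := c_cvg.
set P := enorm p0; have P0 : 0 <= P := enorm_ge0 p0.
pose r6 := e / (L * P + 1); have r60 : 0 < r6 by rewrite divr_gt0// ltr_wpDl ?mulr_ge0.
have r6P : L * P * r6 <= e.
  rewrite /r6 mulrA ler_pdivrMr ?ltr_wpDl ?mulr_ge0// mulrC ler_wpM2l ?(ltW e0)// lerDl //.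
have [r7 [r70 r7a r7b]] : exists r7, [/\ 0 < r7, r7 <= t0 / 2 & r7 <= (T - t0) / 2].
  exists (Num.min (t0 / 2) ((T - t0) / 2)).
  by rewrite lt_min !divr_gt0 ?subr_gt0//; split => //; rewrite ge_min lexx ?orbT.
pose r := Num.min r1 (Num.min r2 (Num.min r3 (Num.min r4 (Num.min r5 (Num.min r6 r7))))).
have r0 : 0 < r by rewrite /r !lt_min r10 r20 r30 r40 r50 r60 r70.
have [rr1 rr2 rr3 rr4] : [/\ r <= r1, r <= r2, r <= r3 & r <= r4].
  by rewrite /r !ge_min !lexx !orbT.
have [rr5 rr6 rr7] : [/\ r <= r5, r <= r6 & r <= r7].
  by rewrite /r !ge_min !lexx !orbT.
have [rt0 rT] : r <= t0 / 2 /\ r <= (T - t0) / 2.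
  by split; rewrite (le_trans rr7).
have rLP : L * P * r <= e by rewrite (le_trans _ r6P)// ler_wpM2l ?mulr_ge0.
clearbody r.
pose del := (r / 2) ^+ 2; have del0 : 0 < del by rewrite exprn_gt0// divr_gt0.
have del8 : 0 < del / 8 by rewrite divr_gt0.
pose psi x t := u (x, t) - B t - phi' (x, t).
pose psi0 := psi x0 t0.
have psi_le x t : enorm (x - x0) <= r -> `|t - t0| <= r ->
    psi x t <= psi0 - enorm (x - x0) ^+ 2 - (t - t0) ^+ 2.
  move=> xr tr; have := h3 x t (le_trans xr rr3) (le_trans tr rr3).
  by rewrite /psi0 /psi /phi' /= !subrr enorm0 expr0n /=; slra.
(* [t0] need not be a grid time, so [psi x0] must be controlled around it *)
have [d d0 hd] : exists2 d, 0 < d & forall t, `|t - t0| <= d -> psi0 - del / 4 <= psi x0 t.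
  have e16 : 0 < del / 16 by rewrite divr_gt0.
  have [d1 d10 hd1] := u_cont e16.
  have [d2 d20 hd2] := integral_oo_continuous ib t0T e16.
  have ae0 : 0 < `|a| + e by rewrite ltr_wpDl.
  exists (Num.min r (Num.min d1 (Num.min d2 (del / 8 / (`|a| + e))))).
    by rewrite !lt_min r0 d10 d20 !divr_gt0.
  move=> t; rewrite !le_min => /andP[tr /andP[td1 /andP[td2 td3]]].
  have := hd1 t td1; have := hd2 t td2; rewrite -!/(B _).
  have z0 : enorm (x0 - x0) <= r1 by rewrite subrr enorm0 ltW.
  have tt0 : `|t0 - t0| <= r1 by rewrite subrr normr0 ltW.
  have := h1 x0 x0 t0 t z0 z0 tt0 (le_trans tr rr1).
  rewrite subrr enorm0 add0r (_ : dotp p0 0 = 0); last first.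
    by rewrite dotpC /dotp big1// => i _; rewrite mxE mul0r.
  have : `|a * (t - t0)| <= `|a| * `|t - t0| by rewrite normrM.
  move: td3; rewrite ler_pdivlMr// mulrDr (mulrC _ `|a|) (mulrC _ e).
  rewrite /psi0 /psi; set X := phi' (x0, t); set X0 := phi' (x0, t0).
  set Y := `|a| * `|t - t0|; set Z := e * `|t - t0|; set AA := a * (t - t0).
  rewrite !ler_norml; forget=> ? /andP[? ?] /andP[? ?] /andP[? ?] /andP[? ?]; lra.
pose eta := Num.min (r / 4) (Num.min (r / 2 / (M + 1)) (Num.min e (Num.min (del / 8) (Num.min 1 d)))).
have M1 : 0 < M + 1 by rewrite ltr_wpDl.
have eta0 : 0 < eta by rewrite !lt_min ltr01 d0 e0 del8 !divr_gt0.
have delP : 0 < del / 8 / (P + 1) by rewrite divr_gt0// ltr_wpDl.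
have [m [hm cvu cvc]] : exists m, [/\ h m <= eta,
    forall x k, enorm (x - x0) <= r4 -> `|k%:R * h m - t0| <= r4 ->
      `|U m k x - u (x, k%:R * h m)| <= del / 8 &
    forall t, `|t - t0| <= r5 ->
      `|\int[mu]_(s in `]0, t[) (c m (time_index m s) x0 - cbar s)| <= del / 8 / (P + 1)].
  have hF : \forall m \near F, h m <= eta.
    have /cvgrPdist_le/(_ _ eta0) := h_cvg; apply: filterS => m.
    by rewrite sub0r normrN; apply: le_trans; exact: ler_norm.
  have [m [[? ?] ?]] := @filter_ex _ F _ _ (@filterI _ F _ _ _ (@filterI _ F _ _ _ hF (h4 _ del8)) (h5 _ delP)).
  by exists m.
have hm0 := h_gt0 m.
move: hm; rewrite /eta !le_min => /andP[hr4 /andP[hM /andP[he /andP[hdel /andP[hone hd']]]]].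
have {}hM : h m * M <= r / 2.
  move: hM; rewrite ler_pdivlMr// mulrDr mulr1 => hM.
  by rewrite (le_trans _ hM)// lerDl ltW.
(* the correction of [b] by the oscillating part of the velocity, with small primitive *)
pose bn s := b s + P * (c m (time_index m s) x0 - cbar s).
have icb : mu.-integrable `]0, T[ (EFin \o (fun s => c m (time_index m s) x0 - cbar s)).
  exact: integrable_sub.
have ibn : mu.-integrable `]0, T[ (EFin \o bn).
  by apply: integrable_add => //; exact: integrable_scale.
pose Bn t := \int[mu]_(s in `]0, t[) bn s.
have BnE t : `|t - t0| <= r -> `|Bn t - B t| <= del / 8.
  move=> tr; have tT : t <= T by move: tr rT; rewrite ler_norml; move: t0T'; forget=> ? /andP[]; lra.
  have sub (f : R -> R) : mu.-integrable `]0, T[ (EFin \o f) -> mu.-integrable `]0, t[ (EFin \o f).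
    move=> intf; apply: (integrableS _ _ _ intf) => // s; rewrite /= !in_itv/=.
    by move=> /andP[? ?]; apply/andP; split => //; exact: lt_le_trans tT.
  have i1 : mu.-integrable `]0, t[ (EFin \o (fun s => P * (c m (time_index m s) x0 - cbar s))).
    by apply: sub; exact: integrable_scale.
  rewrite /Bn /bn RintegralD//; last exact: sub.
  rewrite addrAC subrr add0r RintegralZl//; last exact: sub.
  rewrite normrM ger0_norm// (le_trans (ler_wpM2l P0 (cvc t (le_trans tr rr5))))//.
  rewrite mulrA ler_pdivrMr ?ltr_wpDl// mulrC ler_wpM2l ?lerDl// ltW//.
pose val k x := U m k x - Bn (k%:R * h m) - phi' (x, k%:R * h m).
have val_psi k x : enorm (x - x0) <= r -> `|k%:R * h m - t0| <= r ->
    `|val k x - psi x (k%:R * h m)| <= del / 4.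
  move=> xr kr; have := cvu x k (le_trans xr rr4) (le_trans kr rr4).
  have := BnE _ kr; rewrite /val /psi; set X := phi' _; set Y := Bn _; set Z := B _.
  rewrite !ler_norml; forget=> /andP[? ?] /andP[? ?]; apply/andP; split; lra.
pose X := [set v | exists k x, [/\ enorm (x - x0) <= r, `|k%:R * h m - t0| <= r & v = val k x]].
have Xub : ubound X (psi0 + del / 4).
  move=> _ [k [x [xr kr ->]]]; have := val_psi k x xr kr; have := psi_le _ _ xr kr.
  have := sqr_ge0 (enorm (x - x0)); have := sqr_ge0 (k%:R * h m - t0).
  by rewrite ler_norml; forget=> ? ? ? /andP[? ?]; lra.
pose k0 := Num.truncn (t0 / h m).
have k0t : `|k0%:R * h m - t0| <= h m.
  have /truncn_itv : 0 <= t0 / h m by rewrite divr_ge0// ltW.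
  rewrite -/k0 ler_pdivlMr// ltr_pdivrMr// -addn1 natrD mulrDl mul1r ler_norml.
  by move: hm0; forget=> ? /andP[? ?]; apply/andP; split; lra.
have xx0 : enorm (x0 - x0) <= r by rewrite subrr enorm0 ltW.
have k0r : `|k0%:R * h m - t0| <= r by rewrite (le_trans k0t)//; move: hr4 r0; slra.
have X0 : X (val k0 x0) by exists k0, x0.
have supX : has_sup X by split; [exists (val k0 x0)|exists (psi0 + del / 4)].
have v0 : psi0 - del / 2 <= val k0 x0.
  have := val_psi k0 x0 xx0 k0r; have := hd _ (le_trans k0t hd').
  by rewrite ler_norml; forget=> ? /andP[? ?]; lra.
have h20 : 0 < h m ^+ 2 by rewrite exprn_gt0.
have h2del : h m ^+ 2 <= del / 8.
  by rewrite (le_trans _ hdel)// expr2 ler_piMl// ltW.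
(* suprema over balls need not be attained; an error [h ^+ 2] is negligible against one step *)
have [_ [k [x [xr kr ->]]] vmax] := sup_adherent h20 supX.
have vle k' x' : enorm (x' - x0) <= r -> `|k'%:R * h m - t0| <= r -> val k' x' <= val k x + h m ^+ 2.
  move=> xr' kr'; rewrite -lerBlDr; apply/ltW; apply: le_lt_trans vmax.
  by rewrite lerB//; apply: ub_le_sup; [case: supX|exists k', x'].
have inner : enorm (x - x0) ^+ 2 + (k%:R * h m - t0) ^+ 2 <= del.
  have := vle k0 x0 xx0 k0r; have := val_psi k x xr kr; have := psi_le _ _ xr kr.
  have := v0; move: h2del del0; rewrite ler_norml; forget=> ? ? ? ? /andP[? ?] ?; lra.
have r20' : 0 <= r / 2 by rewrite divr_ge0// ltW.
have xr2 : enorm (x - x0) <= r / 2.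
  rewrite -ler_sqr ?nnegrE ?enorm_ge0//; rewrite -/del.
  by have := sqr_ge0 (k%:R * h m - t0); move: inner; slra.
have kr2 : `|k%:R * h m - t0| <= r / 2.
  rewrite -ler_sqr ?nnegrE//; rewrite -/del real_normK ?num_real//.
  by have := sqr_ge0 (enorm (x - x0)); move: inner; slra.
case: k xr kr vmax vle inner xr2 kr2 => [|k] xr kr vmax vle inner xr2 kr2.
  by move: rt0 kr2; rewrite mul0r sub0r normrN (gtr0_norm t00); move: t00; slra.
pose t := k%:R * h m; pose t' := k.+1%:R * h m.
have tt' : t' = t + h m by rewrite /t' -addn1 natrD mulrDl mul1r.
move: kr kr2; rewrite -/t' => kr kr2.
have trr : `|t - t0| <= r.
  move: kr2 hr4 hm0 r0; rewrite tt' !ler_norml; forget=> /andP[? ?] ? ? ?; apply/andP; split; lra.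
have tpos : 0 < t by move: trr rt0 t00; rewrite ler_norml; forget=> /andP[? ?]; lra.
have tT : t' <= T by move: kr rT t0T'; rewrite ler_norml; forget=> /andP[? ?]; lra.
pose q := c m k x.
have qM : `|q| <= M by exact: cM.
pose A := U m k.+1 x + h m ^+ 2 + (Bn t - Bn t') - a * h m + e * ((M + 1) * h m).
have lin y : enorm (y - x) <= h m * `|q| -> U m k y <= A + dotp p0 (y - x).
  move=> hy; have hyM : enorm (y - x) <= h m * M.
    by rewrite (le_trans hy)// ler_wpM2l// ltW.
  have yr : enorm (y - x0) <= r by have := enorm_dist x y x0; move: hyM hM xr2; slra.
  have := vle k y yr trr; rewrite /val -/t -/t'.
  have := h1 y x t t' (le_trans yr rr1) (le_trans xr rr1) (le_trans trr rr1) (le_trans kr rr1).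
  have -> : dotp p0 (x - y) = - dotp p0 (y - x).
    by rewrite dotpC -opprB -scaleN1r dotpZl mulN1r dotpC.
  rewrite (enormB x y) (_ : t' - t = h m); last by rewrite tt' addrC addKr.
  rewrite (gtr0_norm hm0) => h8.
  have : e * (enorm (y - x) + h m) <= e * ((M + 1) * h m).
    by rewrite ler_wpM2l ?(ltW e0)//; move: hyM; slra.
  move: h8; rewrite /A; set Y := phi' _; set Y' := phi' _; set Z := dotp _ _.
  by rewrite ler_norml; forget=> /andP[? ?] ? ?; lra.
have step := @front_step_linear R n (h m) (c m k) (U m k) 1 A p0 x (ltW hm0) (U1 m k) lin; rewrite -US -/q -/P in step.
have split_Bn : Bn t' = Bn t + \int[mu]_(s in `[t, t'[) bn s.
  by apply: Rintegral_oo_split ibn _ _ _ => //; rewrite tt' lerDl ltW.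
have idx s : s \in `[t, t'[ -> time_index m s = k.
  by rewrite in_itv/= => hs; apply: time_index_step.
pose beta s := P * cbar s - b s.
have ibeta : mu.-integrable `]0, T[ (EFin \o beta).
  by apply: integrable_sub => //; exact: integrable_scale.
have bnE : \int[mu]_(s in `[t, t'[) bn s = P * c m k x0 * h m - \int[mu]_(s in `[t, t'[) beta s.
  have tt : t <= t' by rewrite tt' lerDl ltW.
  rewrite (_ : h m = t' - t); last by rewrite tt' addrC addKr.
  rewrite -Rintegral_co_cst// -RintegralB//.
  - apply: eq_Rintegral => s; rewrite inE/= => ts.
    by rewrite /bn idx// /beta; ring.
  - exact: integrable_co_cst.
  - exact: integrable_co ibeta _ _.
have betaE : \int[mu]_(s in `[t, t'[) beta s <= (Gam + e) * h m.
  have tt : t <= t' by rewrite tt' lerDl ltW.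
  rewrite (_ : h m = t' - t); last by rewrite tt' addrC addKr.
  apply: ae_Rintegral_le => //; first exact: integrable_co ibeta _ _.
  apply: (@filterS _ _ (ae_filter_ringOfSetsType (@lebesgue_measure R)) _ _ _ h2) => s hs.
  rewrite in_itv/= => /andP[ts st]; rewrite /beta mulrC; apply: hs.
  apply: le_trans rr2; move: trr kr ts st; rewrite !ler_norml; forget.
  by move=> /andP[? ?] /andP[? ?] *; apply/andP; split; lra.
have cxx : q <= c m k x0 + L * r.
  have := cL m k x x0; rewrite -/q ler_norml => /andP[_].
  have := ler_wpM2l L0 xr; slra.
have qP : h m * q * P <= h m * (P * c m k x0 + e).
  rewrite -mulrA ler_wpM2l ?(ltW hm0)//; have := ler_wpM2r P0 cxx.
  by rewrite mulrDl; move: rLP; slra.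
have hh : h m ^+ 2 <= h m * e by rewrite expr2 ler_wpM2l// ltW.
suff : a * h m <= (Gam + e * K) * h m by rewrite ler_pM2r.
move: step; rewrite /A split_Bn bnE /K.
have eh0 : 0 <= e * h m by rewrite mulr_ge0// ltW.
have ehM0 : 0 <= e * h m * M by rewrite mulr_ge0.
set I := \int[mu]_(s in _) beta s in betaE *; move: betaE qP hh eh0 ehM0; slra.
Qed.

End stability.


(** * The nonlocal velocity *)

Section convolution_bounds.
Context {R : realType} {n : nat}.
Local Notation V := 'rV[R]_n.
Local Notation mu := (@lebesgue_rV R n).
Implicit Types (f g chi : V -> R) (x y : V).

Lemma integrable_reflect f x : mu.-integrable setT (EFin \o f) ->
  mu.-integrable setT (EFin \o (fun y => f (x - y))).
Proof. exact: (integrable_preserves (rV_reflect x)). Qed.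

Lemma Rintegral_reflect f x : measurable_fun setT f ->
  \int[mu]_y f (x - y) = \int[mu]_y f y.
Proof. exact: (Rintegral_preserves (rV_reflect x)). Qed.

Section chi.
Variables (chi : V -> R) (mchi : measurable_fun setT chi).
Hypothesis chi01 : forall y, 0 <= chi y <= 1.

Let chi1 y : `|chi y| <= 1.
Proof. by have /andP[? ?] := chi01 y; rewrite ger0_norm. Qed.

Lemma integrable_convolution f x : mu.-integrable setT (EFin \o f) ->
  mu.-integrable setT (EFin \o (fun y => f (x - y) * chi y)).
Proof.
move=> intf; rewrite (_ : (fun y => _) = fun y => chi y * f (x - y)).
  by apply: integrable_mul_le1 => //; exact: integrable_reflect.
by apply/funext => y; rewrite mulrC.
Qed.

Lemma convolution_diff_le f g x x' : mu.-integrable setT (EFin \o f) ->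
  mu.-integrable setT (EFin \o g) ->
  `|convolution f chi x - convolution g chi x'| <= \int[mu]_y `|f (x - y) - g (x' - y)|.
Proof.
move=> intf intg; rewrite /convolution -RintegralB//; [|exact: integrable_convolution..].
apply: Rintegral_abs_le => //.
- by apply: integrable_abs => //; apply: integrable_sub => //; exact: integrable_reflect.
- apply: measurable_funB; apply: integrable_measurable; exact: integrable_convolution.
- by move=> y _; rewrite -mulrBl normrM ler_piMr.
Qed.

Lemma convolution_bound f x : mu.-integrable setT (EFin \o f) ->
  `|convolution f chi x| <= \int[mu]_y `|f y|.
Proof.
move=> intf; rewrite -(Rintegral_reflect (f := fun y => `|f y|) x); last first.
  by apply: measurableT_comp => //; exact: integrable_measurable intf.
apply: Rintegral_abs_le => //.
- by apply: integrable_abs => //; exact: integrable_reflect.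
- by apply: integrable_measurable; exact: integrable_convolution.
- by move=> y _; rewrite normrM ler_piMr.
Qed.

Lemma convolution_lip f x x' : mu.-integrable setT (EFin \o f) ->
  `|convolution f chi x - convolution f chi x'| <= L1_shift f (x - x').
Proof.
move=> intf; rewrite (le_trans (convolution_diff_le _ _ intf intf))//.
rewrite /L1_shift -(Rintegral_reflect (f := fun y => `|f (y + (x - x')) - f y|) x'); last first.
  apply: measurableT_comp => //; apply: measurable_funB.
    exact: integrable_measurable (integrable_shift intf _).
  exact: integrable_measurable intf.
rewrite le_eqVlt; apply/orP; left; apply/eqP; apply: eq_Rintegral => y _.
by congr `|f _ - _|; apply/rowP => i; rewrite !mxE; ring.
Qed.

Lemma convolution_dist f g x : mu.-integrable setT (EFin \o f) ->
  mu.-integrable setT (EFin \o g) ->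
  `|convolution f chi x - convolution g chi x| <= \int[mu]_y `|f y - g y|.
Proof.
move=> intf intg; rewrite (le_trans (convolution_diff_le _ _ intf intg))//.
rewrite (Rintegral_reflect (f := fun y => `|f y - g y|))//.
apply: measurableT_comp => //; apply: measurable_funB.
  exact: integrable_measurable intf.
exact: integrable_measurable intg.
Qed.
End chi.

Definition L1_dist f g := \int[mu]_y `|f y - g y|.

Lemma L1_dist_triangle f g k : mu.-integrable setT (EFin \o f) ->
  mu.-integrable setT (EFin \o g) -> mu.-integrable setT (EFin \o k) ->
  L1_dist f k <= L1_dist f g + L1_dist g k.
Proof.
move=> intf intg ik; rewrite /L1_dist.
have i1 : mu.-integrable setT (EFin \o (fun y => `|f y - g y|)).
  by apply: integrable_abs => //; exact: integrable_sub.
have i2 : mu.-integrable setT (EFin \o (fun y => `|g y - k y|)).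
  by apply: integrable_abs => //; exact: integrable_sub.
rewrite -RintegralD//; apply: le_Rintegral => //.
- by apply: integrable_abs => //; exact: integrable_sub.
- exact: integrable_add.
- by move=> y _; exact: ler_distD.
Qed.

Lemma L1_distC f g : L1_dist f g = L1_dist g f.
Proof. by apply: eq_Rintegral => y _; rewrite distrC. Qed.

Lemma L1_norm_dist f g : mu.-integrable setT (EFin \o f) ->
  mu.-integrable setT (EFin \o g) ->
  \int[mu]_y `|f y| <= \int[mu]_y `|g y| + L1_dist f g.
Proof.
move=> intf intg; have i1 : mu.-integrable setT (EFin \o (fun y => `|f y - g y|)).
  by apply: integrable_abs => //; exact: integrable_sub.
have i2 := integrable_abs measurableT intg.
rewrite -RintegralD//; apply: le_Rintegral => //.
- exact: integrable_abs.
- exact: integrable_add.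
- by move=> y _; have := ler_normD (g y) (f y - g y); rewrite addrC subrK.
Qed.

Lemma L1_shift_dist f g a : mu.-integrable setT (EFin \o f) ->
  mu.-integrable setT (EFin \o g) ->
  L1_shift f a <= L1_shift g a + 2 * L1_dist f g.
Proof.
move=> intf intg.
have sub1 : mu.-integrable setT (EFin \o (fun y => f y - g y)) by exact: integrable_sub.
have i1 := integrable_abs measurableT sub1.
have i1' : mu.-integrable setT (EFin \o (fun y => `|f (y + a) - g (y + a)|)).
  exact: (integrable_preserves (rV_shift a) i1).
have i2 : mu.-integrable setT (EFin \o (fun y => `|g (y + a) - g y|)).
  by apply: integrable_abs => //; apply: integrable_sub => //; exact: integrable_shift.
have E : L1_dist f g = \int[mu]_y `|f (y + a) - g (y + a)|.
  by rewrite /L1_dist -(Rintegral_preserves (rV_shift a) (integrable_measurable i1)).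
rewrite mulr_natl mulr2n {1}E /L1_shift /L1_dist addrA -RintegralD//.
rewrite -RintegralD//; last exact: integrable_add.
apply: le_Rintegral => //.
- by apply: integrable_abs => //; apply: integrable_sub => //; exact: integrable_shift.
- by apply: integrable_add => //; exact: integrable_add.
- move=> y _; have := ler_normD ((g (y + a) - g y) + (f (y + a) - g (y + a))) (g y - f y).
  have := ler_normD (g (y + a) - g y) (f (y + a) - g (y + a)).
  rewrite (distrC (g y)) (_ : _ - g y + _ + _ = f (y + a) - f y); last by ring.
  by move=> h1 h2; rewrite (le_trans h2)// lerD2r.
Qed.
End convolution_bounds.

Section ae_dense.
Context {R : realType}.

Lemma ae_dense (T : R) (P : R -> Prop) (t d : R) :
  (\forall s \ae @lebesgue_measure R, s \in `[0, T[ -> P s) ->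
  0 <= t < T -> 0 < d -> exists s, [/\ 0 <= s < T, `|s - t| <= d & P s].
Proof.
move=> [N [mN N0 sub]] /andP[t0 tT] d0.
pose m := Num.min (t + d) T; have tm : t < m by rewrite /m lt_min tT andbT ltrDl.
apply: contrapT => nex.
have : (lebesgue_measure (`]t, m[%classic : set (measurableTypeR R)) <= lebesgue_measure N)%E.
  apply: le_measure; rewrite ?inE//.
  move=> s; rewrite /= in_itv/= => /andP[ts sm]; apply: sub => /= h.
  move: sm; rewrite lt_min => /andP[sd sT].
  have s0 : 0 <= s by rewrite (le_trans t0)// ltW.
  apply: nex; exists s; split; first by rewrite s0.
    by rewrite ler_norml; apply/andP; split; lra.
  by apply: h; rewrite in_itv/= s0.
by rewrite N0 lebesgue_measure_itv/= lte_fin tm -EFinB lee_fin subr_le0 leNgt tm.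
Qed.
End ae_dense.

Section glue.
Context {R : realType}.

Lemma measurable_glue d (X : measurableType d) (k : X -> nat) (f : nat -> X -> R) :
  (forall i, measurable (k @^-1` [set i])) -> (forall i, measurable_fun setT (f i)) ->
  measurable_fun setT (fun x => f (k x) x).
Proof.
move=> mk mf _ Y mY; rewrite setTI.
rewrite (_ : _ @^-1` Y = \bigcup_i ((k @^-1` [set i]) `&` (f i @^-1` Y))).
  apply: bigcup_measurable => i _; apply: measurableI; first exact: mk.
  by rewrite -[X in measurable X]setTI; exact: mf.
by apply/seteqP; split => [x Yx|x [i _ [/= <-]]//]; exists (k x).
Qed.

Lemma measurable_trunc (h : R) i :
  measurable ((fun t : measurableTypeR R => Num.truncn (t / h)) @^-1` [set i]).
Proof.
have mdiv : measurable_fun setT (fun t : measurableTypeR R => t / h : R).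
  exact: (measurable_funM (@measurable_id _ _ _) (@measurable_cst _ _ _ _ _ h^-1)).
have mle (j : nat) : measurable [set t : measurableTypeR R | (Num.truncn (t / h) <= j)%N].
  rewrite (_ : [set _ | _] = setT `&` (fun t : measurableTypeR R => t / h) @^-1` `]-oo, j.+1%:R[).
    exact: mdiv.
  by rewrite setTI; apply/seteqP; split => t; rewrite /= in_itv/= truncn_le_nat.
case: i => [|i].
  rewrite (_ : _ @^-1` _ = [set t | (Num.truncn (t / h) <= 0)%N])//.
  by apply/seteqP; split => t /=; rewrite leqn0 => /eqP.
rewrite (_ : _ @^-1` _ = [set t | (Num.truncn (t / h) <= i.+1)%N] `\`
   [set t | (Num.truncn (t / h) <= i)%N]); first exact: measurableD.
apply/seteqP; split => t /=; first by move=> ->; rewrite leqnn ltnn.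
by move=> [h1 /negP]; rewrite -ltnNge => h2; apply/eqP; rewrite eqn_leq h1.
Qed.
End glue.

Section velocity.
Context {R : realType} {n : nat}.
Local Notation V := 'rV[R]_n.
Local Notation mu := (@lebesgue_rV R n).
Variables (T : R) (T0 : 0 < T) (c0 : R -> V -> R) (Dc0 : V * R -> V) (c1 : V * R -> R).
Variables (M0 L0 M1 L1 : R).
Hypothesis c0_cont : continuous_L1 T c0.
Hypothesis c0_bound : \forall t \ae @lebesgue_measure R, t \in `[0, T[ ->
    (\int[mu]_x `|c0 t x|%:E <= M0%:E)%E.
Hypothesis Dc0_gradient : \forall t \ae @lebesgue_measure R, t \in `[0, T[ ->
    weak_gradient (c0 t) (fun x => Dc0 (x, t)).
Hypothesis Dc0_bound : Linfty_L1_bound T Dc0 L0.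
Hypothesis c1_cont : {within cylinder n T, continuous c1}.
Hypothesis c1_bound : forall x t, t \in `[0, T[ -> `|c1 (x, t)| <= M1.
Hypothesis c1_lip : forall x y t, t \in `[0, T[ ->
    `|c1 (x, t) - c1 (y, t)| <= L1 * enorm (x - y).

Lemma c0_integrable t : 0 <= t < T -> mu.-integrable setT (EFin \o c0 t).
Proof. by move=> tT; have [] := c0_cont (_ : t \in `[0, T[); rewrite ?in_itv. Qed.

Lemma c0_L1_cont t e : 0 <= t < T -> 0 < e -> exists2 d, 0 < d &
  forall s, 0 <= s < T -> `|s - t| <= d -> L1_dist (c0 s) (c0 t) <= e.
Proof.
move=> tT e0; have tT' : t \in `[0, T[ by rewrite in_itv.
have [_ /cvgrPdist_le/(_ _ e0)] := c0_cont tT'; rewrite near_withinE => /nbhs_ballP[d /= d0 dP].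
exists (d / 2); first by rewrite divr_gt0.
move=> s sT sd; rewrite -[leLHS]ger0_norm ?Rintegral_ge0//.
have := dP s; rewrite sub0r normrN; apply; last by rewrite /= in_itv.
by rewrite /ball/= distrC (le_lt_trans sd)// ltr_pdivrMr// ltr_pMr// ltr1n.
Qed.

Lemma Dc0_measurable t i : 0 <= t < T -> measurable_fun setT (fun x : V => Dc0 (x, t) 0 i).
Proof.
move=> tT; have [mD _] := Dc0_bound.
have mcyl : measurable (cylinder n T : set (V * measurableTypeR R)).
  by apply: measurableX => //; exact: measurable_itv.
rewrite (_ : (fun x => _) = (fun v : V => v 0 i) \o (Dc0 \o (fun x : V => (x, t)))) //.
apply: (measurableT_comp (measurable_coord i)).
apply: (measurable_comp (F := cylinder n T) mcyl) mD _.
  by move=> _ [x _ <-]; split => //=; rewrite in_itv.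
by apply/measurable_fun_pairP; split; [exact: measurable_id|exact: measurable_cst].
Qed.

(** The bounds are known for almost all times; such times are dense, and continuity in [L^1] extends
    the bounds to every time. *)
Lemma c0_estimates : exists C0 C1 : R, [/\ 0 <= C0, 0 <= C1,
  forall t, 0 <= t < T -> \int[mu]_x `|c0 t x| <= C0 &
  forall t a, 0 <= t < T -> L1_shift (c0 t) a <= C1 * enorm a].
Proof.
have [_ DL] := Dc0_bound.
have ae : \forall t \ae @lebesgue_measure R, t \in `[0, T[ ->
    \int[mu]_x `|c0 t x| <= M0 /\ forall a, L1_shift (c0 t) a <= 2 * n%:R * L0 * enorm a.
  apply: (@filterS3 _ _ (ae_filter_ringOfSetsType (@lebesgue_measure R)) _ _ _ _ _ c0_bound Dc0_gradient DL).
  move=> t h1 h2 h3 tT; have tT' : 0 <= t < T by move: tT; rewrite in_itv.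
  have it := c0_integrable tT'; split.
    rewrite -lee_fin fineK; first exact: h1.
    by apply: integrable_fin_num => //; exact: integrable_abs.
  move=> a; apply: (L1_shift_le it (h2 tT) _ (h3 tT)) => i; exact: Dc0_measurable.
exists `|M0|, `|2 * n%:R * L0|; split => // [t tT|t a tT].
  apply/ler_addgt0Pr => e e0; have [d d0 hd] := c0_L1_cont tT e0.
  have [s [sT sd [h _]]] := ae_dense ae tT d0.
  have := L1_norm_dist (c0_integrable tT) (c0_integrable sT).
  rewrite L1_distC => /le_trans; apply; rewrite lerD ?hd//.
  by rewrite (le_trans h)// ler_norm.
apply/ler_addgt0Pr => e e0; have e2 : 0 < e / 2 by rewrite divr_gt0.
have [d d0 hd] := c0_L1_cont tT e2.
have [s [sT sd [_ h]]] := ae_dense ae tT d0.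
have := L1_shift_dist a (c0_integrable tT) (c0_integrable sT).
rewrite L1_distC => /le_trans; apply; rewrite lerD//.
  by rewrite (le_trans (h a))// ler_wpM2r ?enorm_ge0// ler_norm.
by have := hd s sT sd; lra.
Qed.

Definition velocity (t : R) (chi : V -> R) (x : V) : R :=
  convolution (c0 t) chi x + c1 (x, t).

Lemma velocity_estimates : exists M L : R, [/\ 0 <= M, 0 <= L &
  forall t (chi : V -> R), 0 <= t < T -> measurable_fun setT chi -> (forall y, 0 <= chi y <= 1) ->
    (forall x, `|velocity t chi x| <= M) /\
    (forall x y, `|velocity t chi x - velocity t chi y| <= L * enorm (x - y))].
Proof.
have [C0 [C1 [C00 C10 h0 h1]]] := c0_estimates.
exists (C0 + `|M1|), (C1 + `|L1|); split; rewrite ?addr_ge0// => t chi tT mchi chi01.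
have t' : t \in `[0, T[ by rewrite in_itv.
have it := c0_integrable tT; split => [x|x y].
  rewrite (le_trans (ler_normD _ _))// lerD//.
    by rewrite (le_trans (convolution_bound mchi chi01 x it))// h0.
  by rewrite (le_trans (c1_bound _ t'))// ler_norm.
rewrite /velocity (_ : _ - _ = (convolution (c0 t) chi x - convolution (c0 t) chi y) +
   (c1 (x, t) - c1 (y, t))); last by ring.
rewrite (le_trans (ler_normD _ _))// mulrDl lerD//.
  by rewrite (le_trans (convolution_lip mchi chi01 x y it))// h1.
by rewrite (le_trans (c1_lip _ _ t'))// ler_wpM2r ?enorm_ge0// ler_norm.
Qed.

Lemma velocity_dist (chi : V -> R) s t x : 0 <= s < T -> 0 <= t < T ->
  measurable_fun setT chi -> (forall y, 0 <= chi y <= 1) ->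
  `|velocity s chi x - velocity t chi x| <=
    L1_dist (c0 s) (c0 t) + `|c1 (x, s) - c1 (x, t)|.
Proof.
move=> sT tT mchi chi01.
rewrite /velocity (_ : _ - _ = (convolution (c0 s) chi x - convolution (c0 t) chi x) +
   (c1 (x, s) - c1 (x, t))); last by ring.
rewrite (le_trans (ler_normD _ _))// lerD2r.
by apply: convolution_dist => //; exact: c0_integrable.
Qed.

Definition vel_dist x s t := L1_dist (c0 s) (c0 t) + `|c1 (x, s) - c1 (x, t)|.

Lemma vel_dist_cont x t e : 0 <= t < T -> 0 < e -> exists2 d, 0 < d &
  forall s, 0 <= s < T -> `|s - t| <= d -> vel_dist x s t <= e.
Proof.
move=> tT e0; have e2 : 0 < e / 2 by rewrite divr_gt0.
have [d1 d10 h1] := c0_L1_cont tT e2.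
have cyl : cylinder n T (x, t) by split => //=; rewrite in_itv.
have /(subspace_continuousP _ _).1/(_ _ cyl)/cvgrPdist_le/(_ _ e2) := c1_cont; rewrite near_withinE => /nbhs_ballP[d2 /= d20 dP].
exists (Num.min d1 (d2 / 2)); first by rewrite lt_min d10 divr_gt0.
move=> s sT; rewrite le_min => /andP[sd1 sd2].
have := dP (x, s); rewrite /= distrC => h2.
rewrite /vel_dist [leRHS]splitr lerD ?h1// h2//.
split => /=; first exact: ballxx.
by rewrite /ball/= distrC (le_lt_trans sd2)// ltr_pdivrMr// ltr_pMr// ltr1n.
Qed.

Definition floor_time (h t : R) : R := (Num.truncn (t / h))%:R * h.

Lemma floor_time_itv h t : 0 < h -> 0 <= t -> 0 <= floor_time h t <= t /\ t - floor_time h t <= h.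
Proof.
move=> h0 t0; have /truncn_itv : 0 <= t / h by rewrite divr_ge0// ltW.
rewrite /floor_time ler_pdivlMr// ltr_pdivrMr// => /andP[h1 h2]; split.
  by rewrite h1 mulr_ge0// ltW.
by rewrite lerBlDr; move: h2; rewrite -addn1 natrD mulrDl mul1r addrC => /ltW.
Qed.

(** Continuity in time is uniform on the compact interval from 0 to [T']. *)
Lemma floor_time_unif (F : set_system nat) (FF : Filter F) (h : nat -> R) x T' e :
  (forall m, 0 < h m) -> h @ F --> 0 -> T' < T -> 0 < e ->
  \forall m \near F, forall s, 0 <= s <= T' -> vel_dist x (floor_time (h m) s) s <= e.
Proof.
move=> h0 hF T'T e0.
have vel_tri s t r : 0 <= s < T -> 0 <= t < T -> 0 <= r < T ->
    vel_dist x s r <= vel_dist x s t + vel_dist x r t.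
  move=> sT tT rT; rewrite /vel_dist (L1_distC (c0 r)) (distrC (c1 (x, r))).
  have := L1_dist_triangle (c0_integrable sT) (c0_integrable tT) (c0_integrable rT).
  by have := ler_distD (c1 (x, t)) (c1 (x, s)) (c1 (x, r)); lra.
have cov := (compact_near_coveringP `[0, T']%classic).1 (@segment_compact R 0 T').
have := cov nat F (fun m s => 0 <= s <= T' -> vel_dist x (floor_time (h m) s) s <= e) FF.
move=> /(_ _)/(@filterS _ F FF) - /(_ [set m | forall s, 0 <= s <= T' -> vel_dist x (floor_time (h m) s) s <= e]); apply.
  by move=> m hm s sT'; apply: (hm s) => //; rewrite /= in_itv.
  move=> t; rewrite /= in_itv/= => /andP[t0 tT'].
  have tT : 0 <= t < T by rewrite t0 (le_lt_trans tT').
  have e2 : 0 < e / 2 by rewrite divr_gt0.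
  have [d d0 hd] := vel_dist_cont x tT e2.
  have d2 : 0 < d / 2 by rewrite divr_gt0.
  exists ([set s | `|t - s| < d / 2], [set m | h m <= d / 2]).
    split; first by apply/nbhs_ballP; exists (d / 2).
    have /cvgrPdist_le/(_ _ d2) := hF; apply: filterS => m.
    by rewrite sub0r normrN; apply: le_trans; exact: ler_norm.
  move=> [s m] /= [ts hm] /andP[s0 sT'].
  have sT : 0 <= s < T by rewrite s0 (le_lt_trans sT').
  have [/andP[f0 fs] sf] := floor_time_itv (h0 m) s0.
  have fT : 0 <= floor_time (h m) s < T by rewrite f0 (le_lt_trans fs)//; case/andP: sT.
  rewrite (le_trans (vel_tri _ t _ fT tT sT))// [leRHS]splitr lerD//; apply: hd => //.
    move: ts; rewrite ltr_norml => /andP[? ?]; rewrite ler_norml; apply/andP; split; lra.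
  by rewrite distrC ltW// (lt_trans ts)// ltr_pdivrMr// ltr_pMr// ltr1n.
Qed.

End velocity.


(** * Passing to the limit in the velocities *)

Section slices.
Context {R : realType} {n : nat}.
Local Notation V := 'rV[R]_n.
Local Notation mu := (@lebesgue_rV R n).
Local Notation lam := (@lebesgue_measure R).
Local Notation nu := (mu \x lam)%E.
Implicit Types (g : V * measurableTypeR R -> R).

Lemma lebesgue_oo_fin (t1 t2 : R) :
  (lam (`]t1, t2[%classic : set (measurableTypeR R)) < +oo)%E.
Proof. by rewrite lebesgue_measure_itv/=; case: ifP => // _; rewrite -EFinB ltry. Qed.

Lemma measurable_slice g s : measurable_fun setT g ->
  measurable_fun setT (fun y : V => g (y, s)).
Proof. by move=> mg; apply: (measurableT_comp mg); exact: measurable_pair2. Qed.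

Lemma integrable_space_time g (A : set (measurableTypeR R)) (C : R) :
  measurable A -> (lam A < +oo)%E -> measurable_fun setT g ->
  (forall z, ~ A z.2 -> g z = 0) ->
  (forall s, A s -> mu.-integrable setT (EFin \o (fun y => g (y, s))) /\
    \int[mu]_y `|g (y, s)| <= C) ->
  nu.-integrable setT (EFin \o g).
Proof.
move=> mA Afin mg g0 gA; have mEg : measurable_fun setT (EFin \o g) by exact/measurable_EFinP.
apply/(integrable21ltyP _ _ mEg).
have iA := @integrable_scale _ _ _ lam setT `|C| _ measurableT (integrable_indic mA Afin).
apply: (@le_lt_trans _ _ (\int[lam]_s (`|C| * \1_A s)%:E)%E).
  apply: ge0_le_integral => //.
  - by move=> s _; exact: integral_ge0.
  - apply: (@measurable_fun_fubini_tonelli_G _ _ _ _ _ mu (abse \o (EFin \o g))) => //.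
      exact: measurableT_comp.
    by move=> z; exact: abse_ge0.
  - by case/integrableP: iA.
  - move=> s _; rewrite indicE; case: (pselect (A s)) => [As|nAs].
      rewrite mem_set// mulr1; have [ig gC] := gA s As.
      rewrite (eq_integral (fun y => (`|g (y, s)|)%:E))//.
      rewrite -[leLHS]fineK ?lee_fin ?(le_trans gC) ?ler_norm//.
      by apply: integrable_fin_num => //; exact: integrable_abs.
    rewrite memNset// mulr0 integral0_eq// => y _.
    by rewrite /= g0// normr0.
have /integrableP[_] := iA.
apply: le_lt_trans; rewrite le_eqVlt; apply/orP; left; apply/eqP.
by apply: eq_integral => s _; rewrite gee0_abs// lee_fin mulr_ge0.
Qed.

Lemma Rintegral_slices g : nu.-integrable setT (EFin \o g) ->
  (forall s, mu.-integrable setT (EFin \o (fun y => g (y, s)))) ->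
  lam.-integrable setT (EFin \o (fun s => \int[mu]_y g (y, s))) /\
  \int[nu]_z g z = \int[lam]_s \int[mu]_y g (y, s).
Proof.
move=> ig igs.
have E : EFin \o (fun s => \int[mu]_y g (y, s)) = fubini_G mu (EFin \o g).
  apply/funext => s; rewrite /fubini_G /= fineK//.
  exact: (integrable_fin_num measurableT (igs s)).
split.
  have mg := measurable_int _ ig.
  rewrite E; apply/integrableP; split; first exact: (measurable_fubini_G ig).
  apply: le_lt_trans ((integrable21ltyP _ _ mg).1 ig).
  have mabs : measurable_fun setT (abse \o (EFin \o g)) by exact: measurableT_comp.
  apply: ge0_le_integral => //.
  - by apply: measurableT_comp => //; exact: (measurable_fubini_G ig).
  - apply: (@measurable_fun_fubini_tonelli_G _ _ _ _ _ mu (abse \o (EFin \o g))) => //.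
    by move=> z; exact: abse_ge0.
  - by move=> s _; apply: le_abse_integral => //; exact: measurable_int (igs s).
rewrite /Rintegral -integral21_prod_meas1//; congr fine.
by apply: eq_integral => s _; have := congr1 (@^~ s) E.
Qed.
End slices.

Section limit_velocity.
Context {R : realType} {n : nat}.
Local Notation V := 'rV[R]_n.
Local Notation mu := (@lebesgue_rV R n).
Local Notation lam := (@lebesgue_measure R).
Local Notation nu := (mu \x lam)%E.
Variables (T : R) (T0 : 0 < T) (c0 : R -> V -> R) (c1 : V * R -> R) (M1 C0 : R).
Hypothesis c0_cont : continuous_L1 T c0.
Hypothesis c0_C0 : forall t, 0 <= t < T -> \int[mu]_x `|c0 t x| <= C0.
Hypothesis c1_cont : {within cylinder n T, continuous c1}.
Hypothesis c1_bound : forall x t, t \in `[0, T[ -> `|c1 (x, t)| <= M1.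
Implicit Types (chi : V * measurableTypeR R -> R).

Let c0_int t : 0 <= t < T -> mu.-integrable setT (EFin \o c0 t).
Proof. exact: c0_integrable. Qed.

Let vel h chi x s := velocity c0 c1 (floor_time h s) (fun y : V => chi (y, s)) x.

Section floor_kernel.
Variables (h t : R) (x : V).
Hypotheses (h0 : 0 < h) (tT : t <= T).

Let kernel_step (k : nat) (z : V * measurableTypeR R) : R :=
  if k%:R * h < T then c0 (k%:R * h) (x - z.1) else 0.

Let kernel (z : V * measurableTypeR R) : R :=
  \1_(`]0, t[%classic : set (measurableTypeR R)) z.2 * kernel_step (Num.truncn (z.2 / h)) z.

Let floorT s : 0 < s < t -> 0 <= floor_time h s < T.
Proof.
move=> /andP[s0 st]; have [/andP[f0 fs] _] := floor_time_itv h0 (ltW s0).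
by rewrite f0 (le_lt_trans fs)// (lt_le_trans st).
Qed.

Let kernelE y s : 0 < s < t -> kernel (y, s) = c0 (floor_time h s) (x - y).
Proof.
move=> sT; rewrite /kernel indicE mem_set ?mul1r /=; last by rewrite in_itv.
by rewrite /kernel_step -/(floor_time h s); have /andP[_ ->] := floorT sT.
Qed.

Let kernel0 y s : ~ (0 < s < t) -> kernel (y, s) = 0.
Proof. by move=> h'; rewrite /kernel indicE memNset ?mul0r//= in_itv/=. Qed.

Let kernel_measurable : measurable_fun setT kernel.
Proof.
apply: measurable_funM.
  by apply: (measurableT_comp (measurable_indic _)) => //; exact: measurable_itv.
apply: (measurable_glue (k := fun z : V * measurableTypeR R => Num.truncn (z.2 / h))
  (f := kernel_step)) => i.
  rewrite (_ : _ @^-1` _ = setT `&` snd @^-1` ((fun t : measurableTypeR R => Num.truncn (t / h)) @^-1` [set i])).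
    by apply: measurable_snd => //; exact: measurable_trunc.
  by rewrite setTI.
rewrite /kernel_step; case: (ltP (i%:R * h) T) => [iT|_]; last exact: measurable_cst.
have /c0_int/(integrable_reflect x)/integrable_measurable m : 0 <= i%:R * h < T.
  by rewrite iT mulr_ge0// ltW.
exact: (measurableT_comp m measurable_fst).
Qed.

Let kernel_slice s : mu.-integrable setT (EFin \o (fun y => kernel (y, s))) /\
  \int[mu]_y `|kernel (y, s)| <= `|C0|.
Proof.
have [sT|sT] := pselect (0 < s < t).
  under [X in _.-integrable _ (_ \o X)]eq_fun do rewrite kernelE//.
  under eq_Rintegral do rewrite kernelE//.
  have i0 := c0_int (floorT sT); split; first exact: integrable_reflect.
  rewrite (Rintegral_reflect (f := fun y => `|c0 (floor_time h s) y|)).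
    by rewrite (le_trans (c0_C0 (floorT sT)))// ler_norm.
  by apply: measurableT_comp => //; exact: integrable_measurable i0.
have E y : kernel (y, s) = 0 by exact: kernel0.
split; first by rewrite (_ : _ \o _ = cst 0%E) //; [exact: integrable0|apply/funext => y; rewrite /= E].
by under eq_Rintegral do rewrite E normr0; rewrite Rintegral_cst// mul0r.
Qed.

Let kernel_int : nu.-integrable setT (EFin \o kernel).
Proof.
apply: (integrable_space_time (A := `]0, t[%classic) (C := `|C0|)) => //.
- exact: lebesgue_oo_fin.
- by move=> [y s] /= h'; apply: kernel0; move: h'; rewrite /= in_itv.
Qed.

(** For kernels evaluated at grid times, the time integral of the convolution is the pairing of
    [chi] with an integrable kernel on space-time, as weak-star convergence requires. *)
Lemma floor_convolution : exists2 ker : V * measurableTypeR R -> R,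
  nu.-integrable setT (EFin \o ker) &
  forall chi, measurable_fun setT chi -> (forall z, 0 <= chi z <= 1) ->
    lam.-integrable `]0, t[ (EFin \o (fun s => convolution (c0 (floor_time h s)) (fun y => chi (y, s)) x)) /\
    \int[lam]_(s in `]0, t[) convolution (c0 (floor_time h s)) (fun y => chi (y, s)) x =
    \int[nu]_z (chi z * ker z).
Proof.
exists kernel => // chi mchi chi01.
have chi1 z : `|chi z| <= 1 by have /andP[? ?] := chi01 z; rewrite ger0_norm.
have i1 : nu.-integrable setT (EFin \o (fun z => chi z * kernel z)).
  exact: integrable_mul_le1.
have i2 s : mu.-integrable setT (EFin \o (fun y => chi (y, s) * kernel (y, s))).
  by apply: integrable_mul_le1 => //; [have [] := kernel_slice s|exact: measurable_slice].
have [i3 E] := Rintegral_slices i1 i2.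
have E2 s : s \in `]0, t[%classic ->
   \int[mu]_y (chi (y, s) * kernel (y, s)) =
   convolution (c0 (floor_time h s)) (fun y => chi (y, s)) x.
  rewrite inE/= in_itv/= => st; rewrite /convolution; apply: eq_Rintegral => y _.
  by rewrite kernelE// mulrC.
split.
  have i4 : lam.-integrable `]0, t[ (EFin \o (fun s => \int[mu]_y (chi (y, s) * kernel (y, s)))).
    exact: (integrableS _ _ _ i3).
  by apply: eq_integrable i4 => // s st; rewrite /= E2.
transitivity (\int[lam]_(s in `]0, t[) \int[mu]_y (chi (y, s) * kernel (y, s))).
  by apply: eq_Rintegral => s st; rewrite E2.
rewrite E.
rewrite Rintegral_setIind; last exact: measurable_itv.
apply: eq_Rintegral => s _; rewrite indicE.
have [st|st] := pselect (0 < s < t); first by rewrite mem_set ?mul1r//= in_itv.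
rewrite memNset/= ?in_itv// mul0r.
under eq_Rintegral do rewrite kernel0// mulr0.
by rewrite Rintegral_cst// mul0r.
Qed.

Lemma floor_c1 : lam.-integrable `]0, t[ (EFin \o (fun s => c1 (x, floor_time h s))).
Proof.
apply: measurable_bounded_integrable => //.
- exact: lebesgue_oo_fin.
- apply: measurable_funTS.
  apply: (measurable_glue (k := fun s : measurableTypeR R => Num.truncn (s / h))
   (f := fun k _ => c1 (x, k%:R * h))) => i; [exact: measurable_trunc|exact: measurable_cst].
- exists `|M1|; split; first exact: num_real.
  move=> M cM s; rewrite /= in_itv/= => st.
  rewrite (le_trans (c1_bound _ _)) ?in_itv/= ?floorT//.
  by rewrite (le_trans (ler_norm _))// ltW.
Qed.

Lemma floor_velocity_integrable chi : measurable_fun setT chi -> (forall z, 0 <= chi z <= 1) ->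
  lam.-integrable `]0, t[ (EFin \o vel h chi x).
Proof.
move=> mchi chi01; apply: integrable_add => //; last exact: floor_c1.
by have [ker _ /(_ chi mchi chi01)[]] := floor_convolution.
Qed.

Lemma floor_velocity_cvg (U : set_system nat) (UU : ProperFilter U)
  (Chi : nat -> V * measurableTypeR R -> R) chi :
  (forall m, measurable_fun setT (Chi m)) -> (forall m z, 0 <= Chi m z <= 1) ->
  measurable_fun setT chi -> (forall z, 0 <= chi z <= 1) ->
  (forall phi, nu.-integrable setT (EFin \o phi) ->
    \int[nu]_z (Chi m z * phi z) @[m --> U] --> \int[nu]_z (chi z * phi z)) ->
  \int[lam]_(s in `]0, t[) vel h (Chi m) x s @[m --> U] -->
  \int[lam]_(s in `]0, t[) vel h chi x s.
Proof.
move=> mC C01 mchi chi01 w; have [ker ik kE] := floor_convolution.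
have E (f : V * measurableTypeR R -> R) : measurable_fun setT f -> (forall z, 0 <= f z <= 1) ->
    \int[lam]_(s in `]0, t[) vel h f x s =
    \int[nu]_z (f z * ker z) + \int[lam]_(s in `]0, t[) c1 (x, floor_time h s).
  move=> mf f01; have [i1 e1] := kE f mf f01.
  by rewrite -e1 -RintegralD//; exact: floor_c1.
rewrite E//; rewrite (_ : (fun m => _) = fun m => \int[nu]_z (Chi m z * ker z) +
  \int[lam]_(s in `]0, t[) c1 (x, floor_time h s)); last by apply/funext => m; exact: E.
by apply: cvgD; [exact: w|exact: cvg_cst].
Qed.
End floor_kernel.

Section limit_chi.
Variables (chi : V * measurableTypeR R -> R) (mchi : measurable_fun setT chi).
Hypothesis chi01 : forall z, 0 <= chi z <= 1.
Let cbar x s := velocity c0 c1 s (fun y : V => chi (y, s)) x.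

Let vdist h x s : 0 < h -> 0 <= s < T ->
  `|vel h chi x s - cbar x s| <= vel_dist c0 c1 x (floor_time h s) s.
Proof.
move=> h0 /andP[s0 sT]; have [/andP[f0 fs] _] := floor_time_itv h0 s0.
rewrite /vel_dist; apply: (velocity_dist c1 c0_cont x _ _ _ (fun y => chi01 (y, s))).
- by rewrite f0 (le_lt_trans fs).
- by rewrite s0.
- exact: measurable_slice.
Qed.

(** Measurability holds at grid times by Fubini, and passes to the limit of vanishing steps. *)
Lemma velocity_measurable x : measurable_fun `]0, T[ (cbar x).
Proof.
pose h (j : nat) : R := j.+1%:R^-1.
have h0 j : 0 < h j by rewrite invr_gt0.
have hm j : measurable_fun `]0, T[ (vel (h j) chi x).
  by apply: integrable_measurable (floor_velocity_integrable x (h0 j) (lexx T) mchi chi01).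
apply: (measurable_fun_cvg hm) => s; rewrite /= in_itv/= => /andP[s0 sT].
apply/cvgrPdist_le => e e0.
have sT' : 0 <= s < T by rewrite ltW.
have [d d0 hd] := vel_dist_cont c0_cont c1_cont x sT' e0.
near=> j; have hj : h j <= d.
  near: j; have := @cvg_harmonic R => /cvgrPdist_le/(_ _ d0).
  by apply: filterS => j; rewrite sub0r normrN; apply: le_trans; exact: ler_norm.
rewrite distrC (le_trans (vdist x (h0 j) sT'))//.
have [/andP[f0 fs] sf] := floor_time_itv (h0 j) (ltW s0).
apply: hd; first by rewrite f0 (le_lt_trans fs).
by rewrite distrC ger0_norm ?subr_ge0// (le_trans sf).
Unshelve. all: by end_near.
Qed.

Variables (U : set_system nat) (UU : ProperFilter U) (h : nat -> R).
Hypotheses (h0 : forall m, 0 < h m) (hU : h @ U --> 0).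
Variable Chi : nat -> V * measurableTypeR R -> R.
Hypotheses (mC : forall m, measurable_fun setT (Chi m)) (C01 : forall m z, 0 <= Chi m z <= 1).
Hypothesis Chi_cvg : forall phi, nu.-integrable setT (EFin \o phi) ->
    \int[nu]_z (Chi m z * phi z) @[m --> U] --> \int[nu]_z (chi z * phi z).
Variable M : R.
Hypothesis M0 : 0 <= M.
Hypothesis velM : forall t (f : V -> R), 0 <= t < T -> measurable_fun setT f ->
  (forall y, 0 <= f y <= 1) -> forall x, `|velocity c0 c1 t f x| <= M.

Let cbarM x s : 0 <= s < T -> `|cbar x s| <= M.
Proof. by move=> sT; apply: velM => //; exact: measurable_slice. Qed.

Let velhM k (f : V * measurableTypeR R -> R) x s : 0 < k -> measurable_fun setT f -> (forall z, 0 <= f z <= 1) ->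
  0 <= s < T -> `|vel k f x s| <= M.
Proof.
move=> k0 mf f01 /andP[s0 sT]; have [/andP[f0 fs] _] := floor_time_itv k0 s0.
by apply: velM => //; [rewrite f0 (le_lt_trans fs)|exact: measurable_slice].
Qed.

Lemma velocity_integrable x t : t <= T -> lam.-integrable `]0, t[ (EFin \o cbar x).
Proof.
move=> tT.
suff iT : lam.-integrable `]0, T[ (EFin \o cbar x).
  apply: (integrableS _ _ _ iT) => // s.
  by rewrite /= !in_itv/= => /andP[-> /lt_le_trans]; apply.
apply: measurable_bounded_integrable => //.
- exact: lebesgue_oo_fin.
- exact: velocity_measurable.
- exists M; split; first exact: num_real.
  move=> K MK s; rewrite /= in_itv/= => /andP[s0 sT].
  by rewrite (le_trans (cbarM _ _)) ?(ltW s0)// ltW.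
Qed.

Let int_le (f : R -> R) t e : 0 <= t -> lam.-integrable `]0, t[ (EFin \o f) ->
  (forall s, 0 < s < t -> `|f s| <= e) -> `|\int[lam]_(s in `]0, t[) f s| <= e * t.
Proof.
move=> t0 intf fe; have -> : e * t = \int[lam]_(s in `]0, t[) e.
  rewrite Rintegral_cst//= lebesgue_measure_itv/= lte_fin.
  by move: t0; rewrite le_eqVlt => /predU1P[<-|->]; rewrite ?ltxx/= ?subr0.
apply: Rintegral_abs_le => //.
- apply: measurable_bounded_integrable => //; first exact: lebesgue_oo_fin.
  by exists `|e|; split; [exact: num_real|move=> K eK s _ /=; exact: ltW].
- exact: integrable_measurable intf.
Qed.

Let mvel m x s := vel (h m) (Chi m) x s.

Let triangle (i1 i2 i3 i4 e : R) : `|i1 - i2| <= e / 4 -> `|i2 - i3| <= e / 4 ->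
  `|i3 - i4| <= 2 * (e / 4) -> `|i1 - i4| <= e.
Proof. by have := ler_distD i2 i1 i4; have := ler_distD i3 i2 i4; lra. Qed.

(** Replacing the moving grid of step [h m] by a fixed fine grid costs an error that is small
    uniformly in [m] and in [chi]; on the fixed grid weak-star convergence applies. *)
Lemma integral_velocity_cvg x t : 0 < t < T ->
  \int[lam]_(s in `]0, t[) mvel m x s @[m --> U] --> \int[lam]_(s in `]0, t[) cbar x s.
Proof.
move=> /andP[t0 tT]; have tT' := ltW tT.
have it k (f : V * measurableTypeR R -> R) : 0 < k -> measurable_fun setT f -> (forall z, 0 <= f z <= 1) ->
    lam.-integrable `]0, t[ (EFin \o vel k f x).
  by move=> k0; exact: floor_velocity_integrable.
have ib := velocity_integrable x tT'.
apply/cvgrPdist_le => e e0.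
pose e' := e / (4 * t); have e'0 : 0 < e' by rewrite divr_gt0// mulr_gt0.
have e'E : e' * t = e / 4 by rewrite /e'; field; rewrite gt_eqF.
have FU : Filter U by exact: _.
have small := floor_time_unif c0_cont c1_cont FU x h0 hU tT e'0.
have [j hj] := @filter_ex _ U _ _ small.
have /cvgrPdist_le/(_ _ (divr_gt0 e0 (ltr0n R 4))) := @floor_velocity_cvg (h j) t x (h0 j) tT' U UU Chi chi mC C01 mchi chi01 Chi_cvg.
move=> wk; near=> m.
have h1 : `|\int[lam]_(s in `]0, t[) vel (h j) chi x s - \int[lam]_(s in `]0, t[) vel (h j) (Chi m) x s| <= e / 4.
  by near: m.
have hm : forall s, 0 <= s <= t -> vel_dist c0 c1 x (floor_time (h m) s) s <= e'.
  by near: m.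
have h2 : `|\int[lam]_(s in `]0, t[) cbar x s - \int[lam]_(s in `]0, t[) vel (h j) chi x s| <= e / 4.
  rewrite -RintegralB//; last exact: it.
  rewrite -e'E; apply: int_le (ltW t0) _ _; first by apply: integrable_sub => //; exact: it.
  move=> s /andP[s0 st]; rewrite distrC.
  by rewrite (le_trans (vdist x (h0 j) _)) ?(ltW s0) ?(lt_trans st)// hj// !ltW.
have h3 : `|\int[lam]_(s in `]0, t[) vel (h j) (Chi m) x s - \int[lam]_(s in `]0, t[) mvel m x s| <= 2 * (e / 4).
  have i1 := it (h j) _ (h0 j) (mC m) (C01 m).
  have i2 := it (h m) _ (h0 m) (mC m) (C01 m).
  rewrite -RintegralB// -e'E mulrA; apply: int_le (ltW t0) _ _; first exact: integrable_sub.
  move=> s /andP[s0 st]; have sT : 0 <= s < T by rewrite ltW//= (lt_trans st).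
  have st' : 0 <= s <= t by rewrite !ltW.
  have [/andP[f0 fs] _] := floor_time_itv (h0 j) (ltW s0).
  have [/andP[f0' fs'] _] := floor_time_itv (h0 m) (ltW s0).
  have mC' := measurable_slice s (mC m).
  have C01' y : 0 <= Chi m (y, s) <= 1 by exact: C01.
  have d1 := velocity_dist c1 c0_cont x (_ : 0 <= floor_time (h j) s < T) sT mC' C01'.
  have d2 := velocity_dist c1 c0_cont x (_ : 0 <= floor_time (h m) s < T) sT mC' C01'.
  rewrite (le_trans (ler_distD (velocity c0 c1 s (fun y => Chi m (y, s)) x) _ _))//.
  rewrite mulr2n mulrDl mul1r lerD//.
    by rewrite (le_trans (d1 _)) ?f0 ?(le_lt_trans fs) ?(andP sT).2//; exact: hj.
  by rewrite distrC (le_trans (d2 _)) ?f0' ?(le_lt_trans fs') ?(andP sT).2//; exact: hm.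
exact: triangle h2 h1 h3.
Unshelve. all: by end_near.
Qed.

(** The velocities are bounded by [M], so these integrals are equi-Lipschitz in [t] and their
    pointwise convergence is uniform on compact intervals. *)
Lemma integral_velocity_unif x t0 : 0 < t0 < T -> exists2 r, 0 < r & forall e, 0 < e ->
  \forall m \near U, forall t, `|t - t0| <= r ->
    `|\int[lam]_(s in `]0, t[) (mvel m x s - cbar x s)| <= e.
Proof.
move=> /andP[t00 t0T].
pose r := Num.min (t0 / 2) ((T - t0) / 2).
have r0 : 0 < r by rewrite lt_min !divr_gt0// subr_gt0.
have [r1 r2] : r <= t0 / 2 /\ r <= (T - t0) / 2 by rewrite /r !ge_min !lexx ?orbT.
clearbody r; exists r => // e e0.
pose D m t := \int[lam]_(s in `]0, t[) (mvel m x s - cbar x s).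
have iD m t : t <= T -> lam.-integrable `]0, t[ (EFin \o (fun s => mvel m x s - cbar x s)).
  move=> tT; apply: integrable_sub => //; last exact: velocity_integrable.
  exact: floor_velocity_integrable.
have dT s : 0 < s < T -> 0 <= s < T by move=> /andP[/ltW -> ->].
have D_lip m t t' : 0 < t -> t <= t' -> t' <= T -> `|D m t' - D m t| <= 2 * M * (t' - t).
  move=> tt tt' t'T; rewrite /D (Rintegral_oo_split (iD m T (lexx T)) tt tt' t'T).
  rewrite addrC addKr -(Rintegral_co_cst (2 * M) tt'); apply: Rintegral_abs_le => //.
  - exact: integrable_co_cst.
  - exact: integrable_measurable (integrable_co (iD m T (lexx T)) tt t'T).
  - move=> s; rewrite /= in_itv/= => /andP[ts st'].
    have sT : 0 <= s < T by rewrite (le_trans (ltW tt) ts) (lt_le_trans st').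
    by rewrite (le_trans (ler_normB _ _))// mulr2n mulrDl mul1r lerD ?cbarM ?velhM.
have D_lip' m t t' : 0 < t <= T -> 0 < t' <= T -> `|D m t' - D m t| <= 2 * M * `|t' - t|.
  move=> /andP[tt tT] /andP[tt' t'T]; have [h1|/ltW h1] := leP t t'.
    by rewrite (ger0_norm (_ : 0 <= t' - t)) ?subr_ge0//; exact: D_lip.
  by rewrite distrC (distrC t') (ger0_norm (_ : 0 <= t - t')) ?subr_ge0//; exact: D_lip.
have cov := (compact_near_coveringP `[t0 - r, t0 + r]%classic).1 (@segment_compact R _ _).
have FU : Filter U by exact: _.
have := cov nat U (fun m t => t \in `[t0 - r, t0 + r] -> `|D m t| <= e) FU.
move=> /(_ _)/(@filterS _ U FU) - /(_ [set m | forall t, `|t - t0| <= r -> `|D m t| <= e]); apply.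
  move=> m hm t tr; have tin : t \in `[t0 - r, t0 + r].
    by move: tr; rewrite ler_norml in_itv/= => /andP[? ?]; apply/andP; split; lra.
  exact: (hm t).
move=> t; rewrite /= in_itv/= => /andP[t1 t2].
have tT : 0 < t < T by apply/andP; split; lra.
pose d := e / (4 * M + 1); have M4 : 0 < 4 * M + 1 by rewrite ltr_wpDl// mulr_ge0.
have d0 : 0 < d by rewrite divr_gt0.
have dM : 2 * M * d <= e / 2.
  rewrite /d mulrA ler_pdivrMr// mulrDr mulr1 (_ : e / 2 * (4 * M) = 2 * M * e); last by field.
  by rewrite lerDl divr_ge0// ltW.
have e2 : 0 < e / 2 by rewrite divr_gt0.
exists ([set s | `|t - s| < d], [set m | `|D m t| <= e / 2]).
  split; first by apply/nbhs_ballP; exists d.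
  have /cvgrPdist_le/(_ _ e2) := @integral_velocity_cvg x t tT; apply: filterS => m.
  rewrite distrC -RintegralB//; last by apply: velocity_integrable; exact: ltW (andP tT).2.
  by apply: floor_velocity_integrable => //; exact: ltW (andP tT).2.
move=> [s m] /= [ts hm]; rewrite in_itv/= => /andP[s1 s2].
have hD : `|D m s - D m t| <= 2 * M * `|s - t|.
  by apply: D_lip'; apply/andP; split; lra.
have hd : 2 * M * `|s - t| <= 2 * M * d.
  by rewrite ler_wpM2l ?mulr_ge0// distrC ltW.
have := ler_normD (D m s - D m t) (D m t); rewrite subrK.
move: hD hd hm dM; lra.
Qed.

End limit_chi.

End limit_velocity.


(** * The limit front *)

Section weak_level.
Context {R : realType} d (X : measurableType d).
Variables (mu : {measure set X -> \bar R}) (U : set_system nat) (UU : ProperFilter U).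
Variables (f : nat -> X -> R) (g : X -> R) (A : set X).
Hypothesis (mg : measurable_fun setT g).
Hypothesis g1 : forall z, `|g z| <= 1.
Hypotheses (mA : measurable A) (Afin : (mu A < +oo)%E).
Hypothesis w : forall phi, mu.-integrable setT (EFin \o phi) ->
  \int[mu]_z (f m z * phi z) @[m --> U] --> \int[mu]_z (g z * phi z).

(** Testing against the indicator of [A] shows that [g - a], which has a constant sign, has zero
    integral over [A]. *)
Lemma weak_star_eq (a s : R) : s != 0 -> (forall z, 0 <= s * (g z - a)) ->
  (\forall m \near U, forall z, A z -> f m z = a) ->
  \forall z \ae mu, A z -> g z = a.
Proof.
move=> s0 ga fa; have iA := integrable_indic mA Afin.
have igA : mu.-integrable setT (EFin \o (fun z => g z * \1_A z)).
  exact: integrable_mul_le1.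
have E : \int[mu]_z (g z * \1_A z) = \int[mu]_z (a * \1_A z).
  have lim2 : \int[mu]_z (f m z * \1_A z) @[m --> U] --> \int[mu]_z (a * \1_A z).
    apply/cvgrPdist_le => e e0; apply: filterS fa => m fa.
    rewrite (_ : \int[mu]_z (f m z * \1_A z) = \int[mu]_z (a * \1_A z)).
      by rewrite subrr normr0 ltW.
    apply: eq_Rintegral => z _; rewrite indicE.
    by case: (pselect (A z)) => Az; [rewrite fa|rewrite memNset// !mulr0].
  exact: (cvg_unique _ (w iA) lim2).
pose k z := s * (g z * \1_A z - a * \1_A z).
have ik0 : mu.-integrable setT (EFin \o (fun z => g z * \1_A z - a * \1_A z)).
  by apply: integrable_sub => //; exact: integrable_scale.
have ik : mu.-integrable setT (EFin \o k) by exact: integrable_scale.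
have k0 z : 0 <= k z by rewrite /k -mulrBl mulrA mulr_ge0.
have : ae_eq mu setT (EFin \o k) (cst 0%E).
  apply/ae_eq_integral_abs => //; first exact: measurable_int ik.
  rewrite (eq_integral (EFin \o k)); last by move=> z _; rewrite gee0_abs//= lee_fin.
  have fk : (\int[mu]_z (EFin \o k) z)%E \is a fin_num by exact: integrable_fin_num.
  apply/eqP; rewrite -(fineK fk) eqe; apply/eqP.
  have -> : fine (\int[mu]_z (EFin \o k) z)%E = \int[mu]_z k z by [].
  rewrite /k RintegralZl// RintegralB//; last exact: integrable_scale.
  by rewrite E subrr mulr0.
apply: (@filterS _ _ (ae_filter_ringOfSetsType mu)) => z /(_ Logic.I) /= [kz] Az.
move/eqP: kz; rewrite /k indicE mem_set// !mulr1 mulf_eq0 (negbTE s0)/=.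
by rewrite subr_eq0 => /eqP.
Qed.
End weak_level.

Lemma enorm_lipschitz_continuous (R : realType) n (f : 'rV[R]_n -> R) (C : R) :
  (forall x y : 'rV[R]_n, `|f x - f y| <= C * enorm (x - y)) -> continuous f.
Proof.
move=> fC x; apply/(@cvgrPdist_le R R 'rV[R]_n (nbhs x) _) => e e0.
have C1 : 0 < `|C| * n%:R + 1 by rewrite ltr_wpDl// mulr_ge0.
pose d := e / (`|C| * n%:R + 1); have d0 : 0 < d by rewrite divr_gt0.
apply/nbhs_ballP; exists d => //= y; rewrite -ball_normE /= => xy.
have xy' : enorm (x - y) <= n%:R * d by rewrite (le_trans (enorm_le_norm _))// ler_wpM2l// ltW.
rewrite (le_trans (fC _ _))// (le_trans (ler_wpM2r (enorm_ge0 _) (ler_norm C)))//.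
rewrite (le_trans (ler_wpM2l (normr_ge0 C) xy'))//.
have -> : e = (`|C| * n%:R + 1) * d by rewrite /d mulrC divfK// gt_eqF.
by rewrite mulrDl mul1r mulrA lerDl ltW.
Qed.

Definition time_step (R : realType) (m : nat) : R := m.+1%:R^-1.

Lemma time_step_gt0 (R : realType) m : 0 < time_step R m.
Proof. by rewrite invr_gt0. Qed.

Section limit.
Context {R : realType} {n : nat}.
Local Notation V := 'rV[R]_n.
Local Notation mu := (@lebesgue_rV R n).
Local Notation lam := (@lebesgue_measure R).
Local Notation nu := (mu \x lam)%E.
Variables (T M L K0 R0 : R) (u0 : V -> R) (U c : nat -> nat -> V -> R).
Variables (UF : set_system nat) (UU : UltraFilter UF) (Uoo : \oo `<=` UF).
Local Notation h := (time_step R).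
Hypotheses (T0 : 0 < T) (M0 : 0 <= M) (L0 : 0 <= L) (K00 : 0 <= K0).
Hypothesis UO : forall m, U m 0%N = u0.
Hypothesis US : forall m k, U m k.+1 = front_step (h m) (c m k) (U m k).
Hypothesis cM : forall m k x, `|c m k x| <= M.
Hypothesis cL : forall m k x y, `|c m k x - c m k y| <= L * enorm (x - y).
Hypothesis u01 : forall x, -1 <= u0 x <= 1.
Hypothesis u0K : forall x y, `|u0 x - u0 y| <= K0 * enorm (x - y).
Hypothesis u0far : forall x, R0 <= enorm x -> u0 x = -1.

Let K := K0 * expR (L * T).
Let K_ge0 : 0 <= K. Proof. by rewrite mulr_ge0// expR_ge0. Qed.
Let h0 m : 0 < h m. Proof. exact: time_step_gt0. Qed.
Let h0' m : 0 <= h m. Proof. exact: ltW. Qed.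

Lemma time_step_cvg : h @ UF --> 0.
Proof. by move=> A /(@cvg_harmonic R) hA; exact: Uoo. Qed.

(** Projecting times to the segment from 0 to [T] makes the front globally defined and Lipschitz,
    in particular at negative times and at [T]. *)
Definition clamp (t : R) := Num.max 0 (Num.min t T).

Lemma clamp_itv t : 0 <= clamp t <= T.
Proof. by rewrite /clamp le_max lexx/= ge_max (ltW T0)/= ge_min lexx orbT. Qed.

Lemma clamp_id t : 0 <= t <= T -> clamp t = t.
Proof. by move=> /andP[t0 tT]; rewrite /clamp min_l// max_r. Qed.

Lemma clamp_dist t s : `|clamp t - clamp s| <= `|t - s|.
Proof.
wlog st : t s / s <= t.
  move=> H; have [/H//|/ltW/H] := leP s t.
  by rewrite distrC (distrC s).
suff /andP[h1 h2] : 0 <= clamp t - clamp s <= t - s by rewrite (ger0_norm h1) ger0_norm ?subr_ge0.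
rewrite /clamp /Num.max /Num.min.
by case: (ltP t T) => ?; case: (ltP s T) => ?; do ?case: ltP => ?; lra.
Qed.

Definition grid_front m x t := U m (time_index h m (clamp t)) x.
Local Notation Um := grid_front.

Lemma grid_front_index m x k : k%:R * h m <= T -> Um m x (k%:R * h m) = U m k x.
Proof.
move=> kT; rewrite /grid_front clamp_id; last by rewrite kT mulr_ge0.
by rewrite (time_index_step h0 (k := k))// lexx/= ltr_pM2r// ltr_nat.
Qed.

Let index_le m t : (time_index h m (clamp t))%:R * h m <= clamp t.
Proof.
have [/andP[_ hle] _] := floor_time_itv (h0 m) (andP (clamp_itv t)).1; exact: hle.
Qed.

Let index_ge m t : clamp t - h m <= (time_index h m (clamp t))%:R * h m.
Proof.
have [_] := floor_time_itv (h0 m) (andP (clamp_itv t)).1.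
by rewrite /floor_time /time_index; lra.
Qed.

Let index_T m t : (time_index h m (clamp t))%:R * h m <= T.
Proof. exact: le_trans (index_le m t) (andP (clamp_itv t)).2. Qed.

Let Um_range m x t : -1 <= Um m x t <= 1.
Proof. exact: (scheme_range (h0' m) (UO m) (US m) u01). Qed.

Let Um1 m x t : `|Um m x t| <= 1.
Proof. by rewrite ler_norml. Qed.

Let Um_lip m x y t : `|Um m x t - Um m y t| <= K * enorm (x - y).
Proof.
rewrite (le_trans (scheme_lip (h0' m) L0 K00 (UO m) (US m) (cL m) u01 u0K _ _ _))//.
rewrite ler_wpM2r ?enorm_ge0// ler_wpM2l// ler_expR ler_wpM2l//; exact: index_T.
Qed.

Let Um_time m x t s : `|Um m x t - Um m x s| <= K * M * (`|t - s| + h m).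
Proof.
wlog ts : t s / (time_index h m (clamp s) <= time_index h m (clamp t))%N.
  move=> H; have [/H//|/ltnW/H] := leqP (time_index h m (clamp s)) (time_index h m (clamp t)).
  by rewrite distrC (distrC s).
rewrite /grid_front -{1}(subnKC ts).
rewrite (le_trans (scheme_time (T := T) (h0' m) L0 K00 (UO m) (US m) (cM m) (cL m) u01 u0K _ _ M0))//.
  by rewrite subnKC//; exact: index_T.
rewrite -/K ler_wpM2l ?mulr_ge0// natrB// mulrBl.
have := index_le m t; have := index_ge m s; have := ler_norm (clamp t - clamp s).
by have := clamp_dist t s; lra.
Qed.

Let Um_far m (x : V) t : R0 + T * M <= enorm x -> Um m x t = -1.
Proof.
move=> hx; apply: (scheme_far (h0' m) (UO m) (US m) (cM m) u01 u0far).
by rewrite (le_trans _ hx)// lerD2l mulrA ler_wpM2r// index_T.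
Qed.

Definition front (z : V * R) : R := lim (Um m z.1 z.2 @[m --> UF]).

Lemma front_cvg x t : Um m x t @[m --> UF] --> front (x, t).
Proof. exact: (@ultra_bounded_cvg R UF UU (fun m => Um m x t) 1 (fun m => Um1 m x t)). Qed.

Let front_lim x t e : 0 < e -> \forall m \near UF, `|front (x, t) - Um m x t| <= e.
Proof. by move=> e0; have /cvgrPdist_le/(_ _ e0) := @front_cvg x t. Qed.

Lemma front_bound z : `|front z| <= 1.
Proof.
case: z => x t; apply/ler_addgt0Pr => e e0; have [m hm] := @filter_ex _ UF _ _ (@front_lim x t e e0).
have := ler_normD (front (x, t) - Um m x t) (Um m x t); rewrite subrK.
by have := Um1 m x t; move: hm; lra.
Qed.

(** The scheme has this modulus of continuity up to an error [h m] in time. *)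
Lemma front_lip x y t s :
  `|front (x, t) - front (y, s)| <= K * enorm (x - y) + K * M * `|t - s|.
Proof.
apply/ler_addgt0Pr => e e0.
have e4 : 0 < e / 4 by rewrite divr_gt0.
have KM0 : 0 <= K * M by rewrite mulr_ge0.
pose d := e / 4 / (K * M + 1); have d0 : 0 < d by rewrite divr_gt0// ltr_wpDl.
have KMd : K * M * d <= e / 4.
  by rewrite /d mulrA ler_pdivrMr ?ltr_wpDl// mulrDr mulr1 mulrC lerDl ltW.
have hd : \forall m \near UF, `|0 - h m| <= d by have /cvgrPdist_le/(_ _ d0) := time_step_cvg.
have [m [hm [h1 h2]]] := @filter_ex _ UF _ _ (@filterI _ UF _ _ _ hd
  (@filterI _ UF _ _ _ (@front_lim x t _ e4) (@front_lim y s _ e4))).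
have h3 := Um_lip m x y t; have h4 := Um_time m y t s.
have h5 : K * M * h m <= e / 4.
  rewrite (le_trans _ KMd)// ler_wpM2l//; move: hm; rewrite sub0r normrN.
  by apply: le_trans; exact: ler_norm.
have -> : front (x, t) - front (y, s) = (front (x, t) - Um m x t) + (Um m x t - Um m y t)
   + (Um m y t - Um m y s) - (front (y, s) - Um m y s) by ring.
rewrite (le_trans (ler_normB _ _))//.
rewrite (le_trans (lerD (le_trans (ler_normD _ _) (lerD (ler_normD _ _) (lexx _))) (lexx _)))//.
by move: h1 h2 h3 h4 h5; rewrite mulrDr; lra.
Qed.

Lemma front_continuous : continuous front.
Proof.
move=> [x t]; apply/cvgrPdist_le => e e0.
have KM0 : 0 <= K * M by rewrite mulr_ge0.
pose C := K * n%:R + K * M + 1.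
have C0 : 0 < C by rewrite /C ltr_wpDl// addr_ge0// mulr_ge0.
pose d := e / C; have d0 : 0 < d by rewrite divr_gt0.
have Cd : C * d = e by rewrite /d mulrC divfK// gt_eqF.
exists (ball x d, ball t d); first by split; exact: nbhsx_ballx.
move=> [y s] [/= xy ts].
rewrite (le_trans (front_lip _ _ _ _))//.
have xy' : enorm (x - y) <= n%:R * d.
  rewrite (le_trans (enorm_le_norm _))// ler_wpM2l// ltW//.
  by move: xy; rewrite -ball_normE.
have ts' : `|t - s| <= d by rewrite ltW.
rewrite -Cd /C (le_trans (lerD (ler_wpM2l K_ge0 xy') (ler_wpM2l KM0 ts')))//.
by rewrite !mulrDl mul1r mulrA lerDl ltW.
Qed.

Lemma front_init x : front (x, 0) = u0 x.
Proof.
apply/eqP; rewrite -subr_eq0 -normr_le0; apply/ler_addgt0Pr => e e0.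
have [m] := @filter_ex _ UF _ _ (@front_lim x 0 e e0).
have -> : Um m x 0 = u0 x by have := @grid_front_index m x 0; rewrite mul0r UO; apply; exact: ltW.
by rewrite add0r.
Qed.

Lemma front_far (x : V) t : R0 + T * M <= enorm x -> front (x, t) = -1.
Proof.
move=> hx; apply/eqP; rewrite -subr_eq0 -normr_le0; apply/ler_addgt0Pr => e e0.
have [m] := @filter_ex _ UF _ _ (@front_lim x t e e0).
by rewrite Um_far// add0r.
Qed.

Let r1 := R0 + T * M.

Let far_cube (x : V) : ~ cube r1 x -> r1 <= enorm x.
Proof.
move=> nx; rewrite leNgt; apply/negP => xr; apply: nx => i.
by rewrite (le_trans (coord_le_enorm x i))// ltW.
Qed.

(** Equicontinuity gives uniform convergence on a compact box, and outside this box both sides are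
    equal to [-1]. *)
Lemma front_unif e : 0 < e -> \forall m \near UF, forall x t, `|Um m x t - front (x, t)| <= e.
Proof.
move=> e0; have FU : Filter UF by exact: _.
have clamp_front x t : front (x, clamp t) = front (x, t).
  rewrite /front /=; congr lim; apply/funext => m.
  by rewrite /grid_front /= (clamp_id (clamp_itv t)).
have clamp_Um m x t : Um m x (clamp t) = Um m x t by rewrite /grid_front (clamp_id (clamp_itv t)).
have cov := (compact_near_coveringP _).1 (compact_setX (@compact_cube R n r1) (@segment_compact R 0 T)).
have := cov nat UF (fun m z => `|Um m z.1 z.2 - front (z.1, z.2)| <= e) FU.
move=> /(_ _)/(@filterS _ UF FU) - /(_ [set m | forall x t, `|Um m x t - front (x, t)| <= e]); apply.
  move=> m hm x t; have [xr|/far_cube xr] := pselect (cube r1 x).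
    rewrite -clamp_front -clamp_Um; apply: (hm (x, clamp t)); split => //=.
    by rewrite in_itv/= clamp_itv.
  by rewrite Um_far// front_far// subrr normr0 ltW.
move=> [x t] _; have e4 : 0 < e / 4 by rewrite divr_gt0.
pose C := K * n%:R + K * M + 1.
have KM0 : 0 <= K * M by rewrite mulr_ge0.
have C0 : 0 < C by rewrite /C ltr_wpDl// addr_ge0// mulr_ge0.
pose d := e / 8 / C; have d0 : 0 < d by rewrite !divr_gt0.
have Cd : C * d = e / 8 by rewrite /d mulrC divfK// gt_eqF.
have CE : K * (n%:R * d) + K * M * (d + d) <= e / 4.
  have -> : e / 4 = 2 * (C * d) by rewrite Cd; field.
  have : 0 <= K * (n%:R * d) by rewrite mulr_ge0// mulr_ge0// ltW.
  have -> : 2 * (C * d) = 2 * (K * (n%:R * d)) + K * M * (d + d) + 2 * d by rewrite /C; ring.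
  move: (K * (n%:R * d)) (K * M * (d + d)) => a1 a2 ha; move: d0; lra.
exists ([set z | ball (x, t) d z], [set m | `|0 - h m| <= d /\ `|front (x, t) - Um m x t| <= e / 4]).
  split; first by exists (ball x d, ball t d) => //; split; exact: nbhsx_ballx.
  have hd : \forall m \near UF, `|0 - h m| <= d by have /cvgrPdist_le/(_ _ d0) := time_step_cvg.
  exact: (@filterI _ UF _ _ _ hd (front_lim x t e4)).
move=> [[y s] m] [/= [/= xy ts] [hm hf]].
have xy' : enorm (x - y) <= n%:R * d.
  rewrite (le_trans (enorm_le_norm _))// ler_wpM2l// ltW//.
  by move: xy; rewrite -ball_normE.
have yx' : enorm (y - x) <= n%:R * d by rewrite -enormN opprB.
have ts' : `|t - s| <= d by rewrite ltW.
have st' : `|s - t| <= d by rewrite distrC.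
have hm' : h m <= d by move: hm; rewrite sub0r normrN; apply: le_trans; exact: ler_norm.
have h1 := front_lip x y t s.
have h2 := Um_lip m y x s; have h3 := Um_time m x s t.
have g1 : K * enorm (y - x) <= K * (n%:R * d) by rewrite ler_wpM2l.
have g1' : K * enorm (x - y) <= K * (n%:R * d) by rewrite ler_wpM2l.
have g2 : K * M * (`|s - t| + h m) <= K * M * (d + d) by rewrite ler_wpM2l// lerD.
have g3 : K * M * `|t - s| <= K * M * (d + d) by rewrite ler_wpM2l// (le_trans ts')// lerDl ltW.
have -> : Um m y s - front (y, s) = (Um m y s - Um m x s) + (Um m x s - Um m x t)
   - (front (x, t) - Um m x t) + (front (x, t) - front (y, s)) by ring.
rewrite (le_trans (ler_normD _ _))//.
rewrite (le_trans (lerD (le_trans (ler_normB _ _) (lerD (ler_normD _ _) (lexx _))) (lexx _)))//.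
by move: h1 h2 h3 g1 g1' g2 g3 CE hf; lra.
Qed.

Definition front_set m : set (V * measurableTypeR R) :=
  [set z | 0 < z.2 < T /\ 0 <= U m (time_index h m z.2) z.1].

Definition space_time : set (V * measurableTypeR R) :=
  cube r1 `*` (`]0, T[%classic : set (measurableTypeR R)).

Lemma space_time_measurable : measurable space_time.
Proof. by apply: measurableX; [exact: measurable_cube|exact: measurable_itv]. Qed.

Lemma space_time_fin : (nu space_time < +oo)%E.
Proof.
rewrite /space_time product_measure1E//; last exact: measurable_cube.
have c1 := @lebesgue_cube R n r1.
have c2 : (lam (`]0%R, T[%classic : set (measurableTypeR R)) < +oo)%E.
  by rewrite lebesgue_measure_itv/= -EFinB; case: ifP => // _; exact: ltry.
by apply: lte_mul_pinfty => //; rewrite ge0_fin_numE.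
Qed.

Lemma scheme_continuous m k : continuous (U m k).
Proof. exact: enorm_lipschitz_continuous (scheme_lip (h0' m) L0 K00 (UO m) (US m) (cL m) u01 u0K k). Qed.

Lemma front_set_measurable m : measurable (front_set m).
Proof.
rewrite (_ : front_set m = \bigcup_k ((snd @^-1` ((fun t => Num.truncn (t / h m)) @^-1` [set k])) `&`
   ((U m k @^-1` `[0, +oo[) `*` (`]0, T[%classic : set (measurableTypeR R))))).
  apply: bigcup_measurable => k _; apply: measurableI.
    rewrite -[X in measurable X]setTI; apply: measurable_snd => //; exact: measurable_trunc.
  apply: measurableX; last exact: measurable_itv.
  rewrite -[X in measurable X]setTI.
  by apply: (rV_continuous_measurable (@scheme_continuous m k)) => //; exact: measurable_itv.
apply/seteqP; split => [[x t] /= [tT ut]|[x t] [k _ [/= <- [+ +]]]].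
  exists (time_index h m t) => //; split => //; split => /=; first by rewrite in_itv/= ut.
  by rewrite in_itv.
by rewrite /= !in_itv/= andbT => ut tT.
Qed.

Lemma front_set_space_time m : front_set m `<=` space_time.
Proof.
move=> [x t] /= [tT ut]; split; last by rewrite /= in_itv.
apply: contrapT => /far_cube xr; have := Um_far m t xr.
rewrite /grid_front clamp_id; last by have /andP[/ltW -> /ltW ->] := tT.
by move=> ut'; move: ut; rewrite ut' ler0N1.
Qed.

Variables (chi : V * measurableTypeR R -> R) (mchi : measurable_fun setT chi).
Hypothesis chi01 : forall z, 0 <= chi z <= \1_space_time z.
Hypothesis chi_cvg : forall phi, nu.-integrable setT (EFin \o phi) ->
    \int[nu]_z (\1_(front_set m) z * phi z) @[m --> UF] --> \int[nu]_z (chi z * phi z).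

Let chi_le1 z : 0 <= chi z <= 1.
Proof. by have /andP[-> /le_trans] := chi01 z; apply; rewrite indicE; case: (_ \in _). Qed.

Let chi1 z : `|chi z| <= 1.
Proof. by have /andP[? ?] := chi_le1 z; rewrite ger0_norm. Qed.

Let mfront : measurable_fun setT (front : V * measurableTypeR R -> R).
Proof. exact: rVR_continuous_measurable front_continuous. Qed.

Let level (B : set R) := space_time `&` (front @^-1` B).

Let level_measurable (B : set (measurableTypeR R)) : measurable B -> measurable (level B).
Proof.
move=> mB; apply: measurableI; first exact: space_time_measurable.
by rewrite -[X in measurable X]setTI; exact: mfront.
Qed.

Let level_fin (B : set (measurableTypeR R)) : measurable B -> (nu (level B) < +oo)%E.
Proof.
move=> mB; apply: le_lt_trans space_time_fin.
by apply: le_measure; rewrite ?inE//; [exact: level_measurable|exact: space_time_measurable|by move=> z []].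
Qed.

Let Um_in m x t : 0 < t < T -> Um m x t = U m (time_index h m t) x.
Proof. by move=> /andP[t0 tT]; rewrite /grid_front clamp_id// !ltW. Qed.

(** Where the limit is at least [h j], uniform convergence makes the scheme eventually positive, so
    that the indicators are eventually 1 and so is their limit; likewise they are eventually 0
    where the limit is at most [- h j]. Countably many [j] exhaust the two open phases, and the zero
    level leaves [chi] free between 0 and 1. *)
Lemma front_chi : \forall z \ae nu, 0 < z.2 < T ->
  \1_[set z' | 0 < front z'] z <= chi z <= \1_[set z' | 0 <= front z'] z.
Proof.
have ae_pos (j : nat) : \forall z \ae nu, level `[h j, +oo[ z -> chi z = 1.
  apply: (@weak_star_eq R _ _ nu UF _ _ chi _ mchi chi1 (level_measurable _) (level_fin _) chi_cvg 1 (-1)) => //.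
  - by move=> z; have /andP[] := chi_le1 z; lra.
  have := front_unif (h0 j); apply: filterS => m hm [x t] [[_ /= tT]].
  rewrite in_itv/= andbT => ht; rewrite indicE mem_set//; split.
    by move: tT; rewrite in_itv.
  rewrite -Um_in; last by move: tT; rewrite in_itv.
  by have := hm x t; rewrite ler_norml => /andP[]; lra.
have ae_neg (j : nat) : \forall z \ae nu, level `]-oo, - h j] z -> chi z = 0.
  apply: (@weak_star_eq R _ _ nu UF _ _ chi _ mchi chi1 (level_measurable _) (level_fin _) chi_cvg 0 1) => //.
  - by move=> z; have /andP[] := chi_le1 z; lra.
  have h2 : 0 < h j / 2 by rewrite divr_gt0.
  have := front_unif h2; apply: filterS => m hm [x t] [[_ /= tT]].
  rewrite in_itv/= => ht; rewrite indicE memNset// => -[/= tT'].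
  rewrite -Um_in// => uge.
  by have := hm x t; rewrite ler_norml => /andP[]; have := h0 j; lra.
have /ae_foralln h1 := ae_pos; have /ae_foralln h2 := ae_neg.
apply: (@filterS2 _ _ (ae_filter_ringOfSetsType nu) _ _ _ _ h1 h2) => -[x t] {}h1 {}h2 /= tT.
have small a : 0 < a -> exists j, h j <= a.
  move=> a0; have [j _ /(_ j (leqnn _))] : \forall j \near \oo, `|0 - h j| <= a.
    by have /cvgrPdist_le/(_ _ a0) := @cvg_harmonic R.
  by rewrite sub0r normrN => hj; exists j; exact: le_trans (ler_norm _) hj.
have inO : cube r1 x -> space_time (x, t) by move=> xc; split => //=; rewrite in_itv.
rewrite !indicE; have /andP[c0 c1] := chi_le1 (x, t).
have [fneg|fpos|f0] := ltrgtP (front (x, t)) 0.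
- rewrite memNset/=; last by move: fneg; lra.
  rewrite memNset/=; last by move: fneg; lra.
  have [xc|xc] := pselect (cube r1 x); last first.
    have /andP[_] := chi01 (x, t); rewrite indicE memNset; last by case.
    by rewrite c0.
  have [j hj] : exists j, h j <= - front (x, t) by apply: small; lra.
  rewrite (h2 j) ?lexx//; split; first exact: inO.
  by rewrite /= in_itv/=; lra.
- rewrite mem_set//= mem_set/=; last exact: ltW.
  have xc : cube r1 x.
    apply: contrapT => /far_cube xr; have := front_far t xr; move: fpos; lra.
  have [j hj] := small _ fpos.
  rewrite (h1 j) ?lexx//; split; first exact: inO.
  by rewrite /= in_itv/= hj.
- rewrite memNset/= ?f0 ?ltxx// c0/= mem_set/= ?f0//.
Qed.
End limit.


(** * Test functions *)

Section strict_differentiability.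
Context {R : realType} {n : nat}.
Local Notation V := 'rV[R]_n.
Variables (A : set (V * R)) (oA : open A) (phi : V * R -> R) (sphi : smooth_on A phi).
Variables (x0 : V) (t0 : R) (Az : A (x0, t0)).
Let p0 := space_gradient phi (x0, t0).
Let a := 'D_dt phi (x0, t0).

Lemma open_cylinder_open (T : R) : open (open_cylinder n T).
Proof.
rewrite /open_cylinder (_ : _ `*` _ = snd @^-1` (`]0, T[%classic : set R)).
  apply: open_comp; [by move=> z _; exact: cvg_snd|exact: interval_open].
by apply/seteqP; split => [[x t] []|[x t]] //=.
Qed.

Let near_box (r : R) (w : V) t : 0 < r -> (forall j, `|w 0 j - x0 0 j| <= r / 2) ->
  `|t - t0| <= r / 2 -> ball ((x0, t0) : V * R) r (w, t).
Proof.
move=> r0 hw ht; have r2 : r / 2 < r by rewrite ltr_pdivrMr// ltr_pMr// ltr1n.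
split => /=.
  by apply/rV_ball => // j; rewrite distrC (le_lt_trans (hw j)).
by rewrite /ball/= distrC (le_lt_trans ht).
Qed.

Let convex (r y z c : R) : 0 <= c <= 1 -> `|y| <= r -> `|y + z| <= r -> `|y + c * z| <= r.
Proof.
move=> /andP[c0 c1]; rewrite !ler_norml => /andP[h1 h2] /andP[h3 h4].
have -> : y + c * z = (1 - c) * y + c * (y + z) by ring.
have k1 : (1 - c) * - r <= (1 - c) * y by rewrite ler_wpM2l// subr_ge0.
have k2 : (1 - c) * y <= (1 - c) * r by rewrite ler_wpM2l// subr_ge0.
have k3 : c * - r <= c * (y + z) by rewrite ler_wpM2l.
have k4 : c * (y + z) <= c * r by rewrite ler_wpM2l.
by apply/andP; split; lra.
Qed.

(** Pass from [x] to [y] one coordinate at a time, then from [t] to [s]. All these segments stay in a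
    box around [(x0, t0)] where the partial derivatives are close to their values at [(x0, t0)],
    so the mean value theorem applies on each of them. *)
Lemma smooth_strict_diff e : 0 < e -> exists2 r, 0 < r & forall x y t s,
  enorm (x - x0) <= r -> enorm (y - x0) <= r -> `|t - t0| <= r -> `|s - t0| <= r ->
  `|phi (y, s) - phi (x, t) - dotp p0 (y - x) - a * (s - t)| <=
    e * (enorm (y - x) + `|s - t|).
Proof.
move=> e0; pose e' := e / (n.+1)%:R; have e'0 : 0 < e' by rewrite divr_gt0.
have cD v : \forall z \near (x0, t0), `|'D_v phi z - 'D_v phi (x0, t0)| <= e'.
  have [/= cD _] := sphi [:: v] Az.
  move: cD => /cvgrPdist_le/(_ _ e'0); apply: filterS => z; by rewrite distrC.
have : \forall z \near (x0, t0), [/\ A z, `|'D_dt phi z - a| <= e' &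
    forall i, `|'D_(dx i) phi z - p0 0 i| <= e'].
  near=> z; split; first by near: z; exact: open_nbhs_nbhs.
    by near: z; exact: cD.
  near: z; apply: filter_forall => i; rewrite /p0 mxE; exact: cD.
move=> /nbhs_ballP[r /= r0 hr].
exists (r / 2); first by rewrite divr_gt0.
move=> x y t s xr yr tr sr.
have xj j : `|x 0 j - x0 0 j| <= r / 2.
  by have := coord_le_enorm (x - x0) j; rewrite !mxE => /le_trans; exact.
have yj j : `|y 0 j - x0 0 j| <= r / 2.
  by have := coord_le_enorm (y - x0) j; rewrite !mxE => /le_trans; exact.
have step (w : V) (k : 'I_n) d : (forall j, `|w 0 j - x0 0 j| <= r / 2) ->
    `|w 0 k - x0 0 k + d| <= r / 2 ->
    `|phi (w + d *: delta_mx 0 k, t) - phi (w, t) - p0 0 k * d| <= e' * `|d|.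
  move=> wr wdr.
  have inb c : 0 <= c <= 1 -> ball ((x0, t0) : V * R) r ((w, t) + (c * d) *: dx k).
    move=> c01; have -> : (w, t) + (c * d) *: dx k = (w + (c * d) *: delta_mx 0 k, t).
      by congr pair; rewrite /= scaler0 addr0.
    apply: near_box => // j; rewrite !mxE /=.
    have [->|jk] := eqVneq j k.
      by rewrite mulr1 addrAC; exact: convex.
    by rewrite mulr0 addr0.
  have [c c01 E] : exists2 c, 0 <= c <= 1 & phi ((w, t) + d *: dx k) - phi (w, t) =
      d * 'D_(dx k) phi ((w, t) + (c * d) *: dx k).
    apply: line_MVT => c c01; have [Ac _ _] := hr _ (inb c c01).
    by have [_] := sphi [::] Ac.
  have -> : (w + d *: delta_mx 0 k, t) = (w, t) + d *: dx k.
    by congr pair; rewrite /= scaler0 addr0.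
  rewrite E mulrC -mulrBl normrM ler_wpM2r//.
  by have [_ _] := hr _ (inb c c01).
(* the path has reached [y] in the first [k] coordinates *)
pose w k : V := \row_j (if (j < k)%N then y 0 j else x 0 j).
have wr k j : `|w k 0 j - x0 0 j| <= r / 2 by rewrite mxE; case: ifP.
have telescope k : (k <= n)%N ->
    `|phi (w k, t) - phi (x, t) - \sum_(j < n | (j < k)%N) p0 0 j * (y 0 j - x 0 j)| <=
    e' * \sum_(j < n | (j < k)%N) `|y 0 j - x 0 j|.
  elim: k => [_|k ih kn].
    have -> : w 0%N = x by apply/rowP => j; rewrite mxE.
    by rewrite !big_pred0_eq !subrr normr0 mulr0.
  pose i := Ordinal kn.
  have split1 (F : 'I_n -> R) : \sum_(j < n | (j < k.+1)%N) F j =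
      F i + \sum_(j < n | (j < k)%N) F j.
    rewrite (bigD1 i)//=; congr (_ + _); apply: eq_bigl => j.
    by rewrite ltnS -val_eqE /= andbC ltn_neqAle.
  rewrite !split1 [leRHS]mulrDr.
  have wk : w k.+1 = w k + (y 0 i - x 0 i) *: delta_mx 0 i.
    apply/rowP => j; rewrite !mxE /= ltnS -val_eqE /=.
    have [jk|jk|jk] := ltngtP j k; rewrite ?mulr0 ?addr0//.
    have -> : j = i by exact: val_inj.
    by rewrite mulr1 addrC subrK.
  have wik : w k 0 i = x 0 i by rewrite mxE /= ltnn.
  have h1 := step (w k) i (y 0 i - x 0 i) (wr k).
  have {}h1 := h1 _; rewrite wik in h1.
  have /h1 {}h1 : `|x 0 i - x0 0 i + (y 0 i - x 0 i)| <= r / 2.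
    by rewrite (_ : _ + _ = y 0 i - x0 0 i)//; ring.
  have h2 := ih (ltnW kn).
  rewrite -wk in h1.
  move: h1 h2; set S1 := \sum_(j < n | _) _; set S2 := \sum_(j < n | _) _.
  set P := phi (w k.+1, t); set Q := phi (w k, t); set X := phi (x, t); set Y := p0 0 i * _.
  move=> h1 h2; have -> : P - X - (Y + S1) = (P - Q - Y) + (Q - X - S1) by ring.
  by rewrite (le_trans (ler_normD _ _))// lerD.
have wn : w n = y by apply/rowP => j; rewrite mxE ltn_ord.
have := telescope n (leqnn n); rewrite wn.
under eq_bigl do rewrite ltn_ord.
under [X in _ <= _ * X]eq_bigl do rewrite ltn_ord.
move=> space.
have inb c : 0 <= c <= 1 -> ball ((x0, t0) : V * R) r ((y, t) + (c * (s - t)) *: dt).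
  move=> c01; have -> : (y, t) + (c * (s - t)) *: dt = (y, t + c * (s - t)).
    by congr pair; rewrite /= ?scaler0 ?addr0// [_ *: 1]mulr1.
  apply: near_box => //; rewrite addrAC; apply: convex => //.
  by rewrite (_ : _ + _ = s - t0)//; ring.
have [c c01 E] : exists2 c, 0 <= c <= 1 & phi ((y, t) + (s - t) *: dt) - phi (y, t) =
    (s - t) * 'D_dt phi ((y, t) + (c * (s - t)) *: dt).
  apply: line_MVT => c c01; have [Ac _ _] := hr _ (inb c c01).
  by have [_] := sphi [::] Ac.
have E' : (y, t) + (s - t) *: dt = (y, s).
  by congr pair; rewrite /= ?scaler0 ?addr0// [_ *: 1]mulr1 addrC subrK.
rewrite E' in E.
have [_ Dt _] := hr _ (inb c c01).
have time : `|phi (y, s) - phi (y, t) - a * (s - t)| <= e' * `|s - t|.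
  by rewrite E mulrC -mulrBl normrM ler_wpM2r.
have sum_le : \sum_(j < n) `|y 0 j - x 0 j| <= n%:R * enorm (y - x).
  rewrite (le_trans (ler_sum _ (G := fun _ => enorm (y - x)) _))//.
    by move=> j _; have := coord_le_enorm (y - x) j; rewrite !mxE.
  by rewrite sumr_const card_ord mulr_natl.
have dE : \sum_(j < n) p0 0 j * (y 0 j - x 0 j) = dotp p0 (y - x).
  by rewrite /dotp; apply: eq_bigr => j _; rewrite !mxE.
rewrite dE in space.
have -> : phi (y, s) - phi (x, t) - dotp p0 (y - x) - a * (s - t) =
  (phi (y, t) - phi (x, t) - dotp p0 (y - x)) + (phi (y, s) - phi (y, t) - a * (s - t)) by ring.
rewrite (le_trans (ler_normD _ _))// (le_trans (lerD space time))//.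
rewrite (le_trans (lerD (ler_wpM2l (ltW e'0) sum_le) (lexx _)))//.
have n1 : 0 < n.+1%:R :> R by [].
rewrite mulrDr lerD//.
  rewrite mulrA ler_wpM2r ?enorm_ge0// /e' -mulrA -[leRHS]mulr1 ler_wpM2l ?(ltW e0)//.
  by rewrite mulrC ler_pdivrMr// mul1r ler_nat.
rewrite ler_wpM2r// /e' ler_pdivrMr// ler_peMr ?(ltW e0)//.
by rewrite ler1n.
Unshelve. all: by end_near.
Qed.
End strict_differentiability.

Section nonlinearity.
Context {R : realType} {n : nat}.
Local Notation V := 'rV[R]_n.

Lemma hamiltonian_bound (T : R) (G : V * R * V -> R) (k : R -> R) (x0 : V) (t0 : R) (p0 : V) (e : R) :
  open_cylinder n T (x0, t0) ->
  {in open_cylinder n T `*` setT, continuous G} ->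
  (exists A B, [/\ nbhs t0 A, nbhs (x0, p0) B &
     \forall t \ae @lebesgue_measure R, A t -> B (x0, p0) -> k t <= G (x0, t, p0)]) ->
  0 < e -> exists2 r, 0 < r &
  \forall s \ae @lebesgue_measure R, `|s - t0| <= r -> k s <= G (x0, t0, p0) + e.
Proof.
move=> z0 Gc [A [B [nA nB ae]]] e0.
have /Gc /cvgrPdist_le/(_ _ e0)[[/= X Y] [nX nY] XY] : (x0, t0, p0) \in open_cylinder n T `*` setT.
  by rewrite inE.
case: nX => -[X1 X2] [/= nX1 nX2] X12.
have nAX : nbhs t0 (A `&` X2) by exact: filterI.
have /nbhs_ballP[r /= r0 hr] := nAX.
exists (r / 2); first by rewrite divr_gt0.
apply: (@filterS _ _ (ae_filter_ringOfSetsType (@lebesgue_measure R)) _ _ _ ae) => s hs sr.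
have [As Xs] : (A `&` X2) s.
  by apply: hr; rewrite /ball/= distrC (le_lt_trans sr)// ltr_pdivrMr// ltr_pMr// ltr1n.
rewrite (le_trans (hs As (nbhs_singleton nB)))//.
have : `|G (x0, t0, p0) - G (x0, s, p0)| <= e.
  apply: (XY (x0, s, p0)); split => /=; last exact: nbhs_singleton.
  by apply: (X12 (x0, s)); split => //=; exact: nbhs_singleton.
by rewrite ler_norml => /andP[]; lra.
Qed.

Lemma near_cylinder_box (T : R) (P : V * R -> Prop) (x0 : V) (t0 : R) : 0 < t0 < T ->
  (\forall z \near within (open_cylinder n T) (nbhs (x0, t0)), P z) ->
  exists2 r, 0 < r & forall x t, enorm (x - x0) <= r -> `|t - t0| <= r -> 0 < t < T /\ P (x, t).
Proof.
move=> t0T; rewrite near_withinE => h.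
have z0 : open_cylinder n T (x0, t0) by split => //=; rewrite in_itv.
have : \forall z \near (x0, t0), open_cylinder n T z /\ P z.
  have h2 := open_nbhs_nbhs (conj (@open_cylinder_open R n T) z0).
  by apply: filterS2 h2 h => z oz; split => //; auto.
move=> /nbhs_ballP[r /= r0 hr]; exists (r / 2); first by rewrite divr_gt0.
move=> x t xr tr; have r2 : r / 2 < r by rewrite ltr_pdivrMr// ltr_pMr// ltr1n.
have [] := hr (x, t); last by rewrite /open_cylinder /= in_itv/= => -[_ ->].
split => /=; last by rewrite /ball/= distrC (le_lt_trans tr).
apply/rV_ball => // j; have := coord_le_enorm (x - x0) j; rewrite !mxE distrC => h1.
by rewrite (le_lt_trans h1)// (le_lt_trans xr).
Qed.
End nonlinearity.


(** * Lipschitz functions have bounded weak derivatives *)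

Section weak_derivative.
Context {R : realType} {n : nat}.
Local Notation V := 'rV[R]_n.
Local Notation X := (V * R)%type.
Local Notation mX := (V * measurableTypeR R)%type.
Local Notation nu := (@lebesgue_rV R n \x @lebesgue_measure R)%E.

Definition space_box (r : R) : set X := cube r `*` `[- r, r].

Lemma measurable_space_box r : measurable (space_box r : set mX).
Proof. by apply: measurableX; [exact: measurable_cube|exact: measurable_itv]. Qed.

Lemma space_box_fin r : (nu (space_box r) < +oo)%E.
Proof.
rewrite /space_box product_measure1E//; last exact: measurable_cube.
have c1 := @lebesgue_cube R n r.
have c2 : (lebesgue_measure (`[(- r)%R, r]%classic : set (measurableTypeR R)) < +oo)%E.
  by rewrite lebesgue_measure_itv/= -EFinB; case: ifP => // _; exact: ltry.
by apply: lte_mul_pinfty => //; rewrite ge0_fin_numE.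
Qed.

Lemma compact_space_box r : compact (space_box r).
Proof. by apply: compact_setX; [exact: compact_cube|exact: segment_compact]. Qed.

Lemma test_function_box (D : set X) phi : test_function D phi ->
  exists2 r, 0 <= r & forall z, ~ space_box r z -> phi z = 0.
Proof.
move=> [_ /compact_bounded[M [_ hM]] _].
exists (`|M| + 1) => [|z nz]; first by rewrite addr_ge0.
apply: contrapT => /eqP z0; apply: nz.
have : `|z| <= `|M| + 1.
  by apply: hM; [rewrite (le_lt_trans (ler_norm _))// ltrDl|exact: subset_closure].
rewrite prod_normE ge_max => /andP[h1 h2]; split.
  by move=> i; rewrite (le_trans _ h1)//; exact: rV_coord_le.
by rewrite /= in_itv/= -ler_norml.
Qed.

Section box_integral.
Variables (r B : R) (k : mX -> R).
Hypotheses (mk : measurable_fun setT k) (kB : forall z, `|k z| <= B).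
Hypothesis k0 : forall z, ~ space_box r z -> k z = 0.

Let k_le z : `|k z| <= B * \1_(space_box r) z.
Proof.
rewrite indicE; have [bz|bz] := pselect (space_box r z); first by rewrite mem_set// mulr1.
by rewrite k0// normr0 memNset// mulr0.
Qed.

Let ibox : nu.-integrable setT (EFin \o (\1_(space_box r) : mX -> R)).
Proof. exact: integrable_indic (measurable_space_box r) (space_box_fin r). Qed.

Lemma integrable_box : nu.-integrable setT (EFin \o k).
Proof.
by apply: (integrable_le measurableT (integrable_scale B measurableT ibox)).
Qed.

Lemma Rintegral_box_le : `|\int[nu]_z k z| <= B * fine (nu (space_box r)).
Proof.
rewrite -(Rintegral_indic nu (measurable_space_box r)) -RintegralZl//.
by apply: Rintegral_abs_le => //; exact: integrable_scale.
Qed.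
End box_integral.

Variables (U : set_system nat) (UU : UltraFilter U) (Uoo : \oo `<=` U).
Variables (f : X -> R) (e : X) (C : R) (Om D : set X).
Hypotheses (f_cont : continuous f) (f1 : forall z, `|f z| <= 1) (C0 : 0 < C).
Hypothesis f_lip : forall z s, `|f (z + s *: e) - f z| <= C * `|s|.
Hypotheses (mOm : measurable (Om : set mX)) (Omfin : (nu Om < +oo)%E).
Hypothesis f_flat : forall z s, D z -> ~ Om z -> `|s| <= 1 -> f (z + s *: e) = f z.

Let h (m : nat) : R := m.+1%:R^-1.
Let h0 m : 0 < h m. Proof. by rewrite invr_gt0. Qed.
Let h1 m : `|h m| <= 1. Proof. by rewrite ger0_norm ?(ltW (h0 m))// invf_le1// ler1n. Qed.

Let q m (z : mX) : R := (f (z + h m *: e) - f z) / h m.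

Let qC m z : `|q m z| <= C.
Proof.
rewrite /q normrM normfV ler_pdivrMr ?normr_gt0 ?gt_eqF//; exact: f_lip.
Qed.

Let mf : measurable_fun setT (f : mX -> R).
Proof. exact: rVR_continuous_measurable. Qed.

Let m_shift (k : X -> R) a : continuous k -> measurable_fun setT ((fun z => k (z + a)) : mX -> R).
Proof.
move=> ck; apply: (measurableT_comp (rVR_continuous_measurable ck)).
by have [] := @space_time_shift R n a.
Qed.

Let mq m : measurable_fun setT (q m).
Proof.
apply: measurable_funM; last exact: measurable_cst.
by apply: measurable_funB => //; exact: m_shift.
Qed.

(* weak-star compactness is available for functions between 0 and an indicator *)
Let p m (z : mX) : R := (q m z + C) / (2 * C) * \1_Om z.

Let p01 m z : 0 <= p m z <= \1_Om z.
Proof.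
have /andP[q1 q2] : - C <= q m z <= C by rewrite -ler_norml.
have h2 : 0 <= (q m z + C) / (2 * C) <= 1.
  rewrite divr_ge0 ?mulr_ge0 ?(ltW C0)//=; last by lra.
  by rewrite ler_pdivrMr ?mulr_gt0// mul1r; lra.
have i0 : 0 <= (\1_Om z : R) by rewrite indicE.
have /andP[? ?] := h2; rewrite /p mulr_ge0//= ler_piMl//.
Qed.

Let mp m : measurable_fun setT (p m).
Proof.
apply: measurable_funM; last exact: measurable_indic.
apply: measurable_funM; last exact: measurable_cst.
by apply: measurable_funD => //; exact: measurable_cst.
Qed.

(** By invariance under translations the difference quotient is moved onto [phi], where it converges
    at rate [h m] to [- 'D_e phi]. *)
Let difference_quotient phi : test_function D phi ->
  \int[nu]_z (q m z * phi z) @[m --> U] --> - \int[nu]_z (f z * 'D_e phi z).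
Proof.
move=> tphi; have [sphi csupp suppD] := tphi; have /smoothP sm := sphi.
have [r r0 phi0] := test_function_box tphi.
pose K := space_box r; have cK := @compact_space_box r : compact K.
have [B B0 hB] := taylor_bound cK e sm phi0.
have cphi := smooth_continuous sm.
have sD := smooth_derive e sm; have cD := smooth_continuous sD.
have D0 := vanish_derive cK e phi0.
have [c1 _ hc1] := vanish_bounded cK cphi phi0.
have [c2 _ hc2] := vanish_bounded cK cD D0.
have mphi : measurable_fun setT (phi : mX -> R) by exact: rVR_continuous_measurable.
have mDphi : measurable_fun setT ('D_e phi : mX -> R) by exact: rVR_continuous_measurable.
pose r' := r + `|e|.
have shrink z (m : nat) : ~ space_box r' z -> ~ space_box r (z - h m *: e).
  move=> nz [h1' h2']; apply: nz; rewrite /r'; split.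
    move=> i; have := h1' i; rewrite !mxE => hi.
    have -> : z.1 0 i = (z.1 0 i - h m * e.1 0 i) + h m * e.1 0 i by ring.
    rewrite (le_trans (ler_normD _ _))// lerD// normrM (le_trans _ (_ : 1 * `|e.1 0 i| <= _))//.
      by rewrite ler_wpM2r.
    by rewrite mul1r (le_trans (rV_coord_le _ _))// prod_normE le_max lexx.
  move: h2'; rewrite /= !in_itv/= -!ler_norml => hi.
  have -> : z.2 = (z.2 - h m * e.2) + h m * e.2 by ring.
  rewrite (le_trans (ler_normD _ _))// lerD// normrM (le_trans _ (_ : 1 * `|e.2| <= _))//.
    by rewrite ler_wpM2r.
  by rewrite mul1r prod_normE le_max lexx orbT.
have rr' z : ~ space_box r' z -> ~ space_box r z.
  move=> nz [hz1 hz2]; apply: nz; split => [i|]; rewrite ?(le_trans (hz1 i)) ?lerDl//.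
  move: hz2; rewrite /= !in_itv/= -!ler_norml => hz2.
  by rewrite (le_trans hz2)// lerDl.
pose W := fine (nu (space_box r')).
have W0 : 0 <= W by rewrite /W fine_ge0.
pose J := \int[nu]_z (f z * 'D_e phi z).
have key m : `|- J - \int[nu]_z (q m z * phi z)| <= h m * (B * W).
  have i1 : nu.-integrable setT (EFin \o ((fun z => f z * phi z) : mX -> R)).
    apply: (@integrable_box r c1) => [|z|z nz]; first exact: measurable_funM.
      by rewrite normrM (le_trans _ (hc1 z))// ler_piMl.
    by rewrite phi0// mulr0.
  have i2 : nu.-integrable setT (EFin \o ((fun z => f z * 'D_e phi z) : mX -> R)).
    apply: (@integrable_box r c2) => [|z|z nz]; first exact: measurable_funM.
      by rewrite normrM (le_trans _ (hc2 z))// ler_piMl.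
    by rewrite D0// mulr0.
  have i3 : nu.-integrable setT (EFin \o ((fun z => f z * phi (z - h m *: e)) : mX -> R)).
    apply: (@integrable_box r' c1) => [|z|z nz].
    - by apply: measurable_funM => //; exact: m_shift.
    - by rewrite normrM (le_trans _ (hc1 (z - h m *: e)))// ler_piMl.
    - by rewrite phi0 ?mulr0//; exact: shrink.
  have pres := @space_time_shift R n (h m *: e).
  have E z : f (z + h m *: e) * phi z = (fun y => f y * phi (y - h m *: e)) (z + h m *: e).
    by rewrite /= addrK.
  have i4 : nu.-integrable setT (EFin \o ((fun z => f (z + h m *: e) * phi z) : mX -> R)).
    have := integrable_preserves pres i3; congr integrable.
    by apply/funext => z; rewrite /= addrK.
  have I4 : \int[nu]_z (f (z + h m *: e) * phi z) = \int[nu]_z (f z * phi (z - h m *: e)).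
    rewrite -(Rintegral_preserves pres (F := fun z => f z * phi (z - h m *: e))).
      by apply: eq_Rintegral => z _; rewrite -E.
    exact: integrable_measurable i3.
  have -> : \int[nu]_z (q m z * phi z) =
      (h m)^-1 * (\int[nu]_z (f z * phi (z - h m *: e)) - \int[nu]_z (f z * phi z)).
    rewrite -I4 -RintegralB// -RintegralZl//; last exact: integrable_sub.
    by apply: eq_Rintegral => z _; rewrite /q; ring.
  have -> : - J = (h m)^-1 * ((- h m) * J).
    by field; rewrite gt_eqF.
  rewrite /J -mulrBr -RintegralB// -RintegralZl// -RintegralB//; last 2 first.
  - exact: integrable_scale.
  - exact: integrable_sub.
  rewrite normrM gtr0_norm ?invr_gt0// ler_pdivrMl//.
  have -> : h m * (h m * (B * W)) = h m ^+ 2 * B * W by ring.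
  apply: Rintegral_box_le.
  - apply: measurable_funB; first by apply: measurable_funM => //; exact: measurable_funM.
    by apply: measurable_funB; [exact: integrable_measurable i3|exact: measurable_funM].
  - move=> z; have -> : - h m * (f z * 'D_e phi z) - (f z * phi (z - h m *: e) - f z * phi z) =
      - (f z * (phi (z + (- h m) *: e) - phi z - (- h m) * 'D_e phi z)).
      by rewrite scaleNr; ring.
    rewrite normrN normrM (le_trans _ (le_trans (hB z (- h m)) _)) ?ler_piMl//.
    by rewrite sqrrN.
  - by move=> z nz; rewrite D0 ?phi0 ?mulr0 ?subrr//; [exact: rr'|exact: shrink|exact: rr'].
apply/cvgrPdist_le => eps eps0.
have BW0 : 0 <= B * W by rewrite mulr_ge0.
pose d := eps / (B * W + 1); have d0 : 0 < d by rewrite divr_gt0// ltr_wpDl.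
have : \forall m \near U, `|0 - h m| <= d.
  by apply: Uoo; have /cvgrPdist_le/(_ _ d0) := @cvg_harmonic R.
apply: filterS => m hm; rewrite (le_trans (key m))//.
have hmd : h m <= d by move: hm; rewrite sub0r normrN; apply: le_trans; exact: ler_norm.
rewrite (le_trans (ler_wpM2r BW0 hmd))// /d mulrAC ler_pdivrMr ?ltr_wpDl//.
by rewrite ler_wpM2l ?(ltW eps0)// lerDl.
Qed.

(** The difference quotients of [f] are bounded by its Lipschitz constant, and their weak-star limit
    is a weak derivative. In [D], they are supported in [Om], whose measure is finite. *)
Lemma bounded_weak_derivative : exists g : mX -> R, [/\ measurable_fun setT g,
  forall z, `|g z| <= C &
  forall phi, test_function D phi ->
    \int[nu]_(z in D) (f z * 'D_e phi z) = - \int[nu]_(z in D) (g z * phi z)].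
Proof.
have [g' [mg' g01 g'E]] := @weak_star_limit_prod R _ _ V (measurableTypeR R) (lebesgue_rV n) lebesgue_measure U UU Om mOm Omfin p mp p01.
have i01 z : 0 <= (\1_Om z : R) <= 1 by rewrite indicE; case: (_ \in _); rewrite ?lexx ?ler01.
pose g z := 2 * C * g' z - C * \1_Om z.
have mg : measurable_fun setT g.
  apply: measurable_funB; first by apply: measurable_funM => //; exact: measurable_cst.
  by apply: measurable_funM; [exact: measurable_cst|exact: measurable_indic].
exists g; split => // [z|phi tphi].
  have /andP[a1 a2] := g01 z; have /andP[b1 b2] := i01 z.
  have c1 : 0 <= C * g' z by rewrite mulr_ge0// ltW.
  have c2 : C * g' z <= C * \1_Om z by rewrite ler_wpM2l// ltW.
  have c3 : C * \1_Om z <= C * 1 by rewrite ler_wpM2l// ltW.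
  rewrite ler_norml /g -mulrA; move: c1 c2 c3.
  by move: (C * g' z) (C * \1_Om z) => x y; lra.
have [sphi csupp suppD] := tphi; have /smoothP sm := sphi.
have [r r0 phi0] := test_function_box tphi.
have phiD z : ~ D z -> phi z = 0.
  move=> nD; apply: contrapT => /eqP z0; apply: nD; apply: suppD.
  exact: subset_closure.
have phi_supp z : ~ closure [set x | phi x != 0] z -> phi z = 0.
  move=> nz; apply: contrapT => /eqP z0; apply: nz; exact: subset_closure.
have DD z : ~ D z -> 'D_e phi z = 0.
  by move=> nD; apply: (vanish_derive csupp) => // /suppD.
have mkcond (k : mX -> R) : (forall z, ~ D z -> k z = 0) ->
    \int[nu]_(z in D) k z = \int[nu]_z k z.
  move=> k0; rewrite Rintegral_mkcond; apply: eq_Rintegral => z _; rewrite patchE.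
  by case: ifPn => //; rewrite notin_setE => /k0.
rewrite mkcond; last by move=> z /DD ->; rewrite mulr0.
rewrite mkcond; last by move=> z /phiD ->; rewrite mulr0.
have [c1 _ hc1] := vanish_bounded (@compact_space_box r) (smooth_continuous sm) phi0.
have mphi : measurable_fun setT (phi : mX -> R).
  exact: rVR_continuous_measurable (smooth_continuous sm).
have iphi : nu.-integrable setT (EFin \o (phi : mX -> R)).
  exact: (@integrable_box r c1).
have i0 : nu.-integrable setT (EFin \o (fun z : mX => \1_Om z * phi z)).
  apply: integrable_mul_le1 => // z _; have /andP[? ?] := i01 z.
  by rewrite ger0_norm.
have ip m : nu.-integrable setT (EFin \o (fun z => p m z * phi z)).
  apply: integrable_mul_le1 => // z _; have /andP[? h2] := p01 m z.
  by have /andP[_] := i01 z; rewrite ger0_norm//; exact: le_trans.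
have ig' : nu.-integrable setT (EFin \o (fun z => g' z * phi z)).
  apply: integrable_mul_le1 => // z _; have /andP[? h2] := g01 z.
  by have /andP[_] := i01 z; rewrite ger0_norm//; exact: le_trans.
have qE m : \int[nu]_z (q m z * phi z) =
    2 * C * \int[nu]_z (p m z * phi z) - C * \int[nu]_z (\1_Om z * phi z).
  rewrite -!RintegralZl// -RintegralB//; [|exact: integrable_scale..].
  apply: eq_Rintegral => z _; have [Dz|Dz] := pselect (D z); last by rewrite phiD// !mulr0 subrr.
  rewrite /p indicE; have [Oz|Oz] := pselect (Om z).
    by rewrite mem_set//=; field; rewrite gt_eqF.
  by rewrite memNset//= /q f_flat// subrr !mulr0n !(mulr0, mul0r) subrr.
have l1 := difference_quotient tphi.
have l2 : \int[nu]_z (q m z * phi z) @[m --> U] --> \int[nu]_z (g z * phi z).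
  have -> : \int[nu]_z (g z * phi z) =
      2 * C * \int[nu]_z (g' z * phi z) - C * \int[nu]_z (\1_Om z * phi z).
    rewrite -!RintegralZl// -RintegralB//; [|exact: integrable_scale..].
    by apply: eq_Rintegral => z _; rewrite /g; ring.
  rewrite (_ : (fun m => _) = fun m =>
    2 * C * \int[nu]_z (p m z * phi z) - C * \int[nu]_z (\1_Om z * phi z)); last exact/funext.
  by apply: cvgB; [apply: cvgM; [exact: cvg_cst|exact: g'E]|exact: cvg_cst].
by apply: (canRL opprK); exact: (cvg_unique _ l1 l2).
Qed.
End weak_derivative.


(** * The weak solution *)

Section envelopes.
Context {R : realType} {n : nat}.
Variables (D : set ('rV[R]_n * R)) (u : 'rV[R]_n * R -> R).
Hypothesis u_cont : continuous u.

Let limf_esup_continuous (f : 'rV[R]_n * R -> R) z : continuous f -> D z ->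
  limf_esup (EFin \o f) (within D (nbhs z)) = (f z)%:E.
Proof.
move=> f_cont Dz; apply/eqP; rewrite eq_le; apply/andP; split.
  apply/lee_addgt0Pr => e e0; apply: ereal_inf_le.
  exists (ereal_sup ((EFin \o f) @` [set y | `|f z - f y| <= e])).
    exists [set y | `|f z - f y| <= e] => //.
    rewrite /within /=; have /cvgrPdist_le/(_ _ e0) := f_cont z.
    by apply: filterS.
  apply: ub_ereal_sup => _ [y /= yz <-]; rewrite -EFinD lee_fin.
  by move: yz; rewrite ler_norml => /andP[]; lra.
apply: le_ereal_inf_tmp => _ [W zW <-]; apply: ereal_sup_ubound.
exists z => //; exact: nbhs_singleton zW Dz.
Qed.

Lemma usc_envelope_continuous z : D z -> usc_envelope D u z = u z.
Proof. by move=> Dz; rewrite /usc_envelope limf_esup_continuous. Qed.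

Lemma lsc_envelope_continuous z : D z -> lsc_envelope D u z = u z.
Proof.
move=> Dz; rewrite /lsc_envelope /limf_einf.
rewrite (_ : (fun x => _) = EFin \o (fun y => - u y)); last exact/funext.
rewrite limf_esup_continuous//; first by rewrite /= opprK.
by move=> y; apply: continuousN; exact: u_cont.
Qed.
End envelopes.

Section scheme.
Context {R : realType} {n : nat}.
Local Notation V := 'rV[R]_n.
Variables (T : R) (c0 : R -> V -> R) (c1 : V * R -> R) (u0 : V -> R).

(** The velocity of a step is computed from the front at the beginning of the step, which decouples
    the nonlocal term from the evolution. *)
Definition scheme_velocity (h : R) (k : nat) (v : V -> R) (x : V) : R :=
  if k%:R * h < T then velocity c0 c1 (k%:R * h) \1_[set y | 0 <= v y] x else 0.

Fixpoint scheme (h : R) (k : nat) : V -> R :=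
  if k is k'.+1 then front_step h (scheme_velocity h k' (scheme h k')) (scheme h k')
  else u0.

Variables (M L K0 : R).
Hypotheses (M0 : 0 <= M) (L0 : 0 <= L) (K00 : 0 <= K0).
Hypothesis velML : forall t (f : V -> R), 0 <= t < T -> measurable_fun setT f ->
  (forall y, 0 <= f y <= 1) ->
    (forall x, `|velocity c0 c1 t f x| <= M) /\
    (forall x y, `|velocity c0 c1 t f x - velocity c0 c1 t f y| <= L * enorm (x - y)).
Hypothesis u01 : forall x, -1 <= u0 x <= 1.
Hypothesis u0K : forall x y, `|u0 x - u0 y| <= K0 * enorm (x - y).

Lemma indic01 (Y : Type) (A : set Y) y : 0 <= (\1_A y : R) <= 1.
Proof. by rewrite indicE; case: (_ \in _); rewrite ?lexx ?ler01. Qed.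

Let velocity_bounds h k v : 0 <= h -> continuous v ->
  (forall x, `|scheme_velocity h k v x| <= M) /\
  (forall x y, `|scheme_velocity h k v x - scheme_velocity h k v y| <= L * enorm (x - y)).
Proof.
move=> h0 vc; rewrite /scheme_velocity; case: ltP => kT; last first.
  by split => *; rewrite ?subrr normr0// mulr_ge0// enorm_ge0.
apply: velML; first by rewrite kT mulr_ge0.
  apply: measurable_indic; rewrite -[X in measurable X]setTI.
  have := rV_continuous_measurable vc measurableT (measurable_itv `[0, +oo[).
  by congr measurable; apply/seteqP; split => y /=; rewrite in_itv/= andbT.
by move=> y; exact: indic01.
Qed.

(** The velocity is controlled once the superlevel set of the front is measurable, and the next front
    is Lipschitz once the velocity is: both properties propagate together. *)
Let scheme_regular h k : 0 <= h -> (forall x, -1 <= scheme h k x <= 1) /\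
  exists2 K, 0 <= K & forall x y, `|scheme h k x - scheme h k y| <= K * enorm (x - y).
Proof.
move=> h0; elim: k => [|k [r1 [K K_ge0 hK]]]; first by split => //; exists K0.
have [_ lip] := velocity_bounds k h0 (enorm_lipschitz_continuous hK).
split; first by move=> x; exact: front_step_range.
have b1 x : `|scheme h k x| <= 1 by rewrite ler_norml.
exists (K * (1 + h * L)) => [|x y]; first by rewrite mulr_ge0// addr_ge0// mulr_ge0.
by rewrite -mulrA; exact: (front_step_lip h0 L0 x y b1 K_ge0 hK lip).
Qed.

Lemma scheme_velocity_le h k x : 0 <= h -> `|scheme_velocity h k (scheme h k) x| <= M.
Proof.
move=> h0; have [_ [K _ hK]] := scheme_regular k h0.
by have [+ _] := velocity_bounds k h0 (enorm_lipschitz_continuous hK).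
Qed.

Lemma scheme_velocity_lip h k x y : 0 <= h ->
  `|scheme_velocity h k (scheme h k) x - scheme_velocity h k (scheme h k) y| <= L * enorm (x - y).
Proof.
move=> h0; have [_ [K _ hK]] := scheme_regular k h0.
by have [_] := velocity_bounds k h0 (enorm_lipschitz_continuous hK).
Qed.
End scheme.

Section solution.
Context {R : realType} {n : nat}.
Local Notation V := 'rV[R]_n.
Local Notation mu := (@lebesgue_rV R n).
Local Notation lam := (@lebesgue_measure R).
Local Notation nu := (mu \x lam)%E.
Variables (T : R) (T0 : 0 < T) (c0 : R -> V -> R) (c1 : V * R -> R) (u0 : V -> R).
Variables (M L K0 R0 C0 M1 : R).
Hypotheses (M0 : 0 <= M) (L0 : 0 <= L) (K00 : 0 <= K0).
Hypothesis c0_cont : continuous_L1 T c0.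
Hypothesis c0_C0 : forall t, 0 <= t < T -> \int[mu]_x `|c0 t x| <= C0.
Hypothesis c1_cont : {within cylinder n T, continuous c1}.
Hypothesis c1_bound : forall x t, t \in `[0, T[ -> `|c1 (x, t)| <= M1.
Hypothesis velML : forall t (f : V -> R), 0 <= t < T -> measurable_fun setT f ->
  (forall y, 0 <= f y <= 1) ->
    (forall x, `|velocity c0 c1 t f x| <= M) /\
    (forall x y, `|velocity c0 c1 t f x - velocity c0 c1 t f y| <= L * enorm (x - y)).
Hypothesis u01 : forall x, -1 <= u0 x <= 1.
Hypothesis u0K : forall x y, `|u0 x - u0 y| <= K0 * enorm (x - y).
Hypothesis u0far : forall x, R0 <= enorm x -> u0 x = -1.
Variables (UF : set_system nat) (UU : UltraFilter UF) (Uoo : \oo `<=` UF).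

Let h := time_step R.
Let h0 m : 0 < h m. Proof. exact: time_step_gt0. Qed.
Let U m := scheme T c0 c1 u0 (h m).
Let c m k := scheme_velocity T c0 c1 (h m) k (U m k).

Let UO m : U m 0%N = u0. Proof. by []. Qed.
Let US m k : U m k.+1 = front_step (h m) (c m k) (U m k). Proof. by []. Qed.
Let cM m k x : `|c m k x| <= M.
Proof. exact: (scheme_velocity_le M0 L0 K00 velML u01 u0K _ _ (ltW (h0 m))). Qed.
Let cL m k x y : `|c m k x - c m k y| <= L * enorm (x - y).
Proof. exact: (scheme_velocity_lip M0 L0 K00 velML u01 u0K _ _ _ (ltW (h0 m))). Qed.

Let u : V * R -> R := front T U UF.

Let u_cont : continuous u.
Proof. exact: (front_continuous UU Uoo T0 M0 L0 K00 UO US cM cL u01 u0K). Qed.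

Let u1 z : `|u z| <= 1.
Proof. exact: (front_bound T UU UO US u01). Qed.

Let u_lip x y t s :
  `|u (x, t) - u (y, s)| <= K0 * expR (L * T) * enorm (x - y) + K0 * expR (L * T) * M * `|t - s|.
Proof. exact: (front_lip UU Uoo T0 M0 L0 K00 UO US cM cL u01 u0K). Qed.

Section level_density.
Variables (chi : V * measurableTypeR R -> R) (mchi : measurable_fun setT chi).
Hypothesis chi01 : forall z, 0 <= chi z <= 1.
Hypothesis chi_cvg : forall phi, nu.-integrable setT (EFin \o phi) ->
    \int[nu]_z (\1_(front_set T U m) z * phi z) @[m --> UF] --> \int[nu]_z (chi z * phi z).
Let cbar x t := velocity c0 c1 t (fun y : V => chi (y, t)) x.

Let mset m : measurable_fun setT (\1_(front_set T U m) : V * measurableTypeR R -> R).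
Proof.
apply: measurable_indic.
exact: (front_set_measurable T L0 K00 UO US cL u01 u0K m).
Qed.

Let velocityE m x s : 0 < s < T ->
  c m (time_index h m s) x =
  velocity c0 c1 (floor_time (h m) s) (fun y : V => \1_(front_set T U m) (y, s)) x.
Proof.
move=> /andP[s0 sT]; have [/andP[f0 fs] _] := floor_time_itv (h0 m) (ltW s0).
rewrite /c /scheme_velocity -/(floor_time (h m) s) (le_lt_trans fs sT).
congr velocity; apply/funext => y; rewrite !indicE; congr (nat_of_bool _)%:R.
apply/idP/idP; rewrite !inE /front_set /=; last by case.
by rewrite s0 sT.
Qed.

Let ic x m : lam.-integrable `]0, T[ (EFin \o (fun s => c m (time_index h m s) x)).
Proof.
have := floor_velocity_integrable c0_cont c0_C0 c1_bound x (h0 m) (lexx T) (mset m) (fun z => indic01 _ z).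
by apply: eq_integrable => // s; rewrite inE/= in_itv/= => sT; rewrite velocityE.
Qed.

Let icbar x : lam.-integrable `]0, T[ (EFin \o cbar x).
Proof.
apply: (velocity_integrable c0_cont c0_C0 c1_cont c1_bound mchi chi01 (M := M)) => //.
by move=> t f tT mf f01; have [] := velML tT mf f01.
Qed.

Let U1 m k x : `|U m k x| <= 1.
Proof. exact: (scheme_bound (ltW (h0 m)) (UO m) (US m) u01). Qed.

Let hU : h @ UF --> 0. Proof. exact: time_step_cvg. Qed.

Let c_cvg x0 t0 : 0 < t0 < T -> exists2 r, 0 < r & forall e, 0 < e -> \forall m \near UF,
  forall t, `|t - t0| <= r ->
    `|\int[lam]_(s in `]0, t[) (c m (time_index h m s) x0 - cbar x0 s)| <= e.
Proof.
move=> t0T; have /andP[t00 t0T'] := t0T.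
have velM t (f : V -> R) : 0 <= t < T -> measurable_fun setT f ->
  (forall y, 0 <= f y <= 1) -> forall x, `|velocity c0 c1 t f x| <= M.
  by move=> tT mf f01; have [] := velML tT mf f01.
have [r r0 hr] := integral_velocity_unif c0_cont c0_C0 c1_cont c1_bound mchi chi01 _
  h0 hU mset (fun m z => indic01 _ z) chi_cvg M0 velM x0 t0T.
exists (Num.min r ((T - t0) / 2)) => [|e e0].
  by rewrite lt_min r0 divr_gt0// subr_gt0.
apply: filterS (hr e e0) => m hm t; rewrite le_min => /andP[tr tT].
have {}tT : t < T by move: tT; rewrite ler_norml => /andP[_]; lra.
have := hm t tr; congr (`|_| <= _); apply: eq_Rintegral => s.
rewrite inE/= in_itv/= => /andP[s0 st]; rewrite velocityE// s0; exact: lt_trans tT.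
Qed.

Let U_cvg x0 t0 : 0 < t0 < T -> exists2 r, 0 < r & forall e, 0 < e -> \forall m \near UF,
  forall x k, enorm (x - x0) <= r -> `|k%:R * h m - t0| <= r ->
    `|U m k x - u (x, k%:R * h m)| <= e.
Proof.
move=> /andP[t00 t0T]; exists ((T - t0) / 2) => [|e e0]; first by rewrite divr_gt0// subr_gt0.
have := front_unif UU Uoo T0 M0 L0 K00 UO US cM cL u01 u0K u0far e0.
apply: filterS => m hm x k _ kt; have := hm x (k%:R * h m); rewrite grid_front_index//.
by change (k%:R * h m <= T); move: kt; rewrite ler_norml => /andP[_]; lra.
Qed.

Let u_time x0 t0 e : 0 < e -> exists2 d, 0 < d &
  forall t, `|t - t0| <= d -> `|u (x0, t) - u (x0, t0)| <= e.
Proof.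
move=> e0; pose K := K0 * expR (L * T) * M.
have K_ge0 : 0 <= K by rewrite !mulr_ge0// expR_ge0.
exists (e / (K + 1)) => [|t tt0]; first by rewrite divr_gt0// ltr_wpDl.
rewrite (le_trans (u_lip _ _ _ _))// subrr enorm0 mulr0 add0r -/K.
rewrite (le_trans (ler_wpM2l K_ge0 tt0))// mulrA ler_pdivrMr ?ltr_wpDl//.
by rewrite mulrDr mulr1 mulrC lerDl ltW.
Qed.

Lemma front_subsolution : L1_subsolution T cbar u0 (usc_envelope (cylinder n T) u).
Proof.
have envE z : cylinder n T z -> usc_envelope (cylinder n T) u z = u z.
  exact: usc_envelope_continuous.
split.
- move=> z a Dz; rewrite envE// => za; rewrite near_withinE.
  have : \forall y \near z, u y < a by have /cvgr_lt/(_ _ za) := @u_cont z.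
  by apply: filterS => y ya Dy; rewrite envE.
- move=> x; rewrite envE; last by split => //=; rewrite in_itv/= lexx.
  by rewrite /u (front_init UU T0 UO US u01).
move=> x0 t0 b phi G p0 t0_in ib sphi Gc psi umax [A [B [nA nB ae]]].
have t0T : 0 < t0 < T by move: t0_in; rewrite in_itv.
have z0 : open_cylinder n T (x0, t0) by split => //=; rewrite in_itv.
have oc_c t x : 0 < t < T -> cylinder n T (x, t).
  by move=> /andP[t1 t2]; split => //=; rewrite in_itv/= ltW.
have [r r0 hr] := near_cylinder_box t0T umax.
apply: (scheme_stability _ h0 hU L0 M0 US U1 cM cL t0T ib (icbar x0) (ic x0)
  (u_time x0 t0) (U_cvg x0 t0T) (c_cvg x0 t0T) (p0 := p0) (phi := phi)).
- exact: (smooth_strict_diff (@open_cylinder_open R n T) sphi z0).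
- move=> e e0; apply: (hamiltonian_bound (k := fun s => cbar x0 s * enorm p0 - b s) z0 Gc _ e0).
  exists A, B; split => //.
  apply: (@filterS _ _ (ae_filter_ringOfSetsType (@lebesgue_measure R)) _ _ _ ae) => s hs As Bs.
  exact: hs.
- exists r => // x t xr tr; have [tT] := hr x t xr tr.
  by rewrite /psi !envE//; exact: oc_c.
Qed.

(** The scheme commutes with a simultaneous change of sign of the front and of the velocity, so the
    stability of subsolutions applies to the opposite functions. *)
Lemma front_supersolution : L1_supersolution T cbar u0 (lsc_envelope (cylinder n T) u).
Proof.
have envE z : cylinder n T z -> lsc_envelope (cylinder n T) u z = u z.
  exact: lsc_envelope_continuous.
split.
- move=> z a Dz; rewrite envE// => za; rewrite near_withinE.
  have : \forall y \near z, a < u y by have /cvgr_gt/(_ _ za) := @u_cont z.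
  by apply: filterS => y ya Dy; rewrite envE.
- move=> x; rewrite envE; last by split => //=; rewrite in_itv/= lexx.
  by rewrite /u (front_init UU T0 UO US u01).
move=> x0 t0 b phi G p0 t0_in ib sphi Gc psi umin [A [B [nA nB ae]]].
have t0T : 0 < t0 < T by move: t0_in; rewrite in_itv.
have z0 : open_cylinder n T (x0, t0) by split => //=; rewrite in_itv.
have oc_c t x : 0 < t < T -> cylinder n T (x, t).
  by move=> /andP[t1 t2]; split => //=; rewrite in_itv/= ltW.
have [r r0 hr] := near_cylinder_box t0T umin.
rewrite -lerN2.
have int_opp (f : R -> R) : lam.-integrable `]0, T[ (EFin \o f) ->
    lam.-integrable `]0, T[ (EFin \o (fun s => - f s)).
  move=> intf; rewrite (_ : (fun s => - f s) = fun s => -1 * f s); first exact: integrable_scale.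
  by apply/funext => s; rewrite mulN1r.
have Rint_opp (f : R -> R) t : t <= T -> lam.-integrable `]0, T[ (EFin \o f) ->
    \int[lam]_(s in `]0, t[) (- f s) = - \int[lam]_(s in `]0, t[) f s.
  move=> tT intf; rewrite -mulN1r -RintegralZl//.
    by apply: eq_Rintegral => s _; rewrite mulN1r.
  apply: (integrableS _ _ _ intf) => // s.
  by rewrite /= !in_itv/= => /andP[-> /lt_le_trans]; apply.
apply: (@scheme_stability R n T M L UF _ h (fun m k x => - U m k x) (fun m k x => - c m k x)
  h0 hU L0 M0 _ _ _ _ (fun z => - u z) (fun s => - cbar x0 s) x0 t0 (fun s => - b s)
  (fun z => - phi z) (- p0)).
- by move=> m k; apply/funext => x; rewrite US (front_step_opp _ _ _ (U1 m k)).
- by move=> m k x; rewrite normrN.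
- by move=> m k x; rewrite normrN.
- by move=> m k x y; rewrite -opprD normrN.
- exact: t0T.
- exact: int_opp.
- by apply: int_opp; exact: icbar.
- by move=> m; apply: (int_opp (fun s => c m (time_index h m s) x0)); exact: ic.
- move=> e e0; have [d d0 hd] := u_time x0 t0 e0; exists d => // t td.
  by rewrite -opprD normrN hd.
- have [r' r'0 hr'] := U_cvg x0 t0T; exists r' => // e e0.
  apply: filterS (hr' e e0) => m hm x k xr kr.
  by rewrite -opprD normrN hm.
- have [r' r'0 hr'] := c_cvg x0 t0T; exists (Num.min r' ((T - t0) / 2)) => [|e e0].
    by rewrite lt_min r'0 divr_gt0// subr_gt0; case/andP: t0T.
  apply: filterS (hr' e e0) => m hm t; rewrite le_min => /andP[tr tT].
  have {}tT : t <= T by move: tT; case/andP: t0T => _ ?; rewrite ler_norml => /andP[_]; lra.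
  have := hm t tr; rewrite -normrN -Rint_opp//; last first.
    by have := @integrable_sub R _ _ lam `]0, T[%classic (fun s => c m (time_index h m s) x0) (cbar x0) (measurable_itv _) (ic x0 m) (icbar x0).
  congr (`|_| <= _); apply: eq_Rintegral => s _; by rewrite opprD.
- move=> e e0; have [d d0 hd] := smooth_strict_diff (@open_cylinder_open R n T) sphi z0 e0.
  exists d => // x y t s xd yd td sd; rewrite -normrN.
  have := hd x y t s xd yd td sd; congr (`|_| <= _).
  have -> : dotp (- p0) (y - x) = - dotp p0 (y - x).
    by rewrite -scaleN1r dotpZl mulN1r.
  by rewrite /p0; ring.
- move=> e e0.
  have Gc' : {in open_cylinder n T `*` setT, continuous (fun z => - G z)}.
    by move=> z zD; apply: continuousN; exact: Gc.
  apply: (hamiltonian_bound (G := fun z => - G z) (p0 := p0)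
    (k := fun s => - cbar x0 s * enorm (- p0) - - b s) z0 Gc' _ e0).
  exists A, B; split => //.
  apply: (@filterS _ _ (ae_filter_ringOfSetsType (@lebesgue_measure R)) _ _ _ ae) => s hs As Bs.
  by rewrite enormN mulNr -opprD lerN2 hs.
- pose r' := Num.min r ((T - t0) / 2).
  exists r'; first by rewrite lt_min r0 divr_gt0// subr_gt0; case/andP: t0T.
  move=> x t xr; rewrite le_min => /andP[tr _].
  have xr' : enorm (x - x0) <= r by rewrite (le_trans xr)// ge_min lexx.
  have [tT] := hr x t xr' tr.
  rewrite /psi !envE; [|exact: oc_c..].
  rewrite /= !Rint_opp//; last 2 first.
  + by case/andP: t0T => _ /ltW.
  + by case/andP: tT => _ /ltW.
  by lra.
Qed.

End level_density.

Let r1 := R0 + T * M.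

Lemma front_W1infty : W1infty_cylinder T u.
Proof.
have mu' : measurable_fun setT (u : V * measurableTypeR R -> R).
  exact: rVR_continuous_measurable u_cont.
have bounded (g : V * measurableTypeR R -> R) C : measurable_fun setT g -> (forall z, `|g z| <= C) ->
    ess_bounded (lebesgue_space_time n) (open_cylinder n T) g.
  move=> mg gC; split; first exact: measurable_funTS.
  by exists C; apply: aeW => z _.
(* off the cube of radius [r1 + 1], increments of length at most 1 do not reach the region where
   the front varies *)
pose Om : set (V * measurableTypeR R) := cube (r1 + 1) `*` (`]0, T[%classic : set (measurableTypeR R)).
have mOm : measurable Om by apply: measurableX; [exact: measurable_cube|exact: measurable_itv].
have Omfin : (nu Om < +oo)%E.
  rewrite /Om product_measure1E//; last exact: measurable_cube.
  apply: lte_mul_pinfty => //; last exact: lebesgue_oo_fin.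
  by rewrite ge0_fin_numE//; exact: lebesgue_cube.
pose K := K0 * expR (L * T); have K_ge0 : 0 <= K by rewrite mulr_ge0// expR_ge0.
pose C := K + K * M + 1; have KM : 0 <= K * M by rewrite mulr_ge0.
have C_gt0 : 0 < C by rewrite ltr_wpDl// addr_ge0.
have flat (e : V * R) : (forall i, `|e.1 0 i| <= 1) ->
    forall z s, open_cylinder n T z -> ~ Om z -> `|s| <= 1 -> u (z + s *: e) = u z.
  move=> e1 [x t] s [_ /= tT] nOm s1.
  have /existsNP[i /negP] : ~ cube (r1 + 1) x by move=> cx; apply: nOm; split.
  rewrite -ltNge => xi.
  have far (y : V) : `|y 0 i - x 0 i| <= 1 -> r1 <= enorm y.
    move=> yx; rewrite (le_trans _ (coord_le_enorm y i))//.
    by have := ler_normD (x 0 i - y 0 i) (y 0 i); rewrite subrK distrC; lra.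
  rewrite /u !(front_far UU T0 M0 UO US cM u01 u0far)//=.
  - apply: far; rewrite !mxE addrAC subrr add0r normrM.
    by rewrite (le_trans (ler_pM _ _ s1 (e1 i)))// mulr1.
  - by apply: far; rewrite subrr normr0.
have lip_x (i : 'I_n) z s : `|u (z + s *: dx i) - u z| <= C * `|s|.
  case: z => x t; rewrite (le_trans (u_lip _ _ _ _))//= scaler0 addr0 subrr normr0 mulr0 addr0.
  rewrite addrAC subrr add0r enormZ.
  have d_le : enorm (delta_mx 0 i : V) <= 1.
    rewrite (le_trans (enorm_le_sum _))// (bigD1 i)//= mxE !eqxx normr1 big1 ?addr0// => j ji.
    by rewrite mxE (negbTE ji) andbF normr0.
  rewrite -/K mulrCA mulrC ler_wpM2r// (le_trans (ler_wpM2l K_ge0 d_le))// mulr1 /C.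
  by move: KM; lra.
have lip_t z s : `|u (z + s *: dt) - u z| <= C * `|s|.
  case: z => x t; rewrite (le_trans (u_lip _ _ _ _))//= scaler0 addr0 subrr enorm0 mulr0 add0r.
  rewrite [s *: 1]mulr1 addrAC subrr add0r ler_wpM2r//.
  by rewrite -/K /C; lra.
have dx1 (i j : 'I_n) : `|(dx i).1 0 j| <= 1 :> R.
  by rewrite mxE normr_nat lern1 leq_b1.
have gx i := bounded_weak_derivative UU Uoo u_cont u1 C_gt0 (lip_x i) mOm Omfin (flat _ (dx1 i)).
have dt1 (j : 'I_n) : `|(@dt R n).1 0 j| <= 1 by rewrite mxE normr0.
have [gt [mgt gtC gtE]] := bounded_weak_derivative UU Uoo u_cont u1 C_gt0 lip_t mOm Omfin (flat _ dt1).
have [g gE] := choice gx.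
split; first exact: continuous_subspaceT.
  exact: (bounded _ 1).
exists (fun z => \row_i g i z), gt; split.
- move=> phi tphi; split => [i|]; last exact: gtE.
  have [_ _ /(_ phi tphi) E] := gE i.
  rewrite [LHS]E; congr (- _); apply: eq_Rintegral => z _; by rewrite mxE.
- move=> i; have [mg gC _] := gE i.
  rewrite (_ : (fun z => _) = g i); first exact: (bounded _ C).
  by apply/funext => z; rewrite mxE.
- exact: (bounded _ C).
Qed.

Lemma front_weak_solution : dislocation_weak_solution T c0 c1 u0 u.
Proof.
split; first exact: front_W1infty.
have mset m : measurable_fun setT (\1_(front_set T U m) : V * measurableTypeR R -> R).
  apply: measurable_indic.
  exact: (front_set_measurable T L0 K00 UO US cL u01 u0K m).
have set01 m z : 0 <= (\1_(front_set T U m) z : R) <= \1_(space_time T M R0) z.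
  rewrite !indicE; case: (boolP (z \in front_set _ _ _)) => [|_]; last by rewrite lexx/=.
  rewrite inE => /(front_set_space_time T0 M0 UO US cM u01 u0far) zs.
  by rewrite mem_set// lexx ler01.
have [chi [mchi chi01 chi_cvg]] := @weak_star_limit_prod R _ _ V (measurableTypeR R) mu lam UF UU
  _ (space_time_measurable T M R0) (space_time_fin T M R0) _ mset set01.
have chi1 z : 0 <= chi z <= 1.
  by have /andP[-> /le_trans] := chi01 z; apply; have /andP[] := @indic01 R _ (space_time T M R0) z.
exists chi; split => //.
- exact: measurable_funTS.
- split.
  + split; first by move=> x; exact: (velocity_measurable c0_cont c0_C0 c1_cont c1_bound mchi chi1 x).
    exists M, L; apply: aeW => t; rewrite in_itv/= => /andP[t0 tT] x y.
    have tT' : 0 <= t < T by rewrite ltW.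
    by have [h1 h2] := velML tT' (measurable_slice t mchi) (fun y => chi1 (y, t)); split; [exact: h1|exact: h2].
  + by move=> z _; exists 1; apply: filterE => y.
  + exact: front_subsolution.
  + exact: front_supersolution.
have := front_chi UU Uoo T0 M0 L0 K00 UO US cM cL u01 u0K u0far mchi chi01 chi_cvg.
apply: (@filterS _ _ (ae_filter_ringOfSetsType nu)) => -[x t] hz [_ tT]; apply: hz.
by move: tT; rewrite /= in_itv.
Qed.

End solution.


Theorem theorem1p2 (R : realType) (N : nat) (T : R)
  (N_ge1 : (1 <= N)%N) (T_gt0 : 0 < T)
  (u0 : 'rV[R]_N -> R) (c0 : R -> 'rV[R]_N -> R)
  (Dc0 : 'rV[R]_N * R -> 'rV[R]_N) (c1 : 'rV[R]_N * R -> R)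
  (M0 L0 M1 L1 : R)
  (u0_W1infty : W1infty u0)
  (u0_range : forall x, -1 <= u0 x <= 1)
  (u0_far : exists2 R0 : R, 0 < R0 & forall x, R0 <= enorm x -> u0 x = -1)
  (c0_cont : continuous_L1 T c0)
  (c0_bound : \forall t \ae @lebesgue_measure R, t \in `[0, T[ ->
    (\int[lebesgue_rV N]_x `|c0 t x|%:E <= M0%:E)%E)
  (Dc0_gradient : \forall t \ae @lebesgue_measure R, t \in `[0, T[ ->
    weak_gradient (c0 t) (fun x => Dc0 (x, t)))
  (Dc0_bound : Linfty_L1_bound T Dc0 L0)
  (c1_cont : {within cylinder N T, continuous c1})
  (c1_bound : forall x t, t \in `[0, T[ -> `|c1 (x, t)| <= M1)
  (c1_lipschitz : forall x y t, t \in `[0, T[ ->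
    `|c1 (x, t) - c1 (y, t)| <= L1 * enorm (x - y)) :
  exists u : 'rV[R]_N * R -> R, dislocation_weak_solution T c0 c1 u0 u.
Proof.
have [K0 K00 u0K] := W1infty_lipschitz u0_W1infty.
have [R0 R0_gt0 u0R] := u0_far.
have [M [L [M_ge0 L_ge0 velML]]] :=
  velocity_estimates c0_cont c0_bound Dc0_gradient Dc0_bound c1_bound c1_lipschitz.
have [C0 [_ [_ _ c0_C0 _]]] := c0_estimates c0_cont c0_bound Dc0_gradient Dc0_bound.
have [UF [UU Uoo]] := ultraFilterLemma (eventually_filter : ProperFilter \oo).
by eexists; exact: (front_weak_solution T_gt0 M_ge0 L_ge0 K00 c0_cont c0_C0 c1_cont
  c1_bound velML u0_range u0K u0R UU Uoo).
Qed.
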